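(* Let $\{Z_n\}_{n\ge0}$ be the two-dimensional ($d=2$) branching random walk described in the context, with offspring mean $m=1$ and offspring variance $\sigma^2<\infty$. Suppose $\mathbb{E}[|X|^4]<\infty$ and the correlation coefficient matrix of $X$ is the identity matrix. Then there exists a function $C(\cdot)>0$ with $\lim_{\varepsilon\to0+}C(\varepsilon)=\infty$ such that for any $r,\delta>0$, $$\exp\left\{-\frac{2\pi(1+\delta)r^2}{\sigma^2}-C(\delta)\right\}\le\liminf_{n\to\infty}\mathbb{P}\left(\frac{R_n}{\sqrt n}\ge r\right)\le\limsup_{n\to\infty}\mathbb{P}\left(\frac{R_n}{\sqrt n}\ge r\right)\le\exp\left\{\int_{\mathbb{R}^2}\log\mathbb{P}_{\delta_0}\big(X_1(B(x,r))=0\big)\,dx\right\},$$ where $\{X_t\}_{t\ge0}$ is the two-dimensional critical super-Brownian motion with branching mechanism $\psi(u)=\sigma^2u^2$ started from $\delta_0$.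
   Context: Let $\{p_k\}_{k\ge0}$ be an offspring distribution on $\{0,1,2,\dots\}$ with $p_0<1$, $p_1<1$, mean $m=\sum_k kp_k$ and variance $\sigma^2=\sum_k k^2p_k-m^2$. Let $X$ be an $\mathbb{R}^d$-valued random vector (the displacement) with mean zero whose components are i.i.d. The branching random walk $\{Z_n\}_{n\ge0}$: $Z_0$ is a Poisson random measure on $\mathbb{R}^d$ with Lebesgue intensity (law $\mathbb{P}$); at each generation every particle independently is replaced by a random number of children with law $\{p_k\}$, each child independently displaced from its parent's position by an independent copy of $X$; $Z_n$ is the counting measure of particle positions at generation $n$. Let $B(u)=\{x:|x|<u\}$, $B(x,r)=\{y:|y-x|<r\}$, and $R_n:=\sup\{u>0:Z_n(B(u))=0\}$ (with $\sup\emptyset=0$). The super-Brownian motion $\{X_t\}$ with branching mechanism $\psi(u)=\sigma^2u^2$ is the $M_F(\mathbb{R}^d)$-valued Markov process (finite measures, weak topology) such that for $\mu\in M_F(\mathbb{R}^d)$ and nonnegative continuous $\phi$, $\mathbb{E}_\mu[e^{-\int\phi\,dX_t}]=e^{-\int u(t,x)\mu(dx)}$, where $u$ is the unique positive solution of $\partial_t u=\frac12\Delta u-\sigma^2u^2$, $u(0,\cdot)=\phi$; $\mathbb{P}_{\delta_0}$ denotes its law started from the unit point mass at $0$.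
   Formalization: The condition that the correlation coefficient matrix of X is the identity is read as covariance matrix equal to the identity, so each component of X has variance 1; without unit variance the upper bound fails, e.g. for components ±τ with τ and r small. *)

(* Defs.v *)
From HB Require Import structures.
From mathcomp Require Import all_boot all_order all_algebra.
From mathcomp Require Import all_classical all_reals all_analysis measurable_realfun.
Set Implicit Arguments. Unset Strict Implicit. Unset Printing Implicit Defensive.
Import Order.TTheory GRing.Theory Num.Theory.
Import numFieldNormedType.Exports.
Local Open Scope classical_set_scope.
Local Open Scope ring_scope.

Definition eball (R : realType) (x : R * R) (r : R) : set (R * R) :=
  [set y | Num.sqrt ((y.1 - x.1) ^+ 2 + (y.2 - x.2) ^+ 2) < r].

Definition leb2 (R : realType) := (@lebesgue_measure R \x @lebesgue_measure R)%E.

Definition eln (R : realType) (a : \bar R) : \bar R :=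
  if (0 < fine a)%R then (ln (fine a))%:E else -oo%E.

Definition poisson_pmf (R : realType) (lam : R) (k : nat) : R :=
  expR (- lam) * lam ^+ k / (k`!)%:R.

Definition mutually_independent (d : measure_display) (Omega : measurableType d)
    (R : realType) (P : probability Omega R) (I : Type) (F : I -> set (set Omega)) :=
  forall (n : nat) (f : 'I_n -> I), injective f ->
  forall E : 'I_n -> set Omega, (forall k, F (f k) (E k)) ->
  P (\bigcap_(k in [set: 'I_n]) E k) = (\prod_(k < n) fine (P (E k)))%:E.

(* index set of the random ingredients of the branching random walk:
   the initial Poisson points, and, for each initial particle i and each
   Ulam-Harris word u, the offspring number and the displacement. *)
Inductive brw_idx := IPP | IOff of nat & seq nat | IDisp of nat & seq nat.

Definition preimages (d' : measure_display) (T : measurableType d') (Omega : Type)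
  (Y : Omega -> T) : set (set Omega) := [set Y @^-1` A | A in [set A | measurable A]].

Definition alive (Omega : Type) (N : nat -> seq nat -> Omega -> nat)
  (i : nat) (u : seq nat) (w : Omega) : Prop :=
  forall k, (k < size u)%N -> (nth 0%N u k < N i (take k u) w)%N.

Definition position (R : realType) (Omega : Type) (xi : nat -> Omega -> R * R)
  (X : nat -> seq nat -> Omega -> R * R) (i : nat) (u : seq nat) (w : Omega) : R * R :=
  ((xi i w).1 + \sum_(k < size u) (X i (take k.+1 u) w).1,
   (xi i w).2 + \sum_(k < size u) (X i (take k.+1 u) w).2).

Definition Zn (R : realType) (Omega : Type) (xi : nat -> Omega -> R * R)
  (N : nat -> seq nat -> Omega -> nat) (X : nat -> seq nat -> Omega -> R * R)
  (n : nat) (w : Omega) (A : set (R * R)) : \bar R :=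
  \esum_(p in [set p : nat * seq nat | size p.2 = n /\ alive N p.1 p.2 w
                                       /\ A (position xi X p.1 p.2 w)]) 1%E.

(* R_n = sup {u > 0 : Z_n(B(u)) = 0}, sup of the empty set = 0 *)
Definition Rn (R : realType) (Omega : Type) (xi : nat -> Omega -> R * R)
  (N : nat -> seq nat -> Omega -> nat) (X : nat -> seq nat -> Omega -> R * R)
  (n : nat) (w : Omega) : \bar R :=
  maxe 0%E (ereal_sup [set u%:E | u in
     [set u : R | 0 < u /\ Zn xi N X n w (eball (0, 0) u) = 0%E]]).

Definition poisson_lebesgue (d : measure_display) (Omega : measurableType d)
    (R : realType) (P : probability Omega R) (xi : nat -> Omega -> R * R) :=
  forall (n : nat) (A : 'I_n -> set (R * R)) (k : 'I_n -> nat),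
  (forall j, measurable (A j)) -> (forall j, (@leb2 R (A j) < +oo)%E) ->
  (forall j j', j != j' -> A j `&` A j' = set0) ->
  P (\bigcap_(j in [set: 'I_n])
       [set w | (\sum_(0 <= i <oo) ((xi i w \in A j)%:R : R)%:E)%E = (k j)%:R%:E])
  = (\prod_(j < n) poisson_pmf (fine (@leb2 R (A j))) (k j))%:E.

Definition sbm_pde_solution (R : realType) (s2 : R) (phi : R * R -> R)
    (u : R -> R * R -> R) :=
  (forall x, u 0 x = phi x) /\
  (forall t x, 0 <= t -> 0 <= u t x) /\
  (exists M : R, forall t x, 0 <= t -> `|u t x| <= M) /\
  {within [set p : R * (R * R) | 0 <= p.1], continuous (fun p => u p.1 p.2)} /\
  (forall t a b, 0 < t ->
     derivable (fun s => u s (a, b)) t 1 /\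
     derivable (fun y => u t (y, b)) a 1 /\
     derivable (fun y => u t (a, y)) b 1 /\
     derivable (fun y => 'D_1 (fun z => u t (z, b)) y) a 1 /\
     derivable (fun y => 'D_1 (fun z => u t (a, z)) y) b 1 /\
     'D_1 (fun s => u s (a, b)) t =
       2^-1 * ('D_1 (fun y => 'D_1 (fun z => u t (z, b)) y) a
              + 'D_1 (fun y => 'D_1 (fun z => u t (a, z)) y) b)
       - s2 * (u t (a, b)) ^+ 2).

(* Y is (the time-1 marginal of) the super-Brownian motion with branching
   mechanism psi(u) = s2 u^2 started from delta_0: a random finite measure on
   R^2 whose Laplace functional is E[exp(-<phi,Y>)] = exp(-u(1,0)). *)
Definition sbm_time1_from_delta0 (d : measure_display) (Omega : measurableType d)
    (R : realType) (P : probability Omega R) (s2 : R)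
    (Y : Omega -> {finite_measure set (R * R)%type -> \bar R}) :=
  (forall A, measurable A -> measurable_fun [set: Omega] (fun w => Y w A)) /\
  (forall (phi : R * R -> R), continuous phi -> (forall x, 0 <= phi x) ->
     (exists M : R, forall x, phi x <= M) ->
     forall u, sbm_pde_solution s2 phi u ->
     (\int[P]_w expeR (- \int[Y w]_x (phi x)%:E) = (expR (- u 1 (0, 0)))%:E)%E).

(* Main.v *)
(* Given the initial points, the trees are independent, so for the Poisson initial
   state P(R_n >= a) = exp (- int h_n(x) dx), where h_n(x) is the probability that the
   tree of one particle started at x charges the ball B(a) in generation n; h_n solves
   the recursion h_(n+1) = f (E h_n (. + X)) with f(q) = 1 - g(1 - q) and g the offspring
   generating function.

   Lower bound: inside B(r sqrt(n (1 + delta))), h_n is at most the survival probability,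
   which is asymptotic to 2 / (s2 n); outside, the fourth moment gives
   h_n(x) <= K n / (|x| - r sqrt n)^4, whose integral over the exterior is bounded in n.

   Upper bound: for a smooth phi supported in B(x, r), comparing the recursion with the
   solution u of the equation of the super-Brownian motion gives
   liminf n h_n(- sqrt n x) >= u(1, 0).  Since the Laplace functional of X_1 at phi is
   exp (- u(1, 0)), letting phi grow to +oo on B(x, r) yields
   liminf n h_n(- sqrt n x) >= - log P(X_1(B(x, r)) = 0), and Fatou's lemma concludes.
   The factor s2 q^2 / 2 in the expansion of f leaves room for the weaker reaction term
   s2 u^2 of the equation. *)
Require Import Defs.
From HB Require Import structures.
From mathcomp Require Import all_boot all_order all_algebra ring lra zify.
From mathcomp Require Import all_classical all_reals all_analysis measurable_realfun.
Set Implicit Arguments. Unset Strict Implicit. Unset Printing Implicit Defensive.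
Import Order.TTheory GRing.Theory Num.Theory.
Import numFieldNormedType.Exports.
Local Open Scope classical_set_scope.
Local Open Scope ring_scope.

(** The definition of the super-Brownian marginal speaks only about data [phi] for which a classical
    solution of the equation is at hand, so solutions must be produced. They are limits of an
    explicit scheme that alternates a four-point average with a logistic step and keeps C^{2,1}
    bounds uniform in the mesh. The bounds are carried as Taylor inequalities, and limits along a
    non-principal ultrafilter exist at all points simultaneously, in place of an Arzela-Ascoli
    extraction. Time derivatives come from interpolation between closeness in sup norm and these
    bounds. The tail estimate cannot come from the mean number of particles in the disc: that has
    order [n^2 / rho^4], too large by a factor [n]. The missing factor is gained from the quadratic
    loss in the recursion. Of the displacement only a few moments are known, so expectations are
    estimated by majorants and minorants spanned by quadratic polynomials and [|y|^4]. Independence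
    is exploited by viewing [Omega] under the sigma-algebra of a block of ingredients and redrawing
    one of two independent blocks. *)

(** * Taylor remainders of [(1 - q)^k] *)

Section PowerBounds.
Context {R : realType}.
Implicit Types (q : R) (k : nat).

(** Averaged against a critical offspring law this remainder gives [q - survival_step q], so every
    estimate of the loss per generation can be proved termwise in [k]. *)
Definition taylor_rem q k : R := (1 - q) ^+ k - 1 + k%:R * q.

(** On [[0, 1]] all coefficients are nonnegative, so the bounds below are inductions on [k] without
    calculus. *)
Lemma taylor_remS q k :
  taylor_rem q k.+1 = k%:R * q ^+ 2 + (1 - q) * taylor_rem q k.
Proof. by rewrite /taylor_rem exprS -natr1; ring. Qed.

Lemma taylor_rem_ge0 q k : 0 <= q <= 1 -> 0 <= taylor_rem q k.
Proof.
move=> /andP[q0 q1]; elim: k => [|k IH]; first by rewrite /taylor_rem expr0; lra.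
by rewrite taylor_remS addr_ge0 ?mulr_ge0 ?subr_ge0 ?sqr_ge0.
Qed.

Lemma taylor_rem_ge_sqr q k : 0 <= q <= 1 -> (1 < k)%N -> q ^+ 2 <= taylor_rem q k.
Proof.
case: k => [|[|k]]// q01 _; rewrite taylor_remS -[leLHS]addr0 lerD//.
  by rewrite ler_peMl ?sqr_ge0// ler1n.
by case/andP: (q01) => q0 q1; rewrite mulr_ge0 ?subr_ge0 ?taylor_rem_ge0.
Qed.

(** Twice the optimal [k (k - 1) / 2]: summed over [k] it yields the loss [s2 q^2], with the very
    coefficient of the super-Brownian equation. *)
Lemma taylor_rem_le q k : 0 <= q <= 1 ->
  taylor_rem q k <= (k%:R ^+ 2 - k%:R) * q ^+ 2.
Proof.
move=> /andP[q0 q1]; elim: k => [|k IH]; first by rewrite /taylor_rem expr0; lra.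
rewrite taylor_remS; have Hk := @taylor_rem_ge0 q k.
have h0 : 0 <= taylor_rem q k by apply: Hk; rewrite q0.
have k0 : 0 <= k%:R :> R by [].
have q20 : 0 <= q ^+ 2 by rewrite sqr_ge0.
rewrite -natr1; nra.
Qed.

Lemma taylor_rem_ge q k : 0 <= q <= 1 ->
  (k%:R ^+ 2 - k%:R) / 2 * q ^+ 2 - k%:R ^+ 3 * q ^+ 3 <= taylor_rem q k.
Proof.
move=> /andP[q0 q1]; elim: k => [|k IH].
  by rewrite /taylor_rem expr0 !expr0n /=; lra.
rewrite taylor_remS -natr1.
have k0 : 0 <= k%:R :> R by [].
have H : (1 - q) * ((k%:R ^+ 2 - k%:R) / 2 * q ^+ 2 - k%:R ^+ 3 * q ^+ 3) <=
   (1 - q) * taylor_rem q k by rewrite ler_wpM2l// subr_ge0.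
move: H; set x : R := k%:R in k0 *; set T := (1 - q) * taylor_rem q k => H.
have q30 : 0 <= q ^+ 3 by rewrite exprn_ge0.
have q40 : 0 <= x ^+ 3 * q ^+ 4 by rewrite mulr_ge0// exprn_ge0.
have E1 : 0 <= (x ^+ 2 * 5 / 2 + x * 7 / 2 + 1) * q ^+ 3.
  rewrite mulr_ge0// !addr_ge0 ?mulr_ge0 ?sqr_ge0//.
rewrite -subr_ge0.
have -> : x * q ^+ 2 + T - (((x + 1) ^+ 2 - (x + 1)) / 2 * q ^+ 2 - (x + 1) ^+ 3 * q ^+ 3)
  = (T - (1 - q) * ((x ^+ 2 - x) / 2 * q ^+ 2 - x ^+ 3 * q ^+ 3)) + x ^+ 3 * q ^+ 4
   + ((x ^+ 2 * 5 / 2 + x * 7 / 2 + 1) * q ^+ 3) by field.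
by rewrite addr_ge0// addr_ge0// subr_ge0.
Qed.

End PowerBounds.

Lemma sum_nat_split2 {R : realType} (a : nat -> R) n : (1 < n)%N ->
  \sum_(0 <= k < n) a k = a 0%N + (a 1%N + \sum_(0 <= k < n.-2) a k.+2).
Proof. by case: n => [|[|n]]// _; rewrite big_nat_recl// big_nat_recl. Qed.

(** * The offspring generating function and the decay of the survival probability *)

Section Offspring.
Context {R : realType} (p : nat -> R).
Implicit Types q s t c e : R.
Hypothesis hp_ge0 : forall k, 0 <= p k.
Hypothesis hp_sum : (fun n => \sum_(0 <= k < n) p k) @ \oo --> (1 : R).

Definition pgf (s : R) : R := limn (fun n => \sum_(0 <= k < n) p k * s ^+ k).

Lemma pgf_cvg s : 0 <= s <= 1 ->
  (fun n => \sum_(0 <= k < n) p k * s ^+ k) @ \oo --> pgf s.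
Proof.
move=> /andP[s0 s1]; apply: nondecreasing_is_cvgn.
  apply/nondecreasing_seqP => n; rewrite big_nat_recr//= lerDl.
  by rewrite mulr_ge0// exprn_ge0.
exists 1 => _ [n _ <-].
have : \sum_(0 <= k < n) p k <= 1.
  rewrite -(cvg_lim _ hp_sum)//; apply: nondecreasing_cvgn_le.
    by apply/nondecreasing_seqP => m; rewrite big_nat_recr//= lerDl.
  by apply/cvg_ex; exists 1.
apply: le_trans; apply: ler_sum_nat => k _.
by rewrite ler_piMr// exprn_ile1.
Qed.

Definition survival_step (q : R) : R := 1 - pgf (1 - q).

Let itv_compl (q : R) : 0 <= q <= 1 -> 0 <= 1 - q <= 1.
Proof. by move=> /andP[? ?]; apply/andP; split; lra. Qed.

Hypothesis hp_mean : (fun n => \sum_(0 <= k < n) (k%:R * p k)) @ \oo --> (1 : R).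

(** Criticality enters here: mean 1 cancels the linear term, and only second-order remainders are
    left. *)
Lemma survival_step_rem q : 0 <= q <= 1 ->
  (fun n => \sum_(0 <= k < n) p k * taylor_rem q k) @ \oo --> q - survival_step q.
Proof.
move=> q01; rewrite /survival_step.
have -> : q - (1 - pgf (1 - q)) = pgf (1 - q) - 1 + 1 * q by ring.
rewrite (_ : (fun n => _) = (fun n => \sum_(0 <= k < n) p k * (1 - q) ^+ k
   - \sum_(0 <= k < n) p k + (\sum_(0 <= k < n) (k%:R * p k)) * q)).
  apply: cvgD; last by apply: cvgM => //; exact: cvg_cst.
  by apply: cvgB => //; apply: pgf_cvg; exact: itv_compl.
apply/funext => n; rewrite -sumrB mulr_suml -big_split/=; apply: eq_bigr => k _.
by rewrite /taylor_rem; ring.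
Qed.

Lemma survival_step_le q : 0 <= q <= 1 -> survival_step q <= q.
Proof.
move=> q01; rewrite -subr_ge0; apply: (cvgr_to_ge (survival_step_rem q01)).
by near=> n; apply: sumr_ge0 => k _; rewrite mulr_ge0// taylor_rem_ge0.
Unshelve. all: by end_near. Qed.

Lemma pgf_ge0 s : 0 <= s <= 1 -> 0 <= pgf s.
Proof.
move=> s01; apply: (cvgr_to_ge (pgf_cvg s01)); near=> n.
by apply: sumr_ge0 => k _; rewrite mulr_ge0// exprn_ge0//; case/andP: s01.
Unshelve. all: by end_near. Qed.

Lemma ler_pgf s t : 0 <= s -> s <= t -> t <= 1 -> pgf s <= pgf t.
Proof.
move=> s0 st t1.
apply: (ler_cvg_to (pgf_cvg _) (pgf_cvg _)); rewrite ?s0 ?t1 ?(le_trans st)//.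
  by rewrite (le_trans s0).
by near=> n; apply: ler_sum_nat => k _; rewrite ler_wpM2l// lerXn2r// nnegrE (le_trans s0).
Unshelve. all: by end_near. Qed.

Lemma pgf_le1 s : 0 <= s <= 1 -> pgf s <= 1.
Proof.
move=> s01; apply: (ler_cvg_to (pgf_cvg s01) hp_sum); near=> n.
apply: ler_sum_nat => k _; rewrite ler_piMr// exprn_ile1//; lra.
Unshelve. all: by end_near. Qed.

Lemma survival_step_ge0 q : 0 <= q <= 1 -> 0 <= survival_step q.
Proof. by move=> q01; rewrite subr_ge0 pgf_le1// itv_compl. Qed.

Lemma survival_step_le1 q : 0 <= q <= 1 -> survival_step q <= 1.
Proof. by move=> q01; rewrite lerBlDl lerDr pgf_ge0// itv_compl. Qed.

Lemma ler_survival_step q q' : 0 <= q -> q <= q' -> q' <= 1 ->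
  survival_step q <= survival_step q'.
Proof. by move=> q0 qq' q'1; rewrite lerD2l lerN2 ler_pgf ?subr_ge0 ?lerD2l ?lerN2//; lra. Qed.

(** Each [taylor_rem q k] is nondecreasing in [q], hence so is [q - survival_step q]. This carries
    an additive error through one generation without amplification. *)
Lemma survival_step_lip q q' : 0 <= q -> q <= q' -> q' <= 1 ->
  survival_step q' - survival_step q <= q' - q.
Proof.
move=> q0 qq' q'1.
have q01 : 0 <= q <= 1 by apply/andP; split; lra.
have q'01 : 0 <= q' <= 1 by apply/andP; split; lra.
suff : q - survival_step q <= q' - survival_step q' by lra.
apply: (ler_cvg_to (survival_step_rem q01) (survival_step_rem q'01)).
near=> n; apply: ler_sum_nat => k _; rewrite ler_wpM2l//.
elim: k => [|k IH]; first by rewrite /taylor_rem !expr0; lra.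
have Hq' : 0 <= 1 - q' by lra.
have k0 : 0 <= k%:R :> R by [].
have Hr : taylor_rem q k <= k%:R * q.
  rewrite /taylor_rem; have : (1 - q) ^+ k <= 1 by rewrite exprn_ile1; lra.
  lra.
rewrite !taylor_remS.
have H1 : 0 <= (1 - q') * (taylor_rem q' k - taylor_rem q k).
  by rewrite mulr_ge0// subr_ge0.
have H2 : 0 <= (q' - q) * (k%:R * q - taylor_rem q k) by rewrite mulr_ge0// subr_ge0.
have H3 : 0 <= k%:R * (q' - q) * q' by rewrite !mulr_ge0//; lra.
lra.
Unshelve. all: by end_near. Qed.

(** Only offspring numbers at least 2 contribute, whence the coefficient [P(k >= 2)]: not sharp, but
    valid on all of [[0, 1]]. *)
Lemma survival_step_le_sqr q : 0 <= q <= 1 ->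
  survival_step q <= q - (1 - p 0%N - p 1%N) * q ^+ 2.
Proof.
move=> q01; rewrite lerBrDl -lerBrDr.
have H : (fun n => (\sum_(0 <= k < n) p k - p 0%N - p 1%N) * q ^+ 2) @ \oo
    --> (1 - p 0%N - p 1%N) * q ^+ 2.
  apply: cvgM; last exact: cvg_cst.
  by apply: cvgB; last exact: cvg_cst; apply: cvgB => //; exact: cvg_cst.
apply: (ler_cvg_to H (survival_step_rem q01)); near=> n.
have n1 : (1 < n)%N by near: n; exact: nbhs_infty_ge.
rewrite !(sum_nat_split2 _ n1).
have -> : taylor_rem q 0 = 0 by rewrite /taylor_rem; ring.
have -> : taylor_rem q 1 = 0 by rewrite /taylor_rem; ring.
have E x : p 0%N + (p 1%N + x) - p 0%N - p 1%N = x by ring.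
rewrite !mulr0 !add0r E mulr_suml; apply: ler_sum_nat => k _.
by rewrite ler_wpM2l// taylor_rem_ge_sqr.
Unshelve. all: by end_near. Qed.

Hypothesis hp1 : p 1%N < 1.

(** Otherwise no particle has two children and the mean is [p 1 < 1], against criticality. *)
Lemma offspring_spread : 0 < 1 - p 0%N - p 1%N.
Proof.
rewrite lt_neqAle; apply/andP; split; last first.
  rewrite -addrA -opprD subr_ge0; apply: (cvgr_to_ge hp_sum); near=> n.
  rewrite sum_nat_split2; last by near: n; exact: nbhs_infty_ge.
  by rewrite addrA lerDl sumr_ge0.
apply/negP => /eqP E.
have pk0 k : (1 < k)%N -> p k = 0.
  move=> k1; apply/eqP; rewrite eq_le hp_ge0 andbT.
  rewrite -(lerD2l (p 0%N + p 1%N)) addr0 (_ : p 0%N + p 1%N = 1); last by lra.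
  apply: (cvgr_to_ge hp_sum); near=> n.
  have nk : (k < n)%N by near: n; exact: nbhs_infty_gt.
  rewrite (sum_nat_split2 _ (ltn_trans k1 nk)).
  rewrite addrA (_ : p 0%N + p 1%N = 1); last by lra.
  rewrite lerD2l (bigD1_seq (k - 2)%N) ?iota_uniq//=; last first.
    by rewrite mem_index_iota/=; lia.
  by rewrite -addn2 subnK// lerDl sumr_ge0.
suff H : (fun n => \sum_(0 <= k < n) (k%:R * p k)) @ \oo --> p 1%N.
  by move: hp1; rewrite -[ltLHS](cvg_lim _ H)// (cvg_lim _ hp_mean)// ltxx.
apply/cvg_ballP => e e0; near=> n.
rewrite (_ : \sum_(0 <= k < n) _ = p 1%N); first exact: ballxx.
rewrite sum_nat_split2; last by near: n; exact: nbhs_infty_ge.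
rewrite mul0r mul1r add0r big1 ?addr0// => k _.
by rewrite pk0// mulr0.
Unshelve. all: by end_near. Qed.

Context (s2 : R).
Hypothesis hp_var : (fun n => \sum_(0 <= k < n) (k%:R ^+ 2 * p k)) @ \oo --> s2 + 1.

Let factorial_moment :
  (fun n => \sum_(0 <= k < n) p k * (k%:R ^+ 2 - k%:R)) @ \oo --> s2.
Proof.
rewrite (_ : s2 = s2 + 1 - 1); last by ring.
rewrite (_ : (fun n => _) = (fun n => \sum_(0 <= k < n) (k%:R ^+ 2 * p k) -
  \sum_(0 <= k < n) (k%:R * p k))); first exact: cvgB.
by apply/funext => n; rewrite -sumrB; apply: eq_bigr => k _; ring.
Qed.

Lemma survival_step_ge q : 0 <= q <= 1 -> q - s2 * q ^+ 2 <= survival_step q.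
Proof.
move=> q01; rewrite lerBlDl -lerBlDr.
have H : (fun n => (\sum_(0 <= k < n) p k * (k%:R ^+ 2 - k%:R)) * q ^+ 2) @ \oo
    --> s2 * q ^+ 2 by apply: cvgM; [exact: factorial_moment|exact: cvg_cst].
apply: (ler_cvg_to (survival_step_rem q01) H).
near=> n; rewrite mulr_suml; apply: ler_sum_nat => k _.
by rewrite -mulrA ler_wpM2l// taylor_rem_le.
Unshelve. all: by end_near. Qed.

(** With mean 1 the variance is the factorial moment of [k^2 - k], which is at least [P(k >= 2)]. *)
Lemma offspring_var_gt0 : 0 < s2.
Proof.
apply: (lt_le_trans offspring_spread).
have H : (fun n => \sum_(0 <= k < n) p k - p 0%N - p 1%N) @ \oo
    --> (1 - p 0%N - p 1%N).
  by apply: cvgB; last exact: cvg_cst; apply: cvgB => //; exact: cvg_cst.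
apply: (ler_cvg_to H factorial_moment); near=> n.
have n1 : (1 < n)%N by near: n; exact: nbhs_infty_ge.
rewrite !(sum_nat_split2 _ n1).
have E x : p 0%N + (p 1%N + x) - p 0%N - p 1%N = x by ring.
rewrite !expr0n expr1n/= !subrr !mulr0 !add0r E; apply: ler_sum_nat => k _.
have k2 : 2 <= k.+2%:R :> R by rewrite ler_nat.
by rewrite ler_peMr//; nra.
Unshelve. all: by end_near. Qed.

(** The third moment may be infinite, so the cubic error is summed only over [k < N], with [N]
    capturing the variance up to [e / 2]; the discarded remainders are nonnegative. *)
Lemma survival_step_le_var e : 0 < e -> exists2 q0, 0 < q0 &
  forall q, 0 <= q <= 1 -> q <= q0 -> survival_step q <= q - (s2 / 2 - e) * q ^+ 2.
Proof.
move=> e0.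
have e20 : 0 < e / 2 by lra.
have /cvgrPdist_le/(_ _ e20)[N _ HN] := factorial_moment.
have := HN N (leqnn _); set s := \sum_(0 <= k < N) _ => Hs.
pose c := \sum_(0 <= k < N) p k * k%:R ^+ 3.
have c0 : 0 <= c by apply: sumr_ge0 => k _; rewrite mulr_ge0.
exists (e / 2 / (c + 1)) => [|q q01 qq0]; first by rewrite divr_gt0//; lra.
rewrite lerBrDl -lerBrDr.
have q0 : 0 <= q by case/andP: q01.
have Hc : c * q <= e / 2.
  rewrite ler_pdivlMr in qq0; last by lra.
  by apply: le_trans qq0; rewrite mulrDr mulr1 mulrC lerDl.
have : s / 2 * q ^+ 2 - c * q ^+ 3 <= q - survival_step q.
  apply: (cvgr_to_ge (survival_step_rem q01)); near=> n.
  have Nn : (N <= n)%N by near: n; exact: nbhs_infty_ge.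
  rewrite (big_cat_nat (n := N))//= -[leLHS]addr0 lerD//; last first.
    by apply: sumr_ge0 => k _; rewrite mulr_ge0// taylor_rem_ge0.
  rewrite /s /c !mulr_suml -sumrB; apply: ler_sum_nat => k _.
  apply: (@le_trans _ _ (p k * ((k%:R ^+ 2 - k%:R) / 2 * q ^+ 2 - k%:R ^+ 3 * q ^+ 3))).
    by rewrite le_eqVlt; apply/orP; left; apply/eqP; ring.
  by rewrite ler_wpM2l// taylor_rem_ge.
apply: le_trans.
have q2 : 0 <= q ^+ 2 by exact: sqr_ge0.
have : c * q * q ^+ 2 <= e / 2 * q ^+ 2 by rewrite ler_wpM2r.
have -> : c * q ^+ 3 = c * q * q ^+ 2 by ring.
have : (s2 - e / 2) * q ^+ 2 <= s * q ^+ 2.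
  by rewrite ler_wpM2r//; move: Hs; rewrite ler_norml => /andP[]; lra.
nra.
Unshelve. all: by end_near. Qed.

Fixpoint survival n : R := if n is m.+1 then survival_step (survival m) else 1.

Lemma survival_itv n : 0 <= survival n <= 1.
Proof.
elim: n => [|n IH]/=; first by rewrite ler01 lexx.
by rewrite survival_step_ge0// survival_step_le1.
Qed.

(** In the variable [1 / q] the quadratic loss becomes a gain of [c] per generation, which explains
    the decay [1 / (c n)]. *)
Lemma inv_step q q' c : 0 < q -> 0 < q' ->
  q' <= q - c * q ^+ 2 -> q^-1 + c <= q'^-1.
Proof.
move=> q0 q'0 H.
have h : 0 < q - c * q ^+ 2 by apply: lt_le_trans H.
apply: (@le_trans _ _ (q - c * q ^+ 2)^-1); last by rewrite lef_pV2.
rewrite -subr_ge0.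
have -> : (q - c * q ^+ 2)^-1 - (q^-1 + c) = c ^+ 2 * q ^+ 2 / (q - c * q ^+ 2).
  by field; rewrite !gt_eqF.
by apply: divr_ge0; [apply: mulr_ge0; exact: sqr_ge0|exact: ltW].
Qed.

Lemma survival_cvg0 e : 0 < e -> exists N, forall n, (N <= n)%N -> survival n <= e.
Proof.
move=> e0; have c0 := offspring_spread.
(* The value 0 is kept apart because its inverse is the default value 0, which would break the
   growth of the reciprocal. *)
have H n : survival n = 0 \/ 0 < survival n /\ 1 + (1 - p 0%N - p 1%N) * n%:R <= (survival n)^-1.
  elim: n => [|n IH]; first by right; rewrite mulr0 addr0 /= invr1; split.
  have := survival_itv n.+1; rewrite le_eqVlt => /andP[/orP[/eqP <-|s0] _]; first by left.
  right; split => //; have /= sq := survival_step_le_sqr (survival_itv n).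
  case: IH => [sn|[sn IH]]; first by move: sq s0; rewrite /= sn expr0n/=; lra.
  by have := inv_step sn s0 sq; rewrite -natr1; move: IH; set x := n%:R; lra.
exists (Num.bound (e^-1 / (1 - p 0%N - p 1%N))) => n Nn.
case: (H n) => [->|[sn]]; first exact: ltW.
have : e^-1 / (1 - p 0%N - p 1%N) < n%:R.
  apply: (lt_le_trans (archi_boundP _)); last by rewrite ler_nat.
  by rewrite divr_ge0 ?ltW ?invr_gt0.
rewrite ltr_pdivrMr// mulrC => h1 h2.
rewrite -lef_pV2 ?posrE//; lra.
Qed.

(** Upper half of Kolmogorov's estimate: the crude bound first brings [survival] below [q0], from
    where the sharp rate governs. *)
Lemma survival_asymptotic e : 0 < e ->
  \forall n \near \oo, n%:R * survival n <= 2 / s2 + e.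
Proof.
move=> e0; have s0 := offspring_var_gt0; pose L := 2 / s2 + e.
have L0 : 0 < L by rewrite addr_gt0// divr_gt0.
have Ls : L^-1 < s2 / 2.
  by rewrite -(invf_div 2 s2) ltf_pV2 ?posrE ?divr_gt0// /L ltrDl.
(* Strictly between [1 / L] and [s2 / 2]: the upper gap is the loss allowed in the rate, and the
   surplus [c * L > 1] pays for the first [N] generations. *)
pose c := (L^-1 + s2 / 2) / 2.
have ce : 0 < s2 / 2 - c by rewrite /c; lra.
have cL : 1 < c * L.
  rewrite -ltr_pdivrMr// div1r /c; lra.
have c0 : 0 < c by rewrite /c; have := invr_gt0 L; rewrite L0; lra.
have [q0 q00 Hq] := survival_step_le_var ce.
have [N HN] := survival_cvg0 q00.
have H m : survival (N + m) = 0 \/ 0 < survival (N + m) /\ c * m%:R <= (survival (N + m))^-1.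
  elim: m => [|m IH].
    have := survival_itv (N + 0); rewrite le_eqVlt => /andP[/orP[/eqP <-|h] _]; first by left.
    by right; rewrite h mulr0 invr_ge0 ltW.
  have := survival_itv (N + m.+1); rewrite le_eqVlt => /andP[/orP[/eqP <-|h] _]; first by left.
  right; split => //; move: h; rewrite addnS /=.
  have := Hq _ (survival_itv (N + m)) (HN _ (leq_addr _ _)).
  rewrite (_ : s2 / 2 - (s2 / 2 - c) = c); last by ring.
  case: IH => [-> |[sm IH] sq h]; first by rewrite expr0n /=; lra.
  by have := inv_step sm h sq; rewrite -natr1; lra.
near=> n.
have nN : (N <= n)%N by near: n; exact: nbhs_infty_ge.
have := H (n - N)%N; rewrite subnKC// => -[->|[sn h]].
  by rewrite mulr0 ltW.
have hn : c * L * N%:R <= (c * L - 1) * n%:R.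
  rewrite -ler_pdivrMl; last by rewrite subr_gt0.
  near: n; exact: nbhs_infty_ger.
rewrite natrB// in h; have : n%:R <= L * (survival n)^-1.
  apply: (@le_trans _ _ (L * (c * (n%:R - N%:R)))); first by lra.
  by rewrite ler_pM2l.
by rewrite ler_pdivlMr.
Unshelve. all: by end_near. Qed.

End Offspring.

(** * A C^{2,1} class stable under averaging and logistic damping *)

Section Jets.
Context {R : realType}.
Implicit Types (h k c d M K e n : R) (x : R * R) (u v : R * R -> R).

Record jet := Jet { j1 : R; j2 : R; j11 : R; j12 : R; j22 : R }.

Definition lin (J : jet) h k := j1 J * h + j2 J * k.
Definition quad (J : jet) h k := (j11 J * h ^+ 2 + 2 * j12 J * h * k + j22 J * k ^+ 2) / 2.
Definition norm1 h k := `|h| + `|k|.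
Definition pshift x h k : R * R := (x.1 + h, x.2 + k).

(** The second-order jet is carried as data, and regularity is expressed by Taylor inequalities
    rather than derivatives: such inequalities survive averages and pointwise limits with the same
    constants. *)
Record C21 M K1 K2 K3 u (J : R * R -> jet) : Prop := MkC21 {
  C21_val : forall x, 0 <= u x <= M;
  C21_lip : forall x h k, `|u (pshift x h k) - u x| <= K1 * norm1 h k;
  C21_lin : forall x h k, `|lin (J x) h k| <= K1 * norm1 h k;
  C21_tay1 : forall x h k,
    `|u (pshift x h k) - u x - lin (J x) h k| <= K2 * norm1 h k ^+ 2;
  C21_quad : forall x h k, `|quad (J x) h k| <= K2 * norm1 h k ^+ 2;
  C21_tay2 : forall x h k,
    `|u (pshift x h k) - u x - lin (J x) h k - quad (J x) h k|
      <= K3 * norm1 h k ^+ 3 }.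

Implicit Types J : R * R -> jet.

Definition avg4 (f : R -> R -> R) (d : R) : R := (f d d + f d (- d) + f (- d) d + f (- d) (- d)) / 4.

Lemma avg4_le (f : R -> R -> R) d K : (forall h k, `|f h k| <= K) -> `|avg4 f d| <= K.
Proof.
move=> H; rewrite /avg4; move: (H d d) (H d (- d)) (H (- d) d) (H (- d) (- d)).
by rewrite !ler_norml => /andP[? ?] /andP[? ?] /andP[? ?] /andP[? ?]; apply/andP; split; lra.
Qed.

(** One step of the walk whose two coordinates move independently by [d] or [- d]; its generator at
    time scale [d^2] approximates half the Laplacian. *)
Definition walk d u x := avg4 (fun h k => u (pshift x h k)) d.
Definition walk_jet d (J : R * R -> jet) x : jet :=
  Jet (avg4 (fun h k => j1 (J (pshift x h k))) d) (avg4 (fun h k => j2 (J (pshift x h k))) d)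
      (avg4 (fun h k => j11 (J (pshift x h k))) d) (avg4 (fun h k => j12 (J (pshift x h k))) d)
      (avg4 (fun h k => j22 (J (pshift x h k))) d).

Lemma pshiftC x h k h' k' : pshift (pshift x h k) h' k' = pshift (pshift x h' k') h k.
Proof. by rewrite /pshift/=; congr pair; ring. Qed.

Lemma C21_walk M K1 K2 K3 u J d : C21 M K1 K2 K3 u J -> C21 M K1 K2 K3 (walk d u) (walk_jet d J).
Proof.
case=> H1 H2 H3 H4 H5 H6; split=> x; try move=> h k.
- have := H1 (pshift x d d); have := H1 (pshift x d (- d)).
  have := H1 (pshift x (- d) d); have := H1 (pshift x (- d) (- d)).
  rewrite /walk /avg4 => /andP[? ?] /andP[? ?] /andP[? ?] /andP[? ?]; apply/andP; split; lra.
- rewrite (_ : _ - _ = avg4 (fun a b => u (pshift (pshift x a b) h k) - u (pshift x a b)) d).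
    by apply: avg4_le => a b.
  by rewrite /walk /avg4 !(pshiftC x h k); field.
- rewrite (_ : lin _ _ _ = avg4 (fun a b => lin (J (pshift x a b)) h k) d).
    by apply: avg4_le => a b.
  by rewrite /walk_jet /lin /avg4 /=; field.
- rewrite (_ : _ - _ = avg4 (fun a b => u (pshift (pshift x a b) h k) - u (pshift x a b) - lin (J (pshift x a b)) h k) d).
    by apply: avg4_le => a b.
  by rewrite /walk /walk_jet /lin /avg4 /= !(pshiftC x h k); field.
- rewrite (_ : quad _ _ _ = avg4 (fun a b => quad (J (pshift x a b)) h k) d).
    by apply: avg4_le => a b.
  by rewrite /walk_jet /quad /avg4 /=; field.
- rewrite (_ : _ - _ = avg4 (fun a b => u (pshift (pshift x a b) h k) - u (pshift x a b)
     - lin (J (pshift x a b)) h k - quad (J (pshift x a b)) h k) d).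
    by apply: avg4_le => a b.
  by rewrite /walk /walk_jet /lin /quad /avg4 /= !(pshiftC x h k); field.
Qed.

Definition logistic c u x := u x - c * u x ^+ 2.
Definition logistic_jet c u (J : R * R -> jet) x : jet :=
  let g := 1 - 2 * c * u x in let j := J x in
  Jet (g * j1 j) (g * j2 j) (g * j11 j - 2 * c * j1 j ^+ 2)
      (g * j12 j - 2 * c * j1 j * j2 j) (g * j22 j - 2 * c * j2 j ^+ 2).

Lemma norm_mul_le (a b A B : R) : `|a| <= A -> `|b| <= B -> `|a * b| <= A * B.
Proof. by move=> aA bB; rewrite normrM ler_pM. Qed.

(** The condition [2 * c * M <= 1] puts the factor [1 - c (a + b)] in [[0, 1]], so [K1] does not
    grow while [K2] and [K3] grow by multiples of [c]. With [c = s d^2] the total growth up to a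
    fixed time is bounded uniformly in the mesh. *)
Lemma C21_logistic M K1 K2 K3 u J c : 0 <= c -> 2 * c * M <= 1 ->
  C21 M K1 K2 K3 u J ->
  C21 M K1 (K2 + c * K1 ^+ 2) (K3 + c * (2 * K1 * K2)) (logistic c u) (logistic_jet c u J).
Proof.
move=> c0 cM [H1 H2 H3 H4 H5 H6].
have g01 x y : 0 <= 1 - c * (u x + u y) <= 1.
  have /andP[a0 aM] := H1 x; have /andP[b0 bM] := H1 y.
  have : c * (u x + u y) <= 2 * c * M by rewrite -mulrA mulrCA ler_wpM2l//; lra.
  have : 0 <= c * (u x + u y) by rewrite mulr_ge0// addr_ge0.
  by move=> ? ?; apply/andP; split; lra.
have g1 x y z Z : `|z| <= Z -> `|(1 - c * (u x + u y)) * z| <= Z.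
  move=> zZ; rewrite normrM; have /andP[? ?] := g01 x y; rewrite ger0_norm//.
  by apply: le_trans zZ; rewrite ler_piMl.
have E x : 1 - 2 * c * u x = 1 - c * (u x + u x) by ring.
have Cle z Z : `|z| <= Z -> `|c * z| <= c * Z.
  by move=> ?; rewrite normrM ger0_norm// ler_wpM2l.
split=> x; try move=> h k.
- have /andP[a0 aM] := H1 x; have /andP[b0 b1] := g01 x x; rewrite /logistic.
  have ca : 0 <= c * u x ^+ 2 by rewrite mulr_ge0// sqr_ge0.
  have : 0 <= c * u x by rewrite mulr_ge0.
  move=> ?; apply/andP; split; [nra|lra].
- rewrite /logistic (_ : _ - _ = (1 - c * (u (pshift x h k) + u x)) * (u (pshift x h k) - u x)); first exact: g1.
  ring.
- rewrite (_ : lin _ _ _ = (1 - c * (u x + u x)) * lin (J x) h k); first exact: g1.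
  by rewrite /lin /logistic_jet/=; ring.
- rewrite (_ : _ - _ = (1 - c * (u x + u x)) * (u (pshift x h k) - u x - lin (J x) h k)
      - c * ((u (pshift x h k) - u x) * (u (pshift x h k) - u x))); last first.
    by rewrite /lin /logistic /logistic_jet/=; ring.
  rewrite [leRHS]mulrDl; apply: (le_trans (ler_normB _ _)); apply: lerD; first exact: g1.
  rewrite (_ : c * K1 ^+ 2 * _ = c * ((K1 * norm1 h k) * (K1 * norm1 h k))); last by ring.
  by apply: Cle; exact: norm_mul_le.
- rewrite (_ : quad _ _ _ = (1 - c * (u x + u x)) * quad (J x) h k
      - c * (lin (J x) h k * lin (J x) h k)); last first.
    by rewrite /quad /lin /logistic_jet/=; field.
  rewrite [leRHS]mulrDl; apply: (le_trans (ler_normB _ _)); apply: lerD; first exact: g1.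
  rewrite (_ : c * K1 ^+ 2 * _ = c * ((K1 * norm1 h k) * (K1 * norm1 h k))); last by ring.
  by apply: Cle; exact: norm_mul_le.
- set D := u (pshift x h k) - u x; set l := lin (J x) h k.
  rewrite (_ : _ - _ = (1 - c * (u x + u x)) * (D - l - quad (J x) h k)
      - c * ((D - l) * (D + l))); last first.
    by rewrite /D /l /quad /lin /logistic /logistic_jet/=; field.
  rewrite [leRHS]mulrDl; apply: (le_trans (ler_normB _ _)); apply: lerD; first by apply: g1; exact: H6.
  rewrite (_ : c * _ * _ = c * ((K2 * norm1 h k ^+ 2) * (K1 * norm1 h k + K1 * norm1 h k))); last by ring.
  apply: Cle; apply: norm_mul_le; first exact: H4.
  by apply: (le_trans (ler_normD _ _)); apply: lerD; [exact: H2|exact: H3].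
Qed.

Definition lapl (J : jet) : R := j11 J + j22 J.

Lemma norm1_sq d : norm1 d d = 2 * `|d| /\ norm1 d (- d) = 2 * `|d|
  /\ norm1 (- d) d = 2 * `|d| /\ norm1 (- d) (- d) = 2 * `|d|.
Proof. by rewrite /norm1 !normrN mulr_natl mulr2n. Qed.

Lemma walk_tay1 M K1 K2 K3 u J d x : C21 M K1 K2 K3 u J ->
  `|walk d u x - u x| <= 4 * K2 * d ^+ 2.
Proof.
move=> H; have [n1 [n2 [n3 n4]]] := norm1_sq d.
have := C21_tay1 H x d d; have := C21_tay1 H x d (- d).
have := C21_tay1 H x (- d) d; have := C21_tay1 H x (- d) (- d).
rewrite n1 n2 n3 n4 exprMn real_normK ?num_real// /walk /avg4 /lin !ler_norml.
set a := u (pshift _ d d); set b := u (pshift _ d (- d)).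
set e := u (pshift _ (- d) d); set f := u (pshift _ (- d) (- d)).
move: (j1 (J x)) (j2 (J x)) (u x) => p q w.
move=> /andP[? ?] /andP[? ?] /andP[? ?] /andP[? ?].
by apply/andP; split; lra.
Qed.

(** Over the four corners the linear and the mixed second-order terms cancel, leaving the Laplacian
    alone. *)
Lemma walk_tay2 M K1 K2 K3 u J d x : C21 M K1 K2 K3 u J ->
  `|walk d u x - u x - d ^+ 2 / 2 * lapl (J x)| <= 8 * K3 * `|d| ^+ 3.
Proof.
move=> H; have [n1 [n2 [n3 n4]]] := norm1_sq d.
have := C21_tay2 H x d d; have := C21_tay2 H x d (- d).
have := C21_tay2 H x (- d) d; have := C21_tay2 H x (- d) (- d).
rewrite n1 n2 n3 n4 exprMn /walk /avg4 /lin /quad /lapl !ler_norml.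
set a := u (pshift _ d d); set b := u (pshift _ d (- d)).
set e := u (pshift _ (- d) d); set f := u (pshift _ (- d) (- d)).
move: (j1 (J x)) (j2 (J x)) (j11 (J x)) (j12 (J x)) (j22 (J x)) (u x) => p q r s t w.
move=> /andP[? ?] /andP[? ?] /andP[? ?] /andP[? ?].
by apply/andP; split; lra.
Qed.

(* Interpolation between the sup norm and the Hoelder bound on second derivatives. *)
Lemma lapl_interp M K1 K2 K3 u J M' K1' K2' v J' e h x :
  C21 M K1 K2 K3 u J -> C21 M' K1' K2' K3 v J' ->
  (forall y, `|u y - v y| <= e) -> 0 < h ->
  `|lapl (J x) - lapl (J' x)| <= 8 * e / h ^+ 2 + 8 * K3 * h.
Proof.
move=> Hu Hv uv h0.
have h2 : 0 < h ^+ 2 by rewrite exprn_gt0.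
rewrite -(ler_pM2r h2) -{1}(ger0_norm (ltW h2)) -normrM [leRHS]mulrDl divfK ?gt_eqF//.
have N1 : norm1 h 0 = h by rewrite /norm1 normr0 addr0 gtr0_norm.
have N2 : norm1 0 h = h by rewrite /norm1 normr0 add0r gtr0_norm.
have N3 : norm1 (- h) 0 = h by rewrite /norm1 normr0 addr0 normrN gtr0_norm.
have N4 : norm1 0 (- h) = h by rewrite /norm1 normr0 add0r normrN gtr0_norm.
have := C21_tay2 Hu x h 0; have := C21_tay2 Hu x (- h) 0.
have := C21_tay2 Hu x 0 h; have := C21_tay2 Hu x 0 (- h).
have := C21_tay2 Hv x h 0; have := C21_tay2 Hv x (- h) 0.
have := C21_tay2 Hv x 0 h; have := C21_tay2 Hv x 0 (- h).
have := uv (pshift x h 0); have := uv (pshift x (- h) 0).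
have := uv (pshift x 0 h); have := uv (pshift x 0 (- h)); have := uv x.
rewrite N1 N2 N3 N4 /lin /quad /lapl !ler_norml.
move: (u (pshift x h 0)) (u (pshift x (-h) 0)) (u (pshift x 0 h)) (u (pshift x 0 (- h))) (u x).
move: (v (pshift x h 0)) (v (pshift x (-h) 0)) (v (pshift x 0 h)) (v (pshift x 0 (- h))) (v x).
move: (j1 (J x)) (j2 (J x)) (j11 (J x)) (j12 (J x)) (j22 (J x)) => p q r s t.
move: (j1 (J' x)) (j2 (J' x)) (j11 (J' x)) (j12 (J' x)) (j22 (J' x)) => p' q' r' s' t'.
move=> a1 a2 a3 a4 a5 b1 b2 b3 b4 b5.
do 13 move=> /andP[? ?].
by apply/andP; split; lra.
Qed.

End Jets.

(** * An explicit splitting scheme for the reaction-diffusion equation *)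

Section Scheme.
Context {R : realType}.
Implicit Types (h k c d M K e n : R) (x : R * R) (u v : R * R -> R).
Implicit Types J : R * R -> jet (R := R).

Lemma norm1_ge0 h k : 0 <= norm1 h k.
Proof. by rewrite addr_ge0. Qed.

Lemma C21_weaken M K1 K2 K3 K2' K3' u J : K2 <= K2' -> K3 <= K3' ->
  C21 M K1 K2 K3 u J -> C21 M K1 K2' K3' u J.
Proof.
move=> K22 K33 [H1 H2 H3 H4 H5 H6]; split=> // x h k.
- by apply: (le_trans (H4 x h k)); rewrite ler_wpM2r// exprn_ge0// norm1_ge0.
- by apply: (le_trans (H5 x h k)); rewrite ler_wpM2r// exprn_ge0// norm1_ge0.
- by apply: (le_trans (H6 x h k)); rewrite ler_wpM2r// exprn_ge0// norm1_ge0.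
Qed.

Context (s M : R).
Hypothesis s0 : 0 <= s.

Definition reaction u J x : R := lapl (J x) / 2 - s * u x ^+ 2.

Lemma sqr_diff_le (a b e : R) : 0 <= a <= M -> 0 <= b <= M -> `|a - b| <= e ->
  `|s * a ^+ 2 - s * b ^+ 2| <= 2 * s * M * e.
Proof.
move=> /andP[a0 aM] /andP[b0 bM] abe.
rewrite -mulrBr subr_sqr normrM ger0_norm//.
rewrite (_ : 2 * s * M * e = s * (e * (2 * M))); last by ring.
rewrite ler_wpM2l// normrM ler_pM// ger0_norm ?addr_ge0//; lra.
Qed.

Lemma reaction_interp K1 K2 K3 u J K1' K2' v J' e h x :
  C21 M K1 K2 K3 u J -> C21 M K1' K2' K3 v J' ->
  (forall y, `|u y - v y| <= e) -> 0 < h ->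
  `|reaction u J x - reaction v J' x| <= 4 * e / h ^+ 2 + 4 * K3 * h + 2 * s * M * e.
Proof.
move=> Hu Hv uv h0; have := lapl_interp x Hu Hv uv h0.
have := sqr_diff_le (C21_val Hu x) (C21_val Hv x) (uv x).
rewrite /reaction !ler_norml; set X := e / h ^+ 2.
rewrite -!(mulrA _ e) -/X => /andP[? ?] /andP[? ?]; apply/andP; split; lra.
Qed.

Definition scheme_step d u := logistic (s * d ^+ 2) (walk d u).
Definition scheme_jet_step d u J := logistic_jet (s * d ^+ 2) (walk d u) (walk_jet d J).

Lemma walk_val K1 K2 K3 u J d x : C21 M K1 K2 K3 u J -> 0 <= walk d u x <= M.
Proof. by move=> H; exact: C21_val (C21_walk d H) x. Qed.

Lemma scheme_step_lip K1 K2 K3 u J d x : C21 M K1 K2 K3 u J ->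
  `|scheme_step d u x - u x| <= d ^+ 2 * (4 * K2 + s * M ^+ 2).
Proof.
move=> H; rewrite /scheme_step /logistic.
have /andP[w0 wM] := walk_val d x H.
have : 0 <= s * d ^+ 2 * walk d u x ^+ 2 <= s * d ^+ 2 * M ^+ 2.
  apply/andP; split; first by rewrite mulr_ge0 ?sqr_ge0// mulr_ge0 ?sqr_ge0.
  apply: ler_wpM2l; first by rewrite mulr_ge0 ?sqr_ge0.
  by rewrite lerXn2r ?nnegrE// (le_trans w0).
have := walk_tay1 d x H; rewrite !ler_norml => /andP[? ?] /andP[? ?].
by apply/andP; split; lra.
Qed.

Lemma scheme_step_expand K1 K2 K3 u J d x : 0 <= d -> d <= 1 -> C21 M K1 K2 K3 u J ->
  `|scheme_step d u x - u x - d ^+ 2 * reaction u J x|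
    <= d ^+ 2 * (d * (8 * K3 + 8 * s * M * K2)).
Proof.
move=> d0 d1 H; have h1 := walk_tay1 d x H; have h2 := walk_tay2 d x H.
have h3 := sqr_diff_le (walk_val d x H) (C21_val H x) h1.
have M0 : 0 <= M by have /andP[a b] := C21_val H x; exact: le_trans b.
have K20 : 0 <= K2.
  have := C21_tay1 H x 1 0; rewrite /norm1 normr0 addr0 normr1 expr1n mulr1.
  exact: le_trans.
have d2 : 0 <= d ^+ 2 by exact: sqr_ge0.
have h4 : `|d ^+ 2 * (s * walk d u x ^+ 2 - s * u x ^+ 2)| <= d ^+ 2 * (d * (8 * s * M * K2)).
  rewrite normrM ger0_norm// ler_wpM2l//; apply: (le_trans h3).
  rewrite (_ : _ * (4 * _ * _) = d ^+ 2 * (8 * s * M * K2)); last by ring.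
  by rewrite ler_wpM2r ?mulr_ge0// expr2 ler_piMr.
move: h2 h4; rewrite (ger0_norm d0) /scheme_step /logistic /reaction.
rewrite !ler_norml => /andP[? ?] /andP[? ?].
by apply/andP; split; lra.
Qed.

Context (phi : R * R -> R) (J0 : R * R -> jet (R := R)) (K1 K2 K3 : R).
Hypothesis phiC : C21 M K1 K2 K3 phi J0.
Hypotheses (K10 : 0 <= K1) (K20 : 0 <= K2) (K30 : 0 <= K3).

Fixpoint scheme d (n : nat) : R * R -> R :=
  if n is m.+1 then scheme_step d (scheme d m) else phi.

Fixpoint scheme_jet d (n : nat) : R * R -> jet (R := R) :=
  if n is m.+1 then scheme_jet_step d (scheme d m) (scheme_jet d m) else J0.

(** As [K1] stays fixed along the scheme, [K2] gains [s K1^2] per unit of time, and [K3] at most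
    [2 s K1 bound2]. *)
Definition bound2 (B : R) := K2 + s * B * K1 ^+ 2.
Definition bound3 (B : R) := K3 + s * B * (2 * K1 * bound2 B).

Let M0 : 0 <= M.
Proof. by have /andP[a b] := C21_val phiC (0, 0); exact: le_trans b. Qed.

Lemma bound2_ge0 B : 0 <= B -> 0 <= bound2 B.
Proof. by move=> ?; rewrite addr_ge0// mulr_ge0// ?mulr_ge0// sqr_ge0. Qed.

Lemma bound3_ge0 B : 0 <= B -> 0 <= bound3 B.
Proof. by move=> ?; rewrite addr_ge0// mulr_ge0// ?mulr_ge0// bound2_ge0. Qed.

Context (d : R).
Hypotheses (d0 : 0 <= d) (d1 : d <= 1) (dM : 2 * (s * d ^+ 2) * M <= 1).

Lemma scheme_C21 (B : R) (n : nat) : n%:R * d ^+ 2 <= B ->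
  C21 M K1 (bound2 B) (bound3 B) (scheme d n) (scheme_jet d n).
Proof.
move=> nB; have B0 : 0 <= B by apply: le_trans nB; rewrite mulr_ge0// sqr_ge0.
have L20 := bound2_ge0 B0.
suff H m : m%:R * d ^+ 2 <= B -> C21 M K1 (K2 + s * (m%:R * d ^+ 2) * K1 ^+ 2)
    (K3 + s * (m%:R * d ^+ 2) * (2 * K1 * bound2 B)) (scheme d m) (scheme_jet d m).
  apply: C21_weaken (H _ nB); rewrite lerD2l ler_wpM2r ?sqr_ge0 ?mulr_ge0//;
  by rewrite ler_wpM2l.
elim: m => [|m IH] mB; first by rewrite !mul0r !mulr0 !mul0r !addr0.
have mB' : m%:R * d ^+ 2 <= B.
  by apply: le_trans mB; rewrite ler_wpM2r ?sqr_ge0// ler_nat.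
have := C21_logistic _ _ (C21_walk d (IH mB')).
move=> /(_ (s * d ^+ 2)); rewrite mulr_ge0 ?sqr_ge0// => /(_ isT dM).
apply: C21_weaken; rewrite -[m.+1%:R]natr1.
  by rewrite le_eqVlt; apply/orP; left; apply/eqP; ring.
rewrite (_ : K3 + s * ((m%:R + 1) * d ^+ 2) * _ =
  K3 + s * (m%:R * d ^+ 2) * (2 * K1 * bound2 B) + s * d ^+ 2 * (2 * K1 * bound2 B)); last by ring.
rewrite lerD2l ler_wpM2l ?mulr_ge0 ?sqr_ge0// ler_wpM2l ?mulr_ge0//.
by rewrite lerD2l ler_wpM2r ?sqr_ge0// ler_wpM2l.
Qed.

Definition speed (B : R) := 4 * bound2 B + s * M ^+ 2.

Lemma scheme_lip B (n m : nat) x : (n + m)%:R * d ^+ 2 <= B ->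
  `|scheme d (n + m) x - scheme d n x| <= m%:R * d ^+ 2 * speed B.
Proof.
elim: m => [|m IH] nB; first by rewrite addn0 subrr normr0 !mul0r.
have nB' : (n + m)%:R * d ^+ 2 <= B.
  by apply: le_trans nB; rewrite ler_wpM2r ?sqr_ge0// ler_nat addnS.
have := scheme_step_lip d x (scheme_C21 nB'); rewrite -/(speed B).
move: (IH nB'); rewrite addnS /= -[m.+1%:R]natr1 !ler_norml => /andP[? ?] /andP[? ?].
by apply/andP; split; lra.
Qed.

(** The equation over [m] steps with its right-hand side frozen at step [n]; interpolation controls
    the drift of the Laplacian in between. The length [h] stays free: it will be chosen small first,
    and [t] small against [h^2] afterwards. *)
Lemma scheme_expand B (n m : nat) x h t : t = m%:R * d ^+ 2 -> 0 < h -> (n + m)%:R * d ^+ 2 <= B ->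
  `|scheme d (n + m) x - scheme d n x - t * reaction (scheme d n) (scheme_jet d n) x|
   <= t * (4 * (t * speed B) / h ^+ 2 + 4 * bound3 B * h + 2 * s * M * (t * speed B)
           + d * (8 * bound3 B + 8 * s * M * bound2 B)).
Proof.
move=> tE h0 nB.
have B0 : 0 <= B by apply: le_trans nB; rewrite mulr_ge0// sqr_ge0.
have S0 : 0 <= speed B by rewrite addr_ge0// mulr_ge0// ?bound2_ge0// sqr_ge0.
set E := (X in _ <= t * X).
have nB' : n%:R * d ^+ 2 <= B.
  by apply: le_trans nB; rewrite ler_wpM2r ?sqr_ge0// ler_nat leq_addr.
suff H i : (i <= m)%N -> `|scheme d (n + i) x - scheme d n x -
    i%:R * d ^+ 2 * reaction (scheme d n) (scheme_jet d n) x| <= i%:R * d ^+ 2 * E.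
  by rewrite tE; exact: (H m (leqnn m)).
elim: i => [|i IH] im; first by rewrite addn0 subrr !mul0r subr0 normr0.
have niB : (n + i)%:R * d ^+ 2 <= B.
  by apply: le_trans nB; rewrite ler_wpM2r ?sqr_ge0// ler_nat leq_add2l ltnW.
have tt : i%:R * d ^+ 2 <= t by rewrite tE ler_wpM2r ?sqr_ge0// ler_nat ltnW.
have lip y : `|scheme d (n + i) y - scheme d n y| <= t * speed B.
  by apply: (le_trans (scheme_lip y niB)); rewrite ler_wpM2r.
have h1 := reaction_interp x (scheme_C21 niB) (scheme_C21 nB') lip h0.
have h2 := scheme_step_expand x d0 d1 (scheme_C21 niB).
have h3 := IH (ltnW im).
rewrite addnS /= -[i.+1%:R]natr1; set a := reaction (scheme d n) _ x in h1 h3 *.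
set b := reaction (scheme d (n + i)) _ x in h1 h2 *.
set F := d * _ in h2; have FE : E = 4 * (t * speed B) / h ^+ 2 + 4 * bound3 B * h
   + 2 * s * M * (t * speed B) + F by [].
have h4 : `|d ^+ 2 * (b - a)| <= d ^+ 2 * (E - F).
  by rewrite normrM ger0_norm ?sqr_ge0// ler_wpM2l ?sqr_ge0// FE addrK.
move: h2 h3 h4; rewrite !ler_norml => /andP[? ?] /andP[? ?] /andP[? ?].
by apply/andP; split; lra.
Qed.

End Scheme.

(** One ultrafilter finer than [\oo] makes all bounded sequences converge together, so the scheme
    and its jets get limits at every time and place without choosing subsequences. *)
Lemma ultrafilter_lim (R : realType) : exists F : set_system nat,
  [/\ ProperFilter F, \oo `<=` F & forall (a : nat -> R) (M : R),
    (forall n, `|a n| <= M) -> cvg (a @ F)].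
Proof.
have [F [FU sF]] := ultraFilterLemma eventually_filter.
exists F; split=> //; first exact: ultra_proper.
move=> a M aM.
have FF : ProperFilter F by exact: ultra_proper.
have aF : (a @ F) `[- M, M]%classic.
  by apply: (@filterS _ F _ setT) => [n _|]; [rewrite /= in_itv/= -ler_norml aM|exact: filterT].
have [l [_ cl]] := @segment_compact R (- M) M (a @ F) _ aF.
apply/cvg_ex; exists l => U Ul.
have [//|FC] := in_ultra_setVsetC (a @^-1` U) FU.
by have [y [nUy Uy]] := cl (~` U) U FC Ul.
Qed.

Lemma is_derive_expansion (R : realType) (f : R -> R) (a l : R) :
  (forall e, 0 < e -> exists2 d, 0 < d &
     forall h, h != 0 -> `|h| < d -> `|f (a + h) - f a - h * l| <= e * `|h|) ->
  is_derive a 1 f l.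
Proof.
move=> H.
have C : h^-1 *: ((f \o shift a) (h *: 1) - f a) @[h --> 0^'] --> l.
  apply/cvgrPdist_le => e e0; have [d d0 Hd] := H e e0.
  near=> h; have h0 : h != 0 by near: h; exact: nbhs_dnbhs_neq.
  have hd : `|h| < d by near: h; apply: dnbhs0_lt.
  rewrite distrC /= (_ : _ - l = h^-1 * (f (a + h) - f a - h * l)); last first.
    by rewrite /shift /GRing.scale /= mulr1 [h + a]addrC; field.
  by rewrite normrM normrV ?unitfE// ler_pdivrMl ?normr_gt0// [leRHS]mulrC; exact: Hd.
by apply: DeriveDef; [exact/cvgP/C|exact: cvg_lim C].
Unshelve. all: by end_near. Qed.

(** * The limit of the scheme solves the equation *)

Section Solution.
Context {R : realType}.
Implicit Types (h k c d M K e n t : R) (x : R * R) (u v : R * R -> R).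
Implicit Types J : R * R -> jet (R := R).

(** Nothing in [C21] says that [j11] is the derivative of [j1]. It follows by comparing the
    expansions at [x] and at [x + h] on the collinear points [x], [x + h], [x + 2h]. *)
Lemma C21_lin_derive1 M K1 K2 K3 u J x h : C21 M K1 K2 K3 u J ->
  `|j1 (J (pshift x h 0)) - j1 (J x) - h * j11 (J x)| <= 10 * K3 * `|h| ^+ 2.
Proof.
have [->|h0 H] := eqVneq h 0.
  move=> H; rewrite /pshift !addr0 -surjective_pairing subrr mul0r subr0 normr0.
  by rewrite expr0n mulr0.
have N1 : norm1 h 0 = `|h| by rewrite /norm1 normr0 addr0.
have N2 : norm1 (2 * h) 0 = 2 * `|h|.
  by rewrite /norm1 normr0 addr0 normrM ger0_norm.
have N4 : norm1 (- h) 0 = `|h| by rewrite /norm1 normr0 addr0 normrN.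
have E1 : pshift (pshift x h 0) h 0 = pshift x (2 * h) 0.
  by rewrite /pshift/=; congr pair; ring.
have E2 : pshift (pshift x h 0) (- h) 0 = x.
  by rewrite /pshift/= !addr0 addrK -surjective_pairing.
have h00 : 0 < `|h| by rewrite normr_gt0.
rewrite -(ler_pM2r h00) -[leLHS]normrM (_ : 10 * K3 * _ * _ = 10 * (K3 * `|h| ^+ 3)); last by ring.
have := C21_tay2 H x h 0; have := C21_tay2 H x (2 * h) 0.
have := C21_tay2 H (pshift x h 0) h 0; have := C21_tay2 H (pshift x h 0) (- h) 0.
rewrite N1 N2 N4 E1 E2 /lin /quad.
rewrite !ler_norml.
move: (J x) (J _) (u (pshift x h 0)) (u (pshift x (2 * h) 0)) (u x).
move=> [a b c p q] [a' b' c' p' q'] r s t /=.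
have : 0 <= K3 * `|h| ^+ 3.
  have := C21_tay2 H x h 0; rewrite N1; exact: le_trans.
set K := K3 * `|h| ^+ 3.
rewrite (_ : K3 * (2 * `|h|) ^+ 3 = 8 * K); last by rewrite /K; ring.
move=> ? /andP[? ?] /andP[? ?] /andP[? ?] /andP[? ?].
by apply/andP; split; lra.
Qed.

Definition swap_jet (j : jet (R := R)) : jet (R := R) := Jet (j2 j) (j1 j) (j22 j) (j12 j) (j11 j).

Definition pswap (x : R * R) : R * R := (x.2, x.1).

Lemma C21_swap M K1 K2 K3 u J : C21 M K1 K2 K3 u J ->
  C21 M K1 K2 K3 (u \o pswap) (swap_jet \o J \o pswap).
Proof.
have N h k : norm1 h k = norm1 k h by rewrite /norm1 addrC.
case=> H1 H2 H3 H4 H5 H6.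
have L (j : jet (R := R)) h k : lin (swap_jet j) h k = lin j k h by rewrite /lin/= addrC.
have Q (j : jet (R := R)) h k : quad (swap_jet j) h k = quad j k h by rewrite /quad/=; ring.
split=> -[a b]; try move=> h k; rewrite /= ?L ?Q ?(N h k).
- exact: H1.
- exact: (H2 (b, a) k h).
- exact: (H3 (b, a) k h).
- exact: (H4 (b, a) k h).
- exact: (H5 (b, a) k h).
- exact: (H6 (b, a) k h).
Qed.

Lemma C21_derive1 M K1 K2 K3 u J (a b : R) : C21 M K1 K2 K3 u J ->
  is_derive a 1 (fun y => u (y, b)) (j1 (J (a, b))).
Proof.
move=> H; have K20 : 0 <= K2.
  have := C21_tay1 H (0, 0) 1 0; rewrite /norm1 normr0 addr0 normr1 expr1n mulr1.
  exact: le_trans.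
apply: is_derive_expansion => e e0; exists (e / (K2 + 1)).
  by rewrite divr_gt0// ltr_pwDr.
move=> h h0; rewrite ltr_pdivlMr ?ltr_pwDr// => hd.
have := C21_tay1 H (a, b) h 0.
rewrite /pshift /lin /norm1/= mulr0 normr0 !addr0 [j1 _ * h]mulrC => /le_trans; apply.
rewrite expr2 mulrA ler_wpM2r//; apply: le_trans (ltW hd).
by rewrite mulrC ler_wpM2l// lerDl.
Qed.

Lemma C21_derive11 M K1 K2 K3 u J (a b : R) : C21 M K1 K2 K3 u J ->
  is_derive a 1 (fun y => j1 (J (y, b))) (j11 (J (a, b))).
Proof.
move=> H; have K30 : 0 <= K3.
  have := C21_tay2 H (0, 0) 1 0; rewrite /norm1 normr0 addr0 normr1 expr1n mulr1.
  exact: le_trans.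
apply: is_derive_expansion => e e0; exists (e / (10 * K3 + 1)).
  by rewrite divr_gt0// ltr_pwDr// mulr_ge0.
move=> h h0; rewrite ltr_pdivlMr ?ltr_pwDr ?mulr_ge0// => hd.
have := C21_lin_derive1 (a, b) h H.
rewrite /pshift /= addr0 => /le_trans; apply.
rewrite expr2 mulrA ler_wpM2r//; apply: le_trans (ltW hd).
by rewrite mulrC ler_wpM2l// lerDl.
Qed.

Lemma C21_jet_bounded M K1 K2 K3 u J x : C21 M K1 K2 K3 u J ->
  [/\ `|j1 (J x)| <= K1, `|j2 (J x)| <= K1, `|j11 (J x)| <= 2 * K2,
      `|j12 (J x)| <= 6 * K2 & `|j22 (J x)| <= 2 * K2].
Proof.
move=> H.
have N1 : norm1 1 0 = 1 :> R by rewrite /norm1 normr0 normr1 addr0.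
have N2 : norm1 0 1 = 1 :> R by rewrite /norm1 normr0 normr1 add0r.
have N3 : norm1 1 1 = 2 :> R by rewrite /norm1 normr1.
have := C21_lin H x 1 0; have := C21_lin H x 0 1; have := C21_quad H x 1 0.
have := C21_quad H x 0 1; have := C21_quad H x 1 1; rewrite N1 N2 N3.
rewrite /lin /quad !ler_norml.
move: (J x) => [a b c p q] /=.
by do 5 move=> /andP[? ?]; split; apply/andP; split; lra.
Qed.

Context (s M : R) (phi : R * R -> R) (J0 : R * R -> jet (R := R)) (K1 K2 K3 : R).
Hypothesis s0 : 0 <= s.
Hypothesis phiC : C21 M K1 K2 K3 phi J0.
Hypotheses (K10 : 0 <= K1) (K20 : 0 <= K2) (K30 : 0 <= K3).

Let M0 : 0 <= M.
Proof. by have /andP[a b] := C21_val phiC (0, 0); exact: le_trans b. Qed.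

(** The prefactor secures the stability condition of the logistic step, and [mesh j <= 1], for every
    [j]. *)
Definition mesh (j : nat) : R := (1 + 2 * s * M)^-1 / j.+1%:R.

Lemma mesh_gt0 j : 0 < mesh j.
Proof. by rewrite divr_gt0// invr_gt0 ltr_pwDl// !mulr_ge0. Qed.

Let sM0 : 0 < 1 + 2 * s * M.
Proof. by rewrite ltr_pwDl// !mulr_ge0. Qed.

Lemma mesh_le j : mesh j <= (1 + 2 * s * M)^-1.
Proof. by rewrite ler_piMr// ?invr_ge0 ?(ltW sM0)// invf_le1// ler1n. Qed.

Lemma mesh_le1 j : mesh j <= 1.
Proof.
apply: le_trans (mesh_le j) _; rewrite invf_le1// lerDl; by rewrite !mulr_ge0.
Qed.

Lemma mesh_stable j : 2 * (s * mesh j ^+ 2) * M <= 1.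
Proof.
have m0 := mesh_gt0 j.
have sM2 : 0 <= 2 * s * M by rewrite !mulr_ge0.
rewrite (_ : 2 * (s * _) * M = 2 * s * M * mesh j * mesh j); last by ring.
apply: (@le_trans _ _ (2 * s * M * mesh j)).
  by apply: ler_piMr; [exact: mulr_ge0 sM2 (ltW m0)|exact: mesh_le1].
apply: (@le_trans _ _ (2 * s * M * (1 + 2 * s * M)^-1)).
  by apply: ler_wpM2l => //; exact: mesh_le.
by rewrite ler_pdivrMr// mul1r lerDr.
Qed.

Lemma mesh_cvg0 : mesh @ \oo --> (0 : R).
Proof.
rewrite -(mulr0 (1 + 2 * s * M)^-1); apply: cvgM; first exact: cvg_cst.
exact: cvg_harmonic.
Qed.

Definition nsteps (j : nat) t : nat := Num.truncn (t / mesh j ^+ 2).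

Lemma nsteps_bounds j t : 0 <= t ->
  (nsteps j t)%:R * mesh j ^+ 2 <= t < (nsteps j t)%:R * mesh j ^+ 2 + mesh j ^+ 2.
Proof.
move=> t0; have m2 : 0 < mesh j ^+ 2 by rewrite exprn_gt0// mesh_gt0.
have /truncn_itv : 0 <= t / mesh j ^+ 2 by rewrite divr_ge0// ltW.
rewrite -natr1 ler_pdivlMr// ltr_pdivrMr// => /andP[-> /=].
by rewrite mulrDl mul1r.
Qed.

Lemma nsteps_cvg t : 0 <= t -> (nsteps j t)%:R * mesh j ^+ 2 @[j --> \oo] --> t.
Proof.
move=> t0; apply: (@squeeze_cvgr _ _ _ _ (fun j => t - mesh j ^+ 2) (fun=> t)).
- near=> j; have /andP[h1 h2] := nsteps_bounds j t0.
  by rewrite h1 lerBlDr ltW.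
- rewrite -[X in _ --> X]subr0; apply: cvgB; first exact: cvg_cst.
  by rewrite -(mulr0 0); apply: cvgM; exact: mesh_cvg0.
- exact: cvg_cst.
Unshelve. all: by end_near. Qed.

Context (F : set_system nat).
Hypothesis FP : ProperFilter F.
Hypothesis Foo : \oo `<=` F.
Hypothesis Fcvg : forall (a : nat -> R) (B : R), (forall j, `|a j| <= B) -> cvg (a @ F).

Definition approx j t := scheme s phi (mesh j) (nsteps j t).
Definition approx_jet j t := scheme_jet s phi J0 (mesh j) (nsteps j t).

Lemma approx_C21 j t B : 0 <= t -> t <= B ->
  C21 M K1 (bound2 s K1 K2 B) (bound3 s K1 K2 K3 B) (approx j t) (approx_jet j t).
Proof.
move=> t0 tB; apply: (scheme_C21 s0 phiC) => //; [exact: ltW (mesh_gt0 j)|exact: mesh_stable|].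
by have /andP[h _] := nsteps_bounds j t0; exact: le_trans tB.
Qed.

Definition sol t x : R := lim (approx j t x @[j --> F]).
Definition sol_jet t x : jet (R := R) :=
  let l (c : jet -> R) := lim (c (approx_jet j t x) @[j --> F]) in
  Jet (l j1) (l j2) (l j11) (l j12) (l j22).

Lemma approx_cvg t x : 0 <= t -> approx j t x @[j --> F] --> sol t x.
Proof.
move=> t0; apply: (@Fcvg _ M) => j.
by have /andP[h1 h2] := C21_val (approx_C21 j t0 (lexx _)) x; rewrite ger0_norm.
Qed.

Lemma approx_jet_cvg t x : 0 <= t ->
  [/\ j1 (approx_jet j t x) @[j --> F] --> j1 (sol_jet t x),
      j2 (approx_jet j t x) @[j --> F] --> j2 (sol_jet t x),
      j11 (approx_jet j t x) @[j --> F] --> j11 (sol_jet t x),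
      j12 (approx_jet j t x) @[j --> F] --> j12 (sol_jet t x) &
      j22 (approx_jet j t x) @[j --> F] --> j22 (sol_jet t x)].
Proof.
move=> t0; have H j := C21_jet_bounded x (approx_C21 j t0 (lexx t)).
by split; apply: Fcvg => j; have [? ? ? ? ?] := H j; eassumption.
Qed.

Lemma approx_lin_cvg t x h k : 0 <= t ->
  lin (approx_jet j t x) h k @[j --> F] --> lin (sol_jet t x) h k.
Proof.
move=> t0; have [? ? ? ? ?] := @approx_jet_cvg _ x t0.
by apply: cvgD; apply: cvgM => //; exact: cvg_cst.
Qed.

Lemma approx_quad_cvg t x h k : 0 <= t ->
  quad (approx_jet j t x) h k @[j --> F] --> quad (sol_jet t x) h k.
Proof.
move=> t0; have [? ? ? ? ?] := @approx_jet_cvg _ x t0.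
apply: cvgM; last exact: cvg_cst.
apply: cvgD; [apply: cvgD|]; apply: cvgM; try exact: cvg_cst; try by [].
by apply: cvgM; last exact: cvg_cst; apply: cvgM; first exact: cvg_cst.
Qed.

Lemma approx_reaction_cvg t x : 0 <= t ->
  reaction s (approx j t) (approx_jet j t) x @[j --> F] --> reaction s (sol t) (sol_jet t) x.
Proof.
move=> t0; have [? ? ? ? ?] := @approx_jet_cvg _ x t0.
apply: cvgB; first by apply: cvgM; [exact: cvgD|exact: cvg_cst].
apply: cvgM; first exact: cvg_cst.
by apply: cvgM; exact: approx_cvg.
Qed.

Lemma norm_lim_le (a : nat -> R) (l B : R) : a j @[j --> F] --> l -> (forall j, `|a j| <= B) -> `|l| <= B.
Proof.
move=> al aB; apply: (cvgr_to_le (cvg_norm al)).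
by apply: nearW => j; exact: aB.
Qed.

Lemma sol_C21 t B : 0 <= t -> t <= B ->
  C21 M K1 (bound2 s K1 K2 B) (bound3 s K1 K2 K3 B) (sol t) (sol_jet t).
Proof.
move=> t0 tB; have H j := approx_C21 j t0 tB; split=> x; try move=> h k.
- have Hx := @approx_cvg _ x t0; apply/andP; split.
    by apply: (cvgr_to_ge Hx); apply: nearW => j; have /andP[] := C21_val (H j) x.
  by apply: (cvgr_to_le Hx); apply: nearW => j; have /andP[] := C21_val (H j) x.
- by apply: norm_lim_le (cvgB (@approx_cvg _ _ t0) (@approx_cvg _ _ t0)) _ => j; exact: C21_lip (H j) _ _ _.
- by apply: norm_lim_le (@approx_lin_cvg _ _ _ _ t0) _ => j; exact: C21_lin (H j) _ _ _.
- apply: norm_lim_le (cvgB (cvgB (@approx_cvg _ _ t0) (@approx_cvg _ _ t0)) (@approx_lin_cvg _ _ _ _ t0)) _ => j.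
  exact: C21_tay1 (H j) _ _ _.
- by apply: norm_lim_le (@approx_quad_cvg _ _ _ _ t0) _ => j; exact: C21_quad (H j) _ _ _.
- apply: norm_lim_le (cvgB (cvgB (cvgB (@approx_cvg _ _ t0) (@approx_cvg _ _ t0)) (@approx_lin_cvg _ _ _ _ t0)) (@approx_quad_cvg _ _ _ _ t0)) _ => j.
  exact: C21_tay2 (H j) _ _ _.
Qed.

Lemma cvg_finer (a : nat -> R) (l : R) : a @ \oo --> l -> a @ F --> l.
Proof. by move=> al U /al; exact: Foo. Qed.

Lemma nsteps_add j t h : 0 <= t -> 0 <= h ->
  nsteps j (t + h) = (nsteps j t + (nsteps j (t + h) - nsteps j t))%N.
Proof.
move=> t0 h0; rewrite subnKC// /nsteps le_truncn// ler_pM2r ?lerDl//.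
by rewrite invr_gt0 exprn_gt0// mesh_gt0.
Qed.

Lemma increment_cvg t h : 0 <= t -> 0 <= h ->
  (nsteps j (t + h) - nsteps j t)%:R * mesh j ^+ 2 @[j --> F] --> h.
Proof.
move=> t0 h0; apply: cvg_finer.
have E : t + h - t = h by rewrite addrC addKr.
rewrite -[X in _ --> X]E.
rewrite (_ : (fun j => _) = (fun j => (nsteps j (t + h))%:R * mesh j ^+ 2
   - (nsteps j t)%:R * mesh j ^+ 2)).
  by apply: cvgB; apply: nsteps_cvg => //; exact: addr_ge0.
apply/funext => j; rewrite -mulrBl natrB//.
by rewrite (nsteps_add j t0 h0) leq_addr.
Qed.

Local Notation S := (speed s M K1 K2).

Lemma sol_lip t h B x : 0 <= t -> 0 <= h -> t + h <= B ->
  `|sol (t + h) x - sol t x| <= h * S B.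
Proof.
move=> t0 h0 thB; have th0 := addr_ge0 t0 h0.
have L : `|approx j (t + h) x - approx j t x| @[j --> F] --> `|sol (t + h) x - sol t x|.
  by apply: cvg_norm; apply: cvgB; exact: approx_cvg.
have RR : (nsteps j (t + h) - nsteps j t)%:R * mesh j ^+ 2 * S B @[j --> F] --> h * S B.
  by apply: cvgM; [exact: increment_cvg|exact: cvg_cst].
apply: (ler_cvg_to L RR).
apply: nearW => j; rewrite /approx {1}(nsteps_add j t0 h0).
apply: (scheme_lip s0 phiC) => //; [exact: ltW (mesh_gt0 j)|exact: mesh_stable|].
rewrite -(nsteps_add j t0 h0).
by have /andP[H _] := nsteps_bounds j th0; exact: le_trans thB.
Qed.

Lemma sol_expand t h B x e : 0 <= t -> 0 <= h -> t + h <= B -> 0 < e ->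
  `|sol (t + h) x - sol t x - h * reaction s (sol t) (sol_jet t) x| <=
  h * (4 * (h * S B) / e ^+ 2 + 4 * bound3 s K1 K2 K3 B * e + 2 * s * M * (h * S B)).
Proof.
move=> t0 h0 thB e0; have th0 := addr_ge0 t0 h0.
have I := increment_cvg t0 h0.
have L : `|approx j (t + h) x - approx j t x - (nsteps j (t + h) - nsteps j t)%:R * mesh j ^+ 2
    * reaction s (approx j t) (approx_jet j t) x| @[j --> F] -->
    `|sol (t + h) x - sol t x - h * reaction s (sol t) (sol_jet t) x|.
  apply: cvg_norm; apply: cvgB; first by apply: cvgB; exact: approx_cvg.
  by apply: cvgM => //; exact: approx_reaction_cvg.
have m0 : mesh @ F --> (0 : R) by apply: cvg_finer; exact: mesh_cvg0.
pose T j := (nsteps j (t + h) - nsteps j t)%:R * mesh j ^+ 2.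
pose C := 8 * bound3 s K1 K2 K3 B + 8 * s * M * bound2 s K1 K2 B.
have RR : T j * (4 * (T j * S B) / e ^+ 2 + 4 * bound3 s K1 K2 K3 B * e
   + 2 * s * M * (T j * S B) + mesh j * C) @[j --> F] -->
   h * (4 * (h * S B) / e ^+ 2 + 4 * bound3 s K1 K2 K3 B * e + 2 * s * M * (h * S B) + 0 * C).
  have IS : T j * S B @[j --> F] --> h * S B by apply: cvgM => //; exact: cvg_cst.
  apply: cvgM => //; apply: cvgD; last by apply: cvgM => //; exact: cvg_cst.
  apply: cvgD; last by apply: cvgM => //; exact: cvg_cst.
  apply: cvgD; last exact: cvg_cst.
  by apply: cvgM; last exact: cvg_cst; apply: cvgM => //; exact: cvg_cst.
rewrite mul0r addr0 in RR; apply: (ler_cvg_to L RR).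
apply: nearW => j; rewrite /approx {1}(nsteps_add j t0 h0).
apply: (scheme_expand s0 phiC) => //; [exact: ltW (mesh_gt0 j)|exact: mesh_le1|exact: mesh_stable|].
rewrite -(nsteps_add j t0 h0).
by have /andP[H _] := nsteps_bounds j th0; exact: le_trans thB.
Qed.

Lemma sol0 x : sol 0 x = phi x.
Proof.
rewrite /sol (_ : (fun j => _) = (fun=> phi x)); last first.
  by apply/funext => j; rewrite /approx /nsteps mul0r truncn0.
by apply: cvg_lim => //; exact: cvg_cst.
Qed.

(** [sol_expand] looks forward in time only, so left increments need a separate argument. *)
Lemma sol_deriv_t t x : 0 < t ->
  is_derive t 1 (fun r => sol r x) (reaction s (sol t) (sol_jet t) x).
Proof.
move=> t0; apply: is_derive_expansion => e e0.
pose B := t + 1; have B0 : 0 <= B by rewrite addr_ge0// ltW.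
have S0 : 0 <= S B by rewrite addr_ge0// mulr_ge0// ?bound2_ge0// sqr_ge0.
have b30 := bound3_ge0 s0 K10 K20 K30 B0; set b3 := bound3 _ _ _ _ _ in b30.
(* The interpolation length is fixed first, its own error being at most [e / 4]; the time increment
   is then made small through [c], which contains the inverse square of this length. *)
pose n := e / 4 / (4 * b3 + 1).
have n0 : 0 < n by rewrite divr_gt0 ?divr_gt0// ltr_pwDr// mulr_ge0.
have Hn : 4 * b3 * n <= e / 4.
  rewrite /n mulrA ler_pdivrMr; last by rewrite ltr_pwDr// mulr_ge0.
  lra.
pose c := 4 * S B / n ^+ 2 + 2 * s * M * S B.
have c0 : 0 <= c.
  by rewrite /c addr_ge0//; [rewrite divr_ge0 ?sqr_ge0// mulr_ge0|rewrite !mulr_ge0].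
pose d := Num.min (Num.min 1 t) (e / 4 / (c + 1)).
have d0 : 0 < d.
  rewrite /d !lt_min ltr01 t0 /=; apply: divr_gt0; first exact: divr_gt0.
  exact: ltr_wpDl.
have key h : 0 <= h -> h < d ->
   4 * (h * S B) / n ^+ 2 + 4 * b3 * n + 2 * s * M * (h * S B) <= e / 2.
  move=> h0 hd; rewrite (_ : _ + _ = h * c + 4 * b3 * n); last by rewrite /c; ring.
  have : h * c <= e / 4.
    have : h <= e / 4 / (c + 1) by apply: (le_trans (ltW hd)); rewrite /d ge_min lexx orbT.
    rewrite ler_pdivlMr ?ltr_pwDr//; apply: le_trans.
    by rewrite ler_wpM2l// lerDl.
  lra.
exists d => // h hn0 hd.
have [h0|h0] := leP 0 h.
  rewrite ger0_norm// in hd *.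
  have hB : t + h <= B.
    by rewrite lerD2l; apply: (le_trans (ltW hd)); rewrite /d !ge_min lexx.
  apply: (le_trans (sol_expand x (ltW t0) h0 hB n0)).
  rewrite [leRHS]mulrC ler_wpM2l//; apply: (le_trans (key h h0 hd)); lra.
(* Left increment: expand forward from [t - k], then move the right-hand side from [t - k] to [t] by
   interpolation, each at relative cost [e / 2]. *)
rewrite ltr0_norm// in hd *; set k := - h in hd *.
have k0 : 0 <= k by rewrite oppr_ge0 ltW.
have tk0 : 0 <= t - k.
  rewrite subr_ge0; apply: (le_trans (ltW hd)).
  by rewrite /d !ge_min lexx orbT.
have tkk : t - k + k = t by rewrite subrK.
have tB : t - k + k <= B by rewrite tkk lerDl.
have tB' : t <= B by rewrite lerDl.
have tkB : t - k <= B by rewrite lerBlDr; apply: (le_trans tB'); rewrite lerDl.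
have h1 := sol_expand x tk0 k0 tB n0; rewrite tkk -/b3 in h1.
have lip y : `|sol t y - sol (t - k) y| <= k * S B.
  by have := sol_lip y tk0 k0 tB; rewrite tkk.
have h2 := reaction_interp s0 x (sol_C21 (ltW t0) tB') (sol_C21 tk0 tkB) lip n0.
rewrite -/b3 in h2; have h3 := key k k0 hd.
rewrite (_ : t + h = t - k); last by rewrite /k opprK.
rewrite (_ : h = - k); last by rewrite /k opprK.
set A := reaction s (sol t) _ x in h1 h2 *; set A' := reaction _ _ _ x in h1 h2 *.
have h4 : `|k * (A - A')| <= k * (e / 2).
  by rewrite normrM ger0_norm// ler_wpM2l//; exact: le_trans h3.
have h5 : `|sol t x - sol (t - k) x - k * A'| <= k * (e / 2).
  by apply: (le_trans h1); rewrite ler_wpM2l.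
move: h4 h5; rewrite !ler_norml => /andP[? ?] /andP[? ?].
by apply/andP; split; lra.
Qed.

Lemma sol_continuous :
  {within [set p : R * (R * R) | 0 <= p.1], continuous (fun p => sol p.1 p.2)}.
Proof.
apply/subspace_continuousP => -[t x] /= t0.
apply/cvgrPdist_le => e e0.
pose B := t + 1; have B0 : 0 <= B by rewrite addr_ge0// ltW.
have S0 : 0 <= S B by rewrite addr_ge0// mulr_ge0// ?bound2_ge0// sqr_ge0.
pose C := S B + 2 * K1 + 1.
have C0 : 0 < C by rewrite ltr_pwDr// addr_ge0// mulr_ge0.
pose d := Num.min 1 (e / C).
have d0 : 0 < d by rewrite lt_min ltr01 divr_gt0.
rewrite /within/=; apply/nbhs_ballP; exists d => //= -[t' x'] [/= Bt [Bx1 Bx2]] /= t'0.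
have H r : `|r| < d -> `|r| <= e / C by move=> h; rewrite (le_trans (ltW h))// /d ge_min lexx orbT.
have {}Bt : `|t - t'| < d by [].
have {}Bx1 : `|x.1 - x'.1| < d by [].
have {}Bx2 : `|x.2 - x'.2| < d by [].
have Bd : `|t - t'| <= 1 by rewrite (le_trans (ltW Bt))// /d ge_min lexx.
have t'B : t' <= B.
  rewrite /B -lerBlDl; apply: le_trans Bd; rewrite distrC; exact: ler_norm.
have tB : t <= B by rewrite lerDl.
have T1 : `|sol t x' - sol t' x'| <= `|t - t'| * S B.
  have [tt'|tt'] := leP t t'.
    have h0 : 0 <= t' - t by rewrite subr_ge0.
    have th : t + (t' - t) <= B by rewrite subrKC.
    have := sol_lip x' t0 h0 th.
    by rewrite subrKC distrC => /le_trans; apply; rewrite distrC ger0_norm.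
  have h0 : 0 <= t - t' by rewrite subr_ge0 ltW.
  have th : t' + (t - t') <= B by rewrite subrKC.
  have := sol_lip x' t'0 h0 th.
  by rewrite subrKC => /le_trans; apply; rewrite ger0_norm.
have T2 : `|sol t x - sol t x'| <= K1 * (`|x.1 - x'.1| + `|x.2 - x'.2|).
  have := C21_lip (sol_C21 t0 tB) x' (x.1 - x'.1) (x.2 - x'.2).
  by rewrite /pshift !subrKC -surjective_pairing.
rewrite (_ : sol t x - sol t' x' = (sol t x - sol t x') + (sol t x' - sol t' x')); last by ring.
apply: (le_trans (ler_normD _ _)).
have eC : 0 <= e / C by rewrite divr_ge0// ltW.
have T1' : `|t - t'| * S B <= e / C * S B by rewrite ler_wpM2r// H.
have T2' : K1 * (`|x.1 - x'.1| + `|x.2 - x'.2|) <= K1 * (e / C + e / C).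
  by rewrite ler_wpM2l// lerD// H.
have : e / C * C = e by rewrite divfK// gt_eqF.
rewrite {2}/C; set E := e / C in T1' T2' eC *; move=> <-; lra.
Qed.

Lemma sol_pde : sbm_pde_solution s phi sol.
Proof.
split; first exact: sol0.
have V t x : 0 <= t -> 0 <= sol t x <= M.
  by move=> t0; exact: C21_val (sol_C21 t0 (lexx t)) x.
split; first by move=> t x /(V t x) /andP[].
split.
  by exists M => t x /(V t x) /andP[h1 h2]; rewrite ger0_norm.
split; first exact: sol_continuous.
move=> t a b t0; have H := sol_C21 (ltW t0) (lexx t).
have Dt := sol_deriv_t (a, b) t0.
have Da (y : R) : is_derive y 1 (fun z => sol t (z, b)) (j1 (sol_jet t (y, b))).
  exact: C21_derive1 H.
have Db (y : R) : is_derive y 1 (fun z => sol t (a, z)) (j2 (sol_jet t (a, y))).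
  exact: (C21_derive1 y a (C21_swap H)).
have Daa : is_derive a 1 (fun y => j1 (sol_jet t (y, b))) (j11 (sol_jet t (a, b))).
  exact: C21_derive11 H.
have Dbb : is_derive b 1 (fun y => j2 (sol_jet t (a, y))) (j22 (sol_jet t (a, b))).
  exact: (C21_derive11 b a (C21_swap H)).
have E1 : (fun y => 'D_1 (fun z => sol t (z, b)) y) = (fun y => j1 (sol_jet t (y, b))).
  by apply/funext => y; have [] := Da y.
have E2 : (fun y => 'D_1 (fun z => sol t (a, z)) y) = (fun y => j2 (sol_jet t (a, y))).
  by apply/funext => y; have [] := Db y.
rewrite E1 E2.
have [D1 ->] := Dt; have [D2 _] := Da a; have [D3 _] := Db b.
have [D4 ->] := Daa; have [D5 ->] := Dbb.
split; [exact: D1|split; [exact: D2|split; [exact: D3|split; [exact: D4|split; [exact: D5|]]]]].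
by rewrite /reaction /lapl /=; ring.
Qed.

End Solution.

(** * Expectation over one displacement *)

Definition padd {R : realType} (x y : R * R) : R * R := (x.1 + y.1, x.2 + y.2).

Lemma measurable_fun_padd {R : realType} d (T : measurableType d) (f g : T -> R * R) :
  measurable_fun setT f -> measurable_fun setT g ->
  measurable_fun setT (fun w => padd (f w) (g w)).
Proof.
move=> mf mg.
apply: measurable_fun_pair; apply: measurable_funD; apply: measurableT_comp => //;
  apply: measurable_fst || apply: measurable_snd.
Qed.

(** Spanned by the monomials of degree at most 2 and [|y|^4], whose expectations are fixed by the
    mean, the covariance and [moment4]. *)
Definition pol7 {R : realType} (a b c d e f g : R) (y : R * R) : R :=
  a + (b * y.1 + (c * y.2 + (d * y.1 ^+ 2 + (e * (y.1 * y.2)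
    + (f * y.2 ^+ 2 + g * (y.1 ^+ 2 + y.2 ^+ 2) ^+ 2))))).

Section Expectation.
Context {R : realType} {d : measure_display} {Omega : measurableType d}.
Context (P : probability Omega R) (X0 : Omega -> (R * R)%type).
Hypothesis hX0_meas : measurable_fun [set: Omega] X0.

Definition EX (v : R * R -> R) (x : R * R) : R := \int[P]_w v (padd x (X0 w)).

Lemma measurable_shift_X0 (v : R * R -> R) x :
  measurable_fun setT v -> measurable_fun setT (fun w => v (padd x (X0 w))).
Proof.
by move=> mv; apply: (measurableT_comp mv); apply: measurable_fun_padd => //; exact: measurable_cst.
Qed.

Lemma bounded_integrable (f : Omega -> R) (C : R) : measurable_fun setT f ->
  (forall w, `|f w| <= C) -> P.-integrable setT (EFin \o f).
Proof.
move=> mf fC; apply: measurable_bounded_integrable => //=.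
  by rewrite -ge0_fin_numE ?fin_num_measure.
by exists C; split; [exact: num_real|move=> M CM w _; exact: le_trans (ltW CM)].
Qed.

Lemma Rintegral_probability_cst (c : R) : \int[P]_w c = c.
Proof. by rewrite /Rintegral integral_cst// [X in (_ * X)%E](@probability_setT _ _ _ P) mule1. Qed.

Lemma EX_itv (v : R * R -> R) x : measurable_fun setT v ->
  (forall y, 0 <= v y <= 1) -> 0 <= EX v x <= 1.
Proof.
move=> mv v01; apply/andP; split.
  by apply: Rintegral_ge0 => w _; have /andP[] := v01 (padd x (X0 w)).
rewrite -[leRHS](Rintegral_probability_cst 1); apply: le_Rintegral => //.
- apply: (bounded_integrable (measurable_shift_X0 x mv) (C := 1)) => w.
  by have /andP[? ?] := v01 (padd x (X0 w)); rewrite ger0_norm.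
- exact: finite_measure_integrable_cst.
- by move=> w _; have /andP[] := v01 (padd x (X0 w)).
Qed.

Lemma measurable_EX (v : R * R -> R) : measurable_fun setT v ->
  (forall y, 0 <= v y) -> measurable_fun setT (EX v).
Proof.
move=> mv v0; apply: measurableT_comp => //.
pose f (z : (R * R) * Omega) := (v (padd z.1 (X0 z.2)))%:E.
apply: (@measurable_fun_fubini_tonelli_F _ _ _ _ _ P f).
  apply/measurable_EFinP; apply: (measurableT_comp mv); apply: measurable_fun_padd.
    exact: measurable_fst.
  by apply: measurableT_comp => //; exact: measurable_snd.
by move=> z; rewrite lee_fin.
Qed.

Hypothesis hX0_m4 : (\int[P]_w ((((X0 w).1 ^+ 2 + (X0 w).2 ^+ 2) ^+ 2)%:E) < +oo)%E.

Definition moment4 : R := \int[P]_w (((X0 w).1 ^+ 2 + (X0 w).2 ^+ 2) ^+ 2).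

Let mX1 : measurable_fun setT (fun w => (X0 w).1).
Proof. by apply: measurableT_comp => //; exact: measurable_fst. Qed.

Let mX2 : measurable_fun setT (fun w => (X0 w).2).
Proof. by apply: measurableT_comp => //; exact: measurable_snd. Qed.

Lemma moment4_ge0 : 0 <= moment4.
Proof. by apply: Rintegral_ge0 => w _; rewrite sqr_ge0. Qed.

Let integrable_dominated (f : Omega -> R) : measurable_fun setT f ->
  (forall w, `|f w| <= 1 + ((X0 w).1 ^+ 2 + (X0 w).2 ^+ 2) ^+ 2) ->
  P.-integrable setT (EFin \o f).
Proof.
move=> mf fM.
have I4 : P.-integrable setT (fun w => (((X0 w).1 ^+ 2 + (X0 w).2 ^+ 2) ^+ 2)%:E).
  apply/integrableP; split.
    apply/measurable_EFinP; apply: measurable_funX; apply: measurable_funD;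
    exact: measurable_funX.
  under eq_integral do rewrite /= ger0_norm ?sqr_ge0//.
  exact: hX0_m4.
have I1 := finite_measure_integrable_cst P 1 measurableT.
apply: (le_integrable measurableT _ _ (integrableD measurableT I1 I4)).
  exact/measurable_EFinP.
move=> w _; rewrite /= lee_fin; apply: (le_trans (fM w)); exact: ler_norm.
Qed.

Let dominate (a b : R) : [/\ `|a| <= 1 + (a ^+ 2 + b ^+ 2) ^+ 2,
  a ^+ 2 <= 1 + (a ^+ 2 + b ^+ 2) ^+ 2 & `|a * b| <= 1 + (a ^+ 2 + b ^+ 2) ^+ 2].
Proof.
have h1 := sqr_ge0 (a ^+ 2 + b ^+ 2 - 2^-1); have h2 := sqr_ge0 (a - 2^-1).
have h3 := sqr_ge0 (a + 2^-1); have h4 := sqr_ge0 (a - b); have h5 := sqr_ge0 (a + b).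
have h6 := sqr_ge0 a; have h7 := sqr_ge0 b.
by rewrite !ler_norml; split; try (apply/andP; split); lra.
Qed.

Let int0 : P.-integrable setT (fun w => ((1 : R))%:E).
Proof. exact: (finite_measure_integrable_cst P 1 measurableT). Qed.
Let int1 : P.-integrable setT (fun w => ((X0 w).1)%:E).
Proof. by apply: integrable_dominated => // w; have [] := dominate (X0 w).1 (X0 w).2. Qed.
Let int2 : P.-integrable setT (fun w => ((X0 w).2)%:E).
Proof. by apply: integrable_dominated => // w; have [] := dominate (X0 w).2 (X0 w).1; rewrite (addrC (_ ^+ 2)). Qed.
Let int11 : P.-integrable setT (fun w => ((X0 w).1 ^+ 2)%:E).
Proof.
apply: integrable_dominated => [|w]; first exact: measurable_funX.
by rewrite ger0_norm ?sqr_ge0//; have [] := dominate (X0 w).1 (X0 w).2.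
Qed.
Let int22 : P.-integrable setT (fun w => ((X0 w).2 ^+ 2)%:E).
Proof.
apply: integrable_dominated => [|w]; first exact: measurable_funX.
by rewrite ger0_norm ?sqr_ge0//; have [] := dominate (X0 w).2 (X0 w).1; rewrite (addrC (_ ^+ 2)).
Qed.
Let int12 : P.-integrable setT (fun w => ((X0 w).1 * (X0 w).2)%:E).
Proof.
apply: integrable_dominated => [|w]; first exact: measurable_funM.
by have [] := dominate (X0 w).1 (X0 w).2.
Qed.
Let int4 : P.-integrable setT (fun w => (((X0 w).1 ^+ 2 + (X0 w).2 ^+ 2) ^+ 2)%:E).
Proof.
apply: integrable_dominated => [|w].
  by apply: measurable_funX; apply: measurable_funD; exact: measurable_funX.
by rewrite ger0_norm ?sqr_ge0//; lra.
Qed.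

Hypothesis hX0_mean1 : (\int[P]_w ((X0 w).1)%:E = 0)%E.
Hypothesis hX0_mean2 : (\int[P]_w ((X0 w).2)%:E = 0)%E.
Hypothesis hX0_cov11 : (\int[P]_w (((X0 w).1 ^+ 2)%:E) = 1)%E.
Hypothesis hX0_cov22 : (\int[P]_w (((X0 w).2 ^+ 2)%:E) = 1)%E.
Hypothesis hX0_cov12 : (\int[P]_w (((X0 w).1 * (X0 w).2)%:E) = 0)%E.

Lemma Rintegral_pol7 (a b c e f g h : R) :
  P.-integrable setT (EFin \o (fun w => pol7 a b c e f g h (X0 w))) /\
  \int[P]_w (pol7 a b c e f g h (X0 w)) = a + e + g + h * moment4.
Proof.
have Z (k : R) (F G : Omega -> R) (i j : R) :
   P.-integrable setT (EFin \o F) -> \int[P]_w F w = i ->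
   P.-integrable setT (EFin \o G) /\ \int[P]_w G w = j ->
   P.-integrable setT (EFin \o (fun w => k * F w + G w)) /\
   \int[P]_w (k * F w + G w) = k * i + j.
  move=> IF <- [IG <-].
  have IkF : P.-integrable setT (EFin \o (fun w => k * F w)) by exact: (integrableZl measurableT k IF).
  split; first exact: (integrableD measurableT IkF IG).
  by rewrite RintegralD// RintegralZl.
have E1 : \int[P]_w ((X0 w).1) = 0 by rewrite /Rintegral hX0_mean1.
have E2 : \int[P]_w ((X0 w).2) = 0 by rewrite /Rintegral hX0_mean2.
have E11 : \int[P]_w ((X0 w).1 ^+ 2) = 1 by rewrite /Rintegral hX0_cov11.
have E22 : \int[P]_w ((X0 w).2 ^+ 2) = 1 by rewrite /Rintegral hX0_cov22.
have E12 : \int[P]_w ((X0 w).1 * (X0 w).2) = 0 by rewrite /Rintegral hX0_cov12.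
have E4 : P.-integrable setT (EFin \o (fun w => h * (((X0 w).1 ^+ 2 + (X0 w).2 ^+ 2) ^+ 2)))
   /\ \int[P]_w (h * (((X0 w).1 ^+ 2 + (X0 w).2 ^+ 2) ^+ 2)) = h * moment4.
  by split; [exact: (integrableZl measurableT h int4)|rewrite RintegralZl].
have [I E] := Z a _ _ _ _ int0 (Rintegral_probability_cst 1) (Z b _ _ _ _ int1 E1 (Z c _ _ _ _ int2 E2
 (Z e _ _ _ _ int11 E11 (Z f _ _ _ _ int12 E12 (Z g _ _ _ _ int22 E22 E4))))).
have F : (fun w => pol7 a b c e f g h (X0 w)) = (fun w => a * 1 +
  (b * (X0 w).1 + (c * (X0 w).2 + (e * (X0 w).1 ^+ 2 + (f * ((X0 w).1 * (X0 w).2) +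
  (g * (X0 w).2 ^+ 2 + h * ((X0 w).1 ^+ 2 + (X0 w).2 ^+ 2) ^+ 2)))))).
  by apply/funext => w; rewrite /pol7 mulr1.
by split; rewrite F//; move: E => ->; ring.
Qed.

Lemma EX_le_pol7 (v : R * R -> R) x (a b c e f g h : R) : measurable_fun setT v ->
  (forall y, 0 <= v y <= 1) -> (forall y, v (padd x y) <= pol7 a b c e f g h y) ->
  EX v x <= a + e + g + h * moment4.
Proof.
move=> mv v01 vp; have [I <-] := Rintegral_pol7 a b c e f g h.
apply: le_Rintegral => //.
apply: (bounded_integrable (measurable_shift_X0 x mv) (C := 1)) => w.
by have /andP[? ?] := v01 (padd x (X0 w)); rewrite ger0_norm.
Qed.

Lemma EX_ge_pol7 (v : R * R -> R) x (a b c e f g h : R) : measurable_fun setT v ->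
  (forall y, 0 <= v y <= 1) -> (forall y, pol7 a b c e f g h y <= v (padd x y)) ->
  a + e + g + h * moment4 <= EX v x.
Proof.
move=> mv v01 vp; have [I <-] := Rintegral_pol7 a b c e f g h.
apply: le_Rintegral => //.
apply: (bounded_integrable (measurable_shift_X0 x mv) (C := 1)) => w.
by have /andP[? ?] := v01 (padd x (X0 w)); rewrite ger0_norm.
Qed.

End Expectation.

(** A bare solution would not suffice for the comparison with the branching recursion: the one-step
    expansion, with an error uniform in space and in times up to 1, is exported as well, its length
    [e] still free. *)
Lemma pde_solution_exists {R : realType} (s M K1 K2 K3 : R) (phi : R * R -> R) J0 :
  0 <= s -> C21 M K1 K2 K3 phi J0 ->
  exists (u : R -> R * R -> R) (J : R -> R * R -> jet) (L2 L3 A : R),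
  [/\ sbm_pde_solution s phi u, 0 <= A,
    (forall t, 0 <= t <= 1 -> C21 M K1 L2 L3 (u t) (J t)) &
    (forall t h e x, 0 <= t -> 0 <= h -> t + h <= 1 -> 0 < e ->
      `|u (t + h) x - u t x - h * reaction s (u t) (J t) x|
        <= h * (A * h / e ^+ 2 + A * e + A * h))].
Proof.
move=> s0 H.
have N1 : norm1 1 0 = 1 :> R by rewrite /norm1 normr0 normr1 addr0.
have K10 : 0 <= K1 by have := C21_lip H (0, 0) 1 0; rewrite N1 mulr1; exact: le_trans.
have K20 : 0 <= K2.
  by have := C21_tay1 H (0, 0) 1 0; rewrite N1 expr1n mulr1; exact: le_trans.
have K30 : 0 <= K3.
  by have := C21_tay2 H (0, 0) 1 0; rewrite N1 expr1n mulr1; exact: le_trans.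
have [F [FP Foo Fcvg]] := ultrafilter_lim R.
pose S := speed s M K1 K2 1; pose b3 := bound3 s K1 K2 K3 1.
have M0 : 0 <= M by have /andP[a b] := C21_val H (0, 0); exact: le_trans b.
have S0 : 0 <= S by rewrite addr_ge0// mulr_ge0// ?bound2_ge0// sqr_ge0.
have b30 : 0 <= b3 by apply: bound3_ge0.
have sMS : 0 <= 2 * s * M * S by rewrite !mulr_ge0.
exists (sol s M phi F), (sol_jet s M phi J0 F), (bound2 s K1 K2 1), b3,
  (4 * S + 4 * b3 + 2 * s * M * S); split.
- exact: (sol_pde s0 H).
- by rewrite addr_ge0// addr_ge0// mulr_ge0.
- by move=> t /andP[t0 t1]; exact: (sol_C21 s0 H).
- move=> t h e x t0 h0 th e0.
  apply: (le_trans (sol_expand s0 H K10 K20 FP Foo Fcvg x t0 h0 th e0)).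
  apply: ler_wpM2l => //; rewrite -/S -/b3.
  have he : 0 <= h / e ^+ 2 by rewrite divr_ge0// exprn_ge0// ltW.
  set z := h / e ^+ 2 in he.
  have h1 : 0 <= (4 * b3 + 2 * s * M * S) * z by rewrite mulr_ge0// addr_ge0// mulr_ge0.
  have h2 : 0 <= (4 * S + 2 * s * M * S) * e by rewrite mulr_ge0 ?(ltW e0)// addr_ge0// mulr_ge0.
  have h3 : 0 <= (4 * S + 4 * b3) * h by rewrite mulr_ge0// addr_ge0// mulr_ge0.
  rewrite -subr_ge0; apply: le_trans (addr_ge0 (addr_ge0 h1 h2) h3) _.
  rewrite le_eqVlt; apply/orP; left; apply/eqP; rewrite /z; ring.
Qed.

(** * Test functions supported in a disc *)

Section Bump.
Context {R : realType}.

(* [(r^2 - |x - c|^2)_+^3], with the second-order jet obtained from the chain rule. *)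
Definition gap (r : R) (c x : R * R) : R := r ^+ 2 - (x.1 - c.1) ^+ 2 - (x.2 - c.2) ^+ 2.
Definition bump (r : R) (c x : R * R) : R := Num.max 0 (gap r c x) ^+ 3.
Definition bump_jet (r : R) (c x : R * R) : jet (R := R) :=
  let w := Num.max 0 (gap r c x) in let a := x.1 - c.1 in let b := x.2 - c.2 in
  Jet (- 6 * a * w ^+ 2) (- 6 * b * w ^+ 2)
      (24 * a ^+ 2 * w - 6 * w ^+ 2) (24 * a * b * w) (24 * b ^+ 2 * w - 6 * w ^+ 2).

Lemma bump_gt0 r c x : 0 < r -> (0 < bump r c x) = (x \in eball c r).
Proof.
move=> r0; have w0 : 0 <= Num.max 0 (gap r c x) by rewrite le_max lexx.
rewrite /bump lt_def exprn_ge0// andbT expf_eq0/= (_ : (_ != 0) = (0 < gap r c x)); last first.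
  by rewrite /Num.max; case: ltP => [h|_]; rewrite ?eqxx// gt_eqF.
apply/idP/idP => [h|]; rewrite ?inE /eball/=.
  rewrite -(ger0_norm (ltW r0)) -sqrtr_sqr ltr_sqrt ?exprn_gt0//.
  by move: h; rewrite /gap; lra.
rewrite -{1}(ger0_norm (ltW r0)) -sqrtr_sqr ltr_sqrt ?exprn_gt0// /gap; lra.
Qed.

(** For displacements longer than 1 the bounds on [u] and on its jet dominate every remainder, so
    Taylor estimates are required for short ones only. *)
Lemma C21_of_local (M A1 A2 A3 : R) (u : R * R -> R) (J : R * R -> jet (R := R)) :
  0 <= M -> 0 <= A1 -> 0 <= A2 -> 0 <= A3 ->
  (forall x, 0 <= u x <= M) ->
  (forall x h k, `|lin (J x) h k| <= A1 * norm1 h k) ->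
  (forall x h k, `|quad (J x) h k| <= A2 * norm1 h k ^+ 2) ->
  (forall x h k, norm1 h k <= 1 ->
    `|u (pshift x h k) - u x - lin (J x) h k - quad (J x) h k| <= A3 * norm1 h k ^+ 3) ->
  let K := M + A1 + A2 + A3 in C21 M K K K u J.
Proof.
move=> M0 A10 A20 A30 Hv Hl Hq Ht K.
have L (x : R * R) (h k : R) : 0 <= norm1 h k /\
  (`|u (pshift x h k) - u x| <= K * norm1 h k /\
   `|u (pshift x h k) - u x - lin (J x) h k| <= K * norm1 h k ^+ 2 /\
   `|u (pshift x h k) - u x - lin (J x) h k - quad (J x) h k| <= K * norm1 h k ^+ 3).
  have := Hv x; have := Hv (pshift x h k); have := Hl x h k; have := Hq x h k.
  have := Ht x h k; have := norm1_ge0 h k.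
  move: (u (pshift x h k)) (u x) (lin _ _ _) (quad _ _ _) (norm1 h k) => v w l q n n0 T.
  move=> qn ln /andP[? ?] /andP[? ?]; split=> //.
  have [n1|n1] := leP n 1.
    have {}T := T n1.
    have n21 : n ^+ 2 <= n by rewrite expr2 ler_piMr.
    have n32 : n ^+ 3 <= n ^+ 2 by rewrite exprS ler_piMl// exprn_ge0.
    have e1 : A2 * n ^+ 2 <= A2 * n by rewrite ler_wpM2l.
    have e2 : A3 * n ^+ 3 <= A3 * n ^+ 2 by rewrite ler_wpM2l.
    have e3 : A3 * n ^+ 2 <= A3 * n by rewrite ler_wpM2l.
    have f1 : 0 <= M * n by rewrite mulr_ge0.
    have f2 : 0 <= (M + A1) * n ^+ 2 by rewrite mulr_ge0 ?exprn_ge0// addr_ge0.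
    have f3 : 0 <= (M + A1 + A2) * n ^+ 3 by rewrite mulr_ge0 ?exprn_ge0// !addr_ge0.
    rewrite /K; move: T qn ln; rewrite !ler_norml => /andP[? ?] /andP[? ?] /andP[? ?].
    by split; [|split]; apply/andP; split; lra.
  have n2 : n <= n ^+ 2 by rewrite expr2 ler_peMr// ltW.
  have n3 : n ^+ 2 <= n ^+ 3 by rewrite [leRHS]exprS ler_peMl ?exprn_ge0// ltW.
  have e0 : M <= M * n by rewrite ler_peMr// ltW.
  have e1 : M * n <= M * n ^+ 2 by rewrite ler_wpM2l.
  have e2 : M * n ^+ 2 <= M * n ^+ 3 by rewrite ler_wpM2l.
  have e3 : A1 * n <= A1 * n ^+ 2 by rewrite ler_wpM2l.
  have e4 : A1 * n ^+ 2 <= A1 * n ^+ 3 by rewrite ler_wpM2l.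
  have e5 : A2 * n ^+ 2 <= A2 * n ^+ 3 by rewrite ler_wpM2l.
  have f1 : 0 <= (A1 + A2 + A3) * n by rewrite mulr_ge0// !addr_ge0.
  have f2 : 0 <= (A2 + A3) * n ^+ 2 by rewrite mulr_ge0 ?exprn_ge0// addr_ge0.
  have f3 : 0 <= A3 * n ^+ 3 by rewrite mulr_ge0 ?exprn_ge0// !addr_ge0.
  rewrite /K; move: qn ln; rewrite !ler_norml => /andP[? ?] /andP[? ?].
  by split; [|split]; apply/andP; split; lra.
split=> //.
- by move=> x h k; have [_ []] := L x h k.
- move=> x h k; apply: (le_trans (Hl x h k)); rewrite ler_wpM2r ?norm1_ge0//.
  by rewrite /K; lra.
- by move=> x h k; have [_ [_ []]] := L x h k.
- move=> x h k; apply: (le_trans (Hq x h k)); rewrite ler_wpM2r ?exprn_ge0 ?norm1_ge0//.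
  by rewrite /K; lra.
- by move=> x h k; have [_ [_ []]] := L x h k.
Qed.

Lemma C21_scale (t M K1 K2 K3 : R) (u : R * R -> R) (J : R * R -> jet (R := R)) :
  0 <= t -> C21 M K1 K2 K3 u J ->
  C21 (t * M) (t * K1) (t * K2) (t * K3) (fun x => t * u x)
    (fun x => Jet (t * j1 (J x)) (t * j2 (J x)) (t * j11 (J x)) (t * j12 (J x)) (t * j22 (J x))).
Proof.
move=> t0 [H1 H2 H3 H4 H5 H6].
have S z Z : `|z| <= Z -> `|t * z| <= t * Z by move=> ?; rewrite normrM ger0_norm// ler_wpM2l.
split=> x; try move=> h k.
- by have /andP[? ?] := H1 x; rewrite mulr_ge0//= ler_wpM2l.
- by rewrite -mulrBr -mulrA; exact: S.
- by rewrite (_ : lin _ _ _ = t * lin (J x) h k) -?mulrA; [exact: S|rewrite /lin/=; ring].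
- rewrite (_ : _ - _ = t * (u (pshift x h k) - u x - lin (J x) h k)) -?mulrA; first exact: S.
  by rewrite /lin/=; ring.
- by rewrite (_ : quad _ _ _ = t * quad (J x) h k) -?mulrA; [exact: S|rewrite /quad/=; field].
- rewrite (_ : _ - _ = t * (u (pshift x h k) - u x - lin (J x) h k - quad (J x) h k)) -?mulrA; first exact: S.
  by rewrite /lin /quad/=; field.
Qed.

(** The cube is the lowest integer power of the positive part with a Lipschitz second derivative,
    hence with a third-order remainder across the kink. *)
Lemma cube_pos_taylor (w d : R) :
  `|Num.max 0 (w + d) ^+ 3 - Num.max 0 w ^+ 3 - 3 * Num.max 0 w ^+ 2 * d
    - 3 * Num.max 0 w * d ^+ 2| <= `|d| ^+ 3.
Proof.
have M z : Num.max 0 z = if 0 < z then z else 0 by [].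
rewrite !M; case: ltP => h1; case: ltP => h2.
- rewrite (_ : _ - _ = d ^+ 3); last by ring.
  by rewrite normrX.
- have d0 : 0 < d by lra.
  rewrite (gtr0_norm d0) ger0_norm; last first.
    by rewrite !expr0n/= !mulr0 !mul0r !subr0 exprn_ge0// ltW.
  rewrite !expr0n/= !mulr0 !mul0r !subr0; apply: lerXn2r; rewrite ?nnegrE; lra.
- have d0 : d < 0 by lra.
  rewrite (ltr0_norm d0) (_ : _ - _ = - (w + d) ^+ 3 + d ^+ 3); last by rewrite expr0n/=; ring.
  have e1 : 0 <= (- (w + d)) ^+ 3 by rewrite exprn_ge0// oppr_ge0.
  have e2 : (- (w + d)) ^+ 3 <= (- d) ^+ 3 by rewrite lerXn2r ?nnegrE; lra.
  have E1 : (- (w + d)) ^+ 3 = - (w + d) ^+ 3 by ring.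
  have E2 : (- d) ^+ 3 = - d ^+ 3 by ring.
  rewrite E1 in e1 e2; rewrite E2 in e2 *; rewrite ler_norml; apply/andP; split; lra.
- by rewrite !expr0n/= !mulr0 !mul0r !subrr normr0 exprn_ge0.
Qed.

Definition slope (c x : R * R) (h k : R) : R := - 2 * ((x.1 - c.1) * h + (x.2 - c.2) * k).

Lemma pos_part_id (w : R) : 0 < w -> Num.max 0 w = w.
Proof. by rewrite /Num.max => ->. Qed.

Lemma pos_part0 (w : R) : w <= 0 -> Num.max 0 w = 0.
Proof. by rewrite leNgt /Num.max => /negbTE ->. Qed.

Lemma gap_le (r : R) c x : gap r c x <= r ^+ 2.
Proof. by rewrite /gap; have := sqr_ge0 (x.1 - c.1); have := sqr_ge0 (x.2 - c.2); lra. Qed.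

Lemma gap_shift (r : R) c x h k :
  gap r c (pshift x h k) = gap r c x + slope c x h k - (h ^+ 2 + k ^+ 2).
Proof. by rewrite /gap /slope /=; ring. Qed.

Lemma lin_bump (r : R) c x h k :
  lin (bump_jet r c x) h k = 3 * Num.max 0 (gap r c x) ^+ 2 * slope c x h k.
Proof. by rewrite /lin /slope/=; ring. Qed.

Lemma quad_bump (r : R) c x h k :
  quad (bump_jet r c x) h k = 3 * Num.max 0 (gap r c x) * slope c x h k ^+ 2
    - 3 * Num.max 0 (gap r c x) ^+ 2 * (h ^+ 2 + k ^+ 2).
Proof. by rewrite /quad /slope/=; field. Qed.

Lemma sumsq_le (h k : R) : 0 <= h ^+ 2 + k ^+ 2 /\ h ^+ 2 + k ^+ 2 <= norm1 h k ^+ 2.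
Proof.
split; first by rewrite addr_ge0 ?sqr_ge0.
rewrite /norm1 -(@real_normK _ h) ?num_real// -(@real_normK _ k) ?num_real// sqrrD.
by rewrite addrAC lerDl mulrn_wge0// mulr_ge0.
Qed.

Lemma slope_le (r : R) c x h k : 0 <= r -> 0 < gap r c x ->
  `|slope c x h k| <= 2 * r * norm1 h k.
Proof.
move=> r0 g0.
have ar : `|x.1 - c.1| <= r.
  rewrite -ler_sqr ?nnegrE// real_normK ?num_real//.
  by move: g0; rewrite /gap; have := sqr_ge0 (x.2 - c.2); lra.
have br : `|x.2 - c.2| <= r.
  rewrite -ler_sqr ?nnegrE// real_normK ?num_real//.
  by move: g0; rewrite /gap; have := sqr_ge0 (x.1 - c.1); lra.
rewrite /slope normrM (_ : `|- 2| = 2); last by rewrite normrN ger0_norm.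
rewrite -mulrA ler_wpM2l//.
apply: (le_trans (ler_normD _ _)); rewrite !normrM /norm1 mulrDr.
by apply: lerD; rewrite ler_wpM2r.
Qed.

Lemma C21_bump r c : 0 < r -> exists K, C21 (r ^+ 6) K K K (bump r c) (bump_jet r c).
Proof.
move=> r0; have r00 := ltW r0.
(* Bounds the variation of [gap] over a displacement of length at most 1, relative to that length,
   since [2 r + 1 <= (r + 1)^2]. *)
pose D := (r + 1) ^+ 2.
eexists; apply: (@C21_of_local (r ^+ 6) (6 * r ^+ 5) (15 * r ^+ 4) (D ^+ 3 + 3 * r ^+ 2 * (4 * r + 1))).
- exact: exprn_ge0.
- by rewrite mulr_ge0// exprn_ge0.
- by rewrite mulr_ge0// exprn_ge0.
- apply: addr_ge0; first exact: exprn_ge0 (sqr_ge0 _).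
  by apply: mulr_ge0; [rewrite mulr_ge0 ?sqr_ge0|lra].
- move=> x; rewrite /bump; set w := Num.max 0 _.
  have w0 : 0 <= w by rewrite le_max lexx.
  have wr : w <= r ^+ 2.
    rewrite ge_max sqr_ge0/= /gap; have := sqr_ge0 (x.1 - c.1); have := sqr_ge0 (x.2 - c.2); lra.
  rewrite exprn_ge0//= (_ : r ^+ 6 = (r ^+ 2) ^+ 3); last by ring.
  by rewrite lerXn2r ?nnegrE ?sqr_ge0.
- move=> x h k; rewrite lin_bump normrM ger0_norm; last by rewrite mulr_ge0 ?sqr_ge0.
  have [g0|/negP] := pselect (0 < gap r c x); last first.
    rewrite -leNgt => g0; by rewrite (pos_part0 g0) expr0n/= mulr0 mul0r mulr_ge0 ?norm1_ge0// mulr_ge0// exprn_ge0.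
  rewrite (pos_part_id g0) (_ : 6 * r ^+ 5 * _ = 3 * (r ^+ 2) ^+ 2 * (2 * r * norm1 h k)); last by ring.
  apply: ler_pM => //; [by rewrite mulr_ge0// sqr_ge0| |exact: slope_le].
  rewrite ler_wpM2l// lerXn2r ?nnegrE ?sqr_ge0 ?(ltW g0)//; exact: gap_le.
- move=> x h k; rewrite quad_bump.
  have n0 := norm1_ge0 h k; have [q0 qn] := sumsq_le h k.
  have [g0|/negP] := pselect (0 < gap r c x); last first.
    rewrite -leNgt => g0; by rewrite (pos_part0 g0) expr0n/= !mulr0 !mul0r subrr normr0 mulr_ge0 ?mulr_ge0 ?exprn_ge0.
  rewrite (pos_part_id g0); set l := slope c x h k; set w := gap r c x in g0 *.
  have ln : `|l| <= 2 * r * norm1 h k by exact: slope_le.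
  have wr : w <= r ^+ 2 by exact: gap_le.
  have l2 : l ^+ 2 <= (2 * r * norm1 h k) ^+ 2.
    by rewrite -(@real_normK _ l) ?num_real// lerXn2r ?nnegrE// !mulr_ge0.
  have e1 : 0 <= 3 * w * l ^+ 2 <= 3 * r ^+ 2 * (2 * r * norm1 h k) ^+ 2.
    apply/andP; split; first by rewrite mulr_ge0 ?sqr_ge0// mulr_ge0// ltW.
    by apply: ler_pM; rewrite ?sqr_ge0 ?ler_wpM2l// mulr_ge0// ltW.
  have e2 : 0 <= 3 * w ^+ 2 * (h ^+ 2 + k ^+ 2) <= 3 * (r ^+ 2) ^+ 2 * norm1 h k ^+ 2.
    apply/andP; split; first by rewrite mulr_ge0// mulr_ge0// sqr_ge0.
    apply: ler_pM => //; first by rewrite mulr_ge0// sqr_ge0.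
    by rewrite ler_wpM2l// lerXn2r ?nnegrE ?sqr_ge0// ltW.
  have e3 : 0 <= r ^+ 4 * norm1 h k ^+ 2 by rewrite mulr_ge0 ?exprn_ge0.
  move: e1 e2 => /andP[? ?] /andP[? ?].
  rewrite ler_norml; apply/andP; split; lra.
- move=> x h k n1; have n0 := norm1_ge0 h k; have [q0 qn] := sumsq_le h k.
  have nn : norm1 h k ^+ 2 <= norm1 h k by rewrite expr2 ler_piMr.
  have D0 : 0 <= D by exact: sqr_ge0.
  have rn : 0 <= r ^+ 2 * norm1 h k by rewrite mulr_ge0 ?sqr_ge0.
  have r2 : 0 <= 3 * r ^+ 2 * (4 * r + 1) by apply: mulr_ge0; [rewrite mulr_ge0 ?sqr_ge0|lra].
  have n3 : 0 <= norm1 h k ^+ 3 by rewrite exprn_ge0.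
  rewrite lin_bump quad_bump /bump.
  have G := gap_shift r c x h k.
  have [g0|/negP] := pselect (0 < gap r c x); last first.
    rewrite -leNgt => g0; rewrite (pos_part0 g0) !expr0n/= !mulr0 !mul0r subrr !subr0.
    rewrite mulrDl ler_wpDr//; first exact: mulr_ge0.
    have [g1|/negP] := pselect (0 < gap r c (pshift x h k)); last first.
      rewrite -leNgt => g1; by rewrite (pos_part0 g1) expr0n/= normr0 mulr_ge0// exprn_ge0.
    rewrite (pos_part_id g1) normrX (gtr0_norm g1) -exprMn.
    apply: lerXn2r; rewrite ?nnegrE; [exact: ltW|exact: mulr_ge0|].
    (* [slope_le] asks for a positive gap, which here holds only at the shifted point: the increment
       is read backwards from there. *)
    have := gap_shift r c (pshift x h k) (- h) (- k).
    rewrite (_ : pshift (pshift x h k) (- h) (- k) = x); last first.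
      by case: (x) => a b; rewrite /pshift/= !addrK.
    have := slope_le (- h) (- k) r00 g1; rewrite /norm1 !normrN -/(norm1 h k) !sqrrN ler_norml.
    by move=> /andP[? ?] ?; rewrite /D; lra.
  rewrite (pos_part_id g0) G; set l := slope c x h k; set w := gap r c x in g0 *.
  set q := h ^+ 2 + k ^+ 2 in q0 qn *.
  have ln : `|l| <= 2 * r * norm1 h k by exact: slope_le.
  have wr : w <= r ^+ 2 by exact: gap_le.
  have := cube_pos_taylor w (l - q); rewrite (pos_part_id g0) addrA.
  have dD : `|l - q| ^+ 3 <= D ^+ 3 * norm1 h k ^+ 3.
    rewrite -exprMn; apply: lerXn2r; rewrite ?nnegrE; [by []|exact: mulr_ge0|].
    rewrite /D; move: ln; rewrite !ler_norml.
    by move=> /andP[? ?]; apply/andP; split; lra.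
  have e1 : `|3 * w * (q * (2 * l - q))| <= 3 * r ^+ 2 * (4 * r + 1) * norm1 h k ^+ 3.
    rewrite (_ : _ * norm1 h k ^+ 3 = 3 * r ^+ 2 * (norm1 h k ^+ 2 * ((4 * r + 1) * norm1 h k))); last by ring.
    rewrite !normrM; apply: ler_pM; rewrite ?mulr_ge0//.
      by rewrite (gtr0_norm g0) (@ger0_norm _ 3)// ler_wpM2l.
    apply: ler_pM => //; first by rewrite ger0_norm.
    move: ln; rewrite !ler_norml => /andP[? ?]; apply/andP; split; lra.
  move=> T; have {}T := le_trans T dD.
  rewrite (_ : _ - _ = (Num.max 0 (w + l - q) ^+ 3 - w ^+ 3 - 3 * w ^+ 2 * (l - q)
    - 3 * w * (l - q) ^+ 2) - 3 * w * (q * (2 * l - q))); last by ring.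
  by rewrite [leRHS]mulrDl; apply: (le_trans (ler_normB _ _)); exact: lerD.
Qed.

End Bump.

(** * The hitting probability and its spatial tail *)

Section HitProbability.
Context {R : realType} (p : nat -> R) (s2 : R).
Hypothesis hp_ge0 : forall k, 0 <= p k.
Hypothesis hp_sum : (fun n => \sum_(0 <= k < n) p k) @ \oo --> (1 : R).
Hypothesis hp1 : p 1%N < 1.
Hypothesis hp_mean : (fun n => \sum_(0 <= k < n) (k%:R * p k)) @ \oo --> (1 : R).
Hypothesis hp_var : (fun n => \sum_(0 <= k < n) (k%:R ^+ 2 * p k)) @ \oo --> s2 + 1.
Context {d : measure_display} {Omega : measurableType d}.
Context (P : probability Omega R) (X0 : Omega -> (R * R)%type).
Hypothesis hX0_meas : measurable_fun [set: Omega] X0.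
Hypothesis hX0_m4 : (\int[P]_w ((((X0 w).1 ^+ 2 + (X0 w).2 ^+ 2) ^+ 2)%:E) < +oo)%E.
Hypothesis hX0_mean1 : (\int[P]_w ((X0 w).1)%:E = 0)%E.
Hypothesis hX0_mean2 : (\int[P]_w ((X0 w).2)%:E = 0)%E.
Hypothesis hX0_cov11 : (\int[P]_w (((X0 w).1 ^+ 2)%:E) = 1)%E.
Hypothesis hX0_cov22 : (\int[P]_w (((X0 w).2 ^+ 2)%:E) = 1)%E.
Hypothesis hX0_cov12 : (\int[P]_w (((X0 w).1 * (X0 w).2)%:E) = 0)%E.

Local Notation step := (survival_step p).
Local Notation E := (EX P X0).
Local Notation kappa := (moment4 P X0).

(** Defined analytically, with one displacement as its only randomness; [probability_reaches]
    identifies it with an event of the tree. *)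
Fixpoint hitp (B : set (R * R)) (k : nat) : R * R -> R :=
  if k is k'.+1 then fun x => step (E (hitp B k') x) else \1_B.

Lemma measurable_survival_step (f : R * R -> R) : measurable_fun setT f ->
  (forall x, 0 <= f x <= 1) -> measurable_fun setT (fun x => step (f x)).
Proof.
move=> mf f01; apply: measurable_funB; first exact: measurable_cst.
apply: (@measurable_fun_cvg _ _ _ setT
  (fun n x => \sum_(0 <= k < n) p k * (1 - f x) ^+ k)) => [n|x _].
  apply: measurable_sum => k; apply: measurable_funM; first exact: measurable_cst.
  by apply: measurable_funX; apply: measurable_funB; first exact: measurable_cst.
by apply: pgf_cvg => //; have /andP[? ?] := f01 x; apply/andP; split; lra.
Qed.

Lemma hitp_measurable_itv (B : set (R * R)) k : measurable B ->
  measurable_fun setT (hitp B k) /\ forall x, 0 <= hitp B k x <= 1.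
Proof.
move=> mB; elim: k => [|k [mk k01]]/=.
  split; first exact: measurable_indic.
  by move=> x; rewrite indicE; case: (x \in B); rewrite lexx ler01.
have e01 x : 0 <= E (hitp B k) x <= 1 by exact: EX_itv.
split.
  by apply: measurable_survival_step => //; apply: measurable_EX => // y; have /andP[] := k01 y.
by move=> x; rewrite survival_step_ge0// survival_step_le1.
Qed.

Lemma hitp_itv B k x : measurable B -> 0 <= hitp B k x <= 1.
Proof. by move=> mB; have [_] := hitp_measurable_itv k mB. Qed.

Lemma hitp_measurable B k : measurable B -> measurable_fun setT (hitp B k).
Proof. by move=> mB; have [] := hitp_measurable_itv k mB. Qed.

Lemma EX_cst_le (v : R * R -> R) x c : measurable_fun setT v ->
  (forall y, 0 <= v y <= 1) -> (forall y, v y <= c) -> E v x <= c.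
Proof.
move=> mv v01 vc.
have H := @EX_le_pol7 _ _ _ P X0 hX0_meas hX0_m4 hX0_mean1 hX0_mean2 hX0_cov11
  hX0_cov22 hX0_cov12 v x c 0 0 0 0 0 0 mv v01.
have : c + 0 + 0 + 0 * kappa = c by ring.
by move=> <-; apply: H => y; rewrite /pol7; apply: (le_trans (vc _)); lra.
Qed.

Lemma hitp_le_survival B k x : measurable B -> hitp B k x <= survival p k.
Proof.
move=> mB; elim: k x => [|k IH] x /=.
  by rewrite indicE; case: (x \in B); rewrite ?lexx ?ler01.
have [mk k01] := hitp_measurable_itv k mB.
have /andP[e0 e1] := EX_itv P hX0_meas x mk k01.
have /andP[s0 s1] := survival_itv hp_ge0 hp_sum k.
by apply: ler_survival_step => //; exact: EX_cst_le.
Qed.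

Local Notation spread := (1 - p 0%N - p 1%N).

(** The first term absorbs the long jumps into half of the increment [C / rho^4]; the second lets
    the branching loss beat the curvature of the barrier once [rho^2 < 640 k]. *)
Definition tail_const : R := 32 * kappa + 320 * 640 / spread.

Let spread0 : 0 < spread.
Proof. exact: offspring_spread. Qed.

Lemma tail_const_gt0 : 0 < tail_const.
Proof.
apply: ltr_wpDl; first by apply: mulr_ge0 => //; exact: moment4_ge0.
by apply: divr_gt0; [apply: mulr_gt0; rewrite ltr0n|exact: spread0].
Qed.

(** The constant is dictated by the left end, where [(1 + z)^4] is only [1 / 16]: [320 / 16 = 20]
    still covers the second-order remainder. *)
Lemma inv4_taylor (z : R) : - 2^-1 <= z -> z <= 2^-1 ->
  (1 + z) ^- 4 <= 1 - 4 * z + 320 * z ^+ 2.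
Proof.
move=> z1 z2; have h : 0 < 1 + z by lra.
rewrite -[leLHS]mul1r ler_pdivrMr ?exprn_gt0// -subr_ge0.
have -> : (1 - 4 * z + 320 * z ^+ 2) * (1 + z) ^+ 4 - 1 =
  z ^+ 2 * (320 * (1 + z) ^+ 4 - (10 + 20 * z + 15 * z ^+ 2 + 4 * z ^+ 3)) by ring.
apply: mulr_ge0; [exact: sqr_ge0|rewrite subr_ge0].
have a : 2^-1 <= 1 + z by lra.
have b : (2^-1) ^+ 4 <= (1 + z) ^+ 4 by rewrite lerXn2r ?nnegrE//; lra.
have c : z ^+ 2 <= 4^-1.
  have : 0 <= (2^-1 - z) * (2^-1 + z) by rewrite mulr_ge0//; lra.
  lra.
have e : z ^+ 3 <= 8^-1.
  have : 0 <= (2^-1 - z) * z ^+ 2 by rewrite mulr_ge0 ?sqr_ge0//; lra.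
  lra.
have : 320 * (1 + z) ^+ 4 >= 10 + 20 * z + 5.
  have [z0|z0] := leP 0 z; last by lra.
  have : 1 <= (1 + z) ^+ 4 by rewrite exprn_ege1//; lra.
  lra.
lra.
Qed.

(* Supersolution [C k / rho^4] of the one-dimensional problem in the direction [e]:
   the quartic term of the majorant absorbs the jumps larger than [rho / 2]. *)
Lemma hitp_halfplane B (e1 e2 rho0 : R) : measurable B ->
  e1 ^+ 2 + e2 ^+ 2 = 1 -> (forall x, B x -> e1 * x.1 + e2 * x.2 <= rho0) ->
  forall k x, 0 < e1 * x.1 + e2 * x.2 - rho0 ->
  hitp B k x <= tail_const * k%:R / (e1 * x.1 + e2 * x.2 - rho0) ^+ 4.
Proof.
move=> mB e12 HB; elim=> [|k IH] x.
  move=> x0 /=; rewrite indicE mulr0 mul0r (_ : (x \in B) = false)//.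
  by apply/negbTE/negP; rewrite inE => /HB; lra.
set rho := _ - rho0 => rho_gt0 /=; set C := tail_const in IH *.
have [mk k01] := hitp_measurable_itv k mB.
have /andP[a0 a1] := EX_itv P hX0_meas x mk k01.
have kap0 : 0 <= kappa := moment4_ge0 P X0.
have C0 : 0 < C := tail_const_gt0.
pose i := rho^-1; have i0 : 0 < i by rewrite invr_gt0.
have ri : rho * i = 1 by rewrite divff// gt_eqF.
pose W := C * k%:R * i ^+ 4.
have W0 : 0 <= W by rewrite mulr_ge0 ?exprn_ge0 ?(ltW i0)// mulr_ge0// ltW.
have bound : E (hitp B k) x <= W + 320 * W * i ^+ 2 + 16 * kappa * i ^+ 4.
  (* The majorant is [W (1 - 4 z + 320 z^2) + 16 (|y| / rho)^4], with [z] the relative change of the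
     distance. As [16 = 2^4], the last term exceeds 1 as soon as [|z| > 1 / 2]. *)
  have := @EX_le_pol7 _ _ _ P X0 hX0_meas hX0_m4 hX0_mean1 hX0_mean2 hX0_cov11
    hX0_cov22 hX0_cov12 _ x W (- 4 * W * e1 * i) (- 4 * W * e2 * i)
    (320 * W * e1 ^+ 2 * i ^+ 2) (640 * W * e1 * e2 * i ^+ 2)
    (320 * W * e2 ^+ 2 * i ^+ 2) (16 * i ^+ 4) mk k01.
  rewrite (_ : W + 320 * W * e1 ^+ 2 * i ^+ 2 + 320 * W * e2 ^+ 2 * i ^+ 2 + 16 * i ^+ 4 * kappa
     = W + 320 * W * (e1 ^+ 2 + e2 ^+ 2) * i ^+ 2 + 16 * kappa * i ^+ 4); last by ring.
  rewrite e12 mulr1; apply => y.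
  pose xi := e1 * y.1 + e2 * y.2; pose z := xi * i.
  have -> : pol7 W (- 4 * W * e1 * i) (- 4 * W * e2 * i) (320 * W * e1 ^+ 2 * i ^+ 2)
    (640 * W * e1 * e2 * i ^+ 2) (320 * W * e2 ^+ 2 * i ^+ 2) (16 * i ^+ 4) y
    = W * (1 - 4 * z + 320 * z ^+ 2) + 16 * (i ^+ 2 * (y.1 ^+ 2 + y.2 ^+ 2)) ^+ 2.
    by rewrite /pol7 /z /xi; ring.
  have z2 : z ^+ 2 <= i ^+ 2 * (y.1 ^+ 2 + y.2 ^+ 2).
    rewrite -[leRHS]mulr1 -e12 -subr_ge0.
    rewrite (_ : _ - _ = i ^+ 2 * (e1 * y.2 - e2 * y.1) ^+ 2); last by rewrite /z /xi; ring.
    by rewrite mulr_ge0 ?sqr_ge0.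
  have q0 : 0 <= 1 - 4 * z + 320 * z ^+ 2 by have := sqr_ge0 (2 * z - 1); have := sqr_ge0 z; lra.
  have [zb|zb] := leP `|z| 2^-1.
    move: zb; rewrite ler_norml => /andP[zl zr].
    have h : 0 < 1 + z by lra.
    have rho' : rho * (1 + z) = e1 * (padd x y).1 + e2 * (padd x y).2 - rho0.
      by rewrite mulrDr mulr1 /z mulrCA ri mulr1 /rho /xi /=; ring.
    have rho'0 : 0 < e1 * (padd x y).1 + e2 * (padd x y).2 - rho0 by rewrite -rho' mulr_gt0.
    have := IH _ rho'0; rewrite -rho' exprMn invfM mulrA -exprVn -/i -/W.
    move=> /le_trans; apply; apply: (@le_trans _ _ (W * (1 - 4 * z + 320 * z ^+ 2))).
      by rewrite ler_wpM2l// inv4_taylor.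
    by rewrite lerDl mulr_ge0// sqr_ge0.
  have /andP[_ v1] := k01 (padd x y); apply: (le_trans v1).
  apply: (@le_trans _ _ (16 * (i ^+ 2 * (y.1 ^+ 2 + y.2 ^+ 2)) ^+ 2)); last first.
    by rewrite lerDr mulr_ge0.
  have zq : 2^-1 ^+ 2 <= z ^+ 2.
    by rewrite -(@real_normK _ z) ?num_real// lerXn2r ?nnegrE// ltW.
  have : (2^-1 ^+ 2) ^+ 2 <= (i ^+ 2 * (y.1 ^+ 2 + y.2 ^+ 2)) ^+ 2 :> R.
    by rewrite lerXn2r ?nnegrE ?sqr_ge0//; [exact: le_trans (sqr_ge0 z) z2|exact: le_trans z2].
  by lra.
have C1 : 32 * kappa <= C.
  rewrite /C /tail_const lerDl; apply: divr_ge0; last exact: (ltW spread0).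
  by apply: mulr_ge0; exact: ler0n.
have C2 : 320 * 640 <= spread * C.
  rewrite [leRHS]mulrC -ler_pdivrMr// /C /tail_const lerDr mulr_ge0//.
have i4 : 0 <= i ^+ 4 by rewrite exprn_ge0// ltW.
have k1 : 16 * kappa * i ^+ 4 <= C / 2 * i ^+ 4 by rewrite ler_wpM2r//; lra.
have -> : C * k.+1%:R / rho ^+ 4 = W + C * i ^+ 4.
  by rewrite -exprVn -/i -[k.+1%:R]natr1 /W; ring.
have sle := survival_step_le hp_ge0 hp_sum hp_mean (q := E (hitp B k) x).
have ssq := survival_step_le_sqr hp_ge0 hp_sum hp_mean (q := E (hitp B k) x).
have {}sle : step (E (hitp B k) x) <= E (hitp B k) x by apply: sle; rewrite a0.
have {}ssq : step (E (hitp B k) x) <= E (hitp B k) x - spread * E (hitp B k) x ^+ 2.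
  by apply: ssq; rewrite a0.
(* For [640 k <= rho^2] the curvature term [320 W / rho^2] is at most the other half of the
   increment [C / rho^4]. *)
have [case1|case1] := leP (640 * k%:R * i ^+ 2) 1.
  apply: (le_trans sle); apply: (le_trans bound).
  have : 320 * W * i ^+ 2 <= C / 2 * i ^+ 4.
    rewrite (_ : 320 * W * i ^+ 2 = C / 2 * i ^+ 4 * (640 * k%:R * i ^+ 2)); last by rewrite /W; field.
    by rewrite ler_piMr// mulr_ge0// divr_ge0// ltW.
  by lra.
(* For larger [k], either the mean is already below the target, or it exceeds [W] and the loss
   [spread * W^2] outweighs the curvature term. *)
have [//|big] := leP (E (hitp B k) x) (W + C * i ^+ 4); first exact: le_trans.
apply: (le_trans ssq).
have Ci : 0 <= C * i ^+ 4 by rewrite mulr_ge0// ltW.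
have WE : W ^+ 2 <= E (hitp B k) x ^+ 2 by rewrite lerXn2r ?nnegrE//; lra.
have WE' : spread * W ^+ 2 <= spread * E (hitp B k) x ^+ 2 by rewrite ler_wpM2l// ltW.
suff : 320 * W * i ^+ 2 <= spread * W ^+ 2 by lra.
have Wi : 0 <= W * i ^+ 2 by rewrite mulr_ge0// sqr_ge0.
apply: (@le_trans _ _ (W * i ^+ 2 * (320 * (640 * k%:R * i ^+ 2)))).
  rewrite (_ : 320 * W * i ^+ 2 = W * i ^+ 2 * 320); last by ring.
  by rewrite ler_wpM2l//; lra.
rewrite (_ : spread * W ^+ 2 = W * i ^+ 2 * (spread * C * (k%:R * i ^+ 2))); last by rewrite /W; ring.
rewrite ler_wpM2l// (_ : 320 * _ = 320 * 640 * (k%:R * i ^+ 2)); last by ring.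
by rewrite ler_wpM2r// mulr_ge0// sqr_ge0.
Qed.

Local Notation enorm x := (Num.sqrt (x.1 ^+ 2 + x.2 ^+ 2)).

Lemma measurable_eball (c : R * R) (r : R) : measurable (eball c r).
Proof.
have mf : measurable_fun setT (fun y : R * R => Num.sqrt ((y.1 - c.1) ^+ 2 + (y.2 - c.2) ^+ 2)).
  apply: (measurableT_comp (continuous_measurable_fun (@sqrt_continuous R))).
  by apply: measurable_funD; apply: measurable_funX; apply: measurable_funB => //;
    exact: measurable_fst || exact: measurable_snd.
rewrite (_ : eball c r = setT `&` (fun y : R * R => Num.sqrt ((y.1 - c.1) ^+ 2 + (y.2 - c.2) ^+ 2)) @^-1` `]-oo, r[).
  exact: mf.
by rewrite setTI; apply/seteqP; split => y; rewrite /eball/= in_itv.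
Qed.

(** By Cauchy-Schwarz the disc lies in the half-plane orthogonal to the direction of [x], whose
    distance from [x] is [|x| - r]. *)
Lemma hitp_tail (r : R) k x : 0 <= r -> r < enorm x ->
  hitp (eball (0, 0) r) k x <= tail_const * k%:R / (enorm x - r) ^+ 4.
Proof.
move=> r0 rx; set n := enorm x in rx *.
have n0 : 0 < n by exact: le_lt_trans rx.
have nn : n ^+ 2 = x.1 ^+ 2 + x.2 ^+ 2 by rewrite sqr_sqrtr// addr_ge0 ?sqr_ge0.
have nV : n * n^-1 = 1 by rewrite divff// gt_eqF.
have e12 : (x.1 / n) ^+ 2 + (x.2 / n) ^+ 2 = 1.
  by rewrite !exprMn -mulrDl -nn -exprMn nV expr1n.
have ex : x.1 / n * x.1 + x.2 / n * x.2 = n.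
  rewrite (_ : _ + _ = (x.1 ^+ 2 + x.2 ^+ 2) / n); last by ring.
  by rewrite -nn expr2 -mulrA nV mulr1.
have := @hitp_halfplane (eball (0, 0) r) _ _ r (measurable_eball _ _) e12 _ k x.
rewrite ex; apply; last by rewrite subr_gt0.
move=> y; rewrite /eball/= !subr0 => yr.
apply: le_trans (ltW yr); apply: le_trans (ler_norm _) _.
rewrite -sqrtr_sqr ler_wsqrtr// -[leRHS]mulr1 -e12 -subr_ge0.
rewrite (_ : _ - _ = (x.1 / n * y.2 - x.2 / n * y.1) ^+ 2); last by ring.
exact: sqr_ge0.
Qed.

End HitProbability.

(** * Comparison of the branching recursion with the equation *)

Section Comparison.
Context {R : realType} (p : nat -> R) (s2 : R).
Hypothesis hp_ge0 : forall k, 0 <= p k.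
Hypothesis hp_sum : (fun n => \sum_(0 <= k < n) p k) @ \oo --> (1 : R).
Hypothesis hp1 : p 1%N < 1.
Hypothesis hp_mean : (fun n => \sum_(0 <= k < n) (k%:R * p k)) @ \oo --> (1 : R).
Hypothesis hp_var : (fun n => \sum_(0 <= k < n) (k%:R ^+ 2 * p k)) @ \oo --> s2 + 1.
Context {d : measure_display} {Omega : measurableType d}.
Context (P : probability Omega R) (X0 : Omega -> (R * R)%type).
Hypothesis hX0_meas : measurable_fun [set: Omega] X0.
Hypothesis hX0_m4 : (\int[P]_w ((((X0 w).1 ^+ 2 + (X0 w).2 ^+ 2) ^+ 2)%:E) < +oo)%E.
Hypothesis hX0_mean1 : (\int[P]_w ((X0 w).1)%:E = 0)%E.
Hypothesis hX0_mean2 : (\int[P]_w ((X0 w).2)%:E = 0)%E.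
Hypothesis hX0_cov11 : (\int[P]_w (((X0 w).1 ^+ 2)%:E) = 1)%E.
Hypothesis hX0_cov22 : (\int[P]_w (((X0 w).2 ^+ 2)%:E) = 1)%E.
Hypothesis hX0_cov12 : (\int[P]_w (((X0 w).1 * (X0 w).2)%:E) = 0)%E.

Local Notation step := (survival_step p).
Local Notation E := (EX P X0).
Local Notation kappa := (moment4 P X0).
Local Notation hit := (hitp p P X0).

Let s20 : 0 < s2.
Proof. exact: (offspring_var_gt0 hp_ge0 hp_sum hp_mean hp1 hp_var). Qed.

(** The Taylor remainder is cubic, which [pol7] cannot express: [n^3 <= (n^2 + n^4) / 2] and
    [n^2 <= 2 (h^2 + k^2)] bring it to available powers. *)
Lemma norm1_cube_le (h k : R) :
  norm1 h k ^+ 3 <= (h ^+ 2 + k ^+ 2) + 2 * (h ^+ 2 + k ^+ 2) ^+ 2.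
Proof.
have n0 := norm1_ge0 h k; set n := norm1 h k in n0 *; set q := h ^+ 2 + k ^+ 2.
have nq : n ^+ 2 <= 2 * q.
  rewrite /n /norm1 /q -(@real_normK _ h) ?num_real// -(@real_normK _ k) ?num_real//.
  have := sqr_ge0 (`|h| - `|k|); lra.
have n4 : (n ^+ 2) ^+ 2 <= (2 * q) ^+ 2 by rewrite lerXn2r ?nnegrE ?sqr_ge0// (le_trans (sqr_ge0 n)).
have h1 : 0 <= n ^+ 2 * (n - 1) ^+ 2 by rewrite mulr_ge0 ?sqr_ge0.
lra.
Qed.

(** From macroscopic to microscopic coordinates, sending [c] to the origin: the disc around [c]
    becomes one around [(0, 0)], and the starting point [(0, 0)] becomes [- a c]. *)
Definition rescale (a : R) (c x : R * R) : R * R := (a * (x.1 - c.1), a * (x.2 - c.2)).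

Lemma rescale_shift a c x (y : R * R) : a != 0 ->
  padd (rescale a c x) y = rescale a c (pshift x (y.1 / a) (y.2 / a)).
Proof. by move=> a0; rewrite /padd /rescale /=; congr pair; field. Qed.

(** First term: the Taylor remainder averaged over the displacement. Second term: the cost of
    evaluating the quadratic loss at the averaged value instead of [u x]. *)
Definition discretization_error (K3 M C a : R) : R :=
  K3 * (2 + 2 * kappa) / a + s2 * (2 * M * C + C ^+ 2) / a ^+ 2.

Lemma hit_step_lower (M K1 K2 K3 a b : R) (c : R * R) (u : R * R -> R) J (V : R * R -> R) :
  C21 M K1 K2 K3 u J -> 1 <= a -> M + 2 * K2 <= a ^+ 2 -> 0 <= b ->
  measurable_fun setT V -> (forall y, 0 <= V y <= 1) ->
  (forall x, u x / a ^+ 2 - b <= V (rescale a c x)) ->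
  forall x, (u x + reaction s2 u J x / a ^+ 2 - discretization_error K3 M (2 * K2) a / a ^+ 2) / a ^+ 2 - b
    <= step (E V (rescale a c x)).
Proof.
move=> H a1 Ma b0 mV V01 uV x.
have a0 : 0 < a by lra.
have an0 : a != 0 by rewrite gt_eqF.
have [j1b j2b j11b j12b j22b] := C21_jet_bounded x H.
have /andP[u0 uM] := C21_val H x.
have K20 : 0 <= K2.
  have := le_trans (normr_ge0 _) j11b; lra.
have K30 : 0 <= K3.
  have := C21_tay2 H (0, 0) 1 0; rewrite /norm1 normr0 addr0 normr1 expr1n mulr1.
  exact: le_trans.
have kap0 : 0 <= kappa := moment4_ge0 P X0.
have [i iE] : exists i, i = a^-1 by exists a^-1.
have i0 : 0 < i by rewrite iE invr_gt0.
have i1 : i <= 1 by rewrite iE invf_le1.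
have ai : a * i = 1 by rewrite iE divff.
have i2 : 0 <= i ^+ 2 by exact: sqr_ge0.
pose L := lapl (J x) / 2.
pose b' := (u x + L * i ^+ 2 - K3 * (2 + 2 * kappa) * i ^+ 3) * i ^+ 2.
have low : b' - b <= E V (rescale a c x).
  (* Coefficients of the minorant [pol7]: the Taylor polynomial times [i^2], minus the remainder
     through [norm1_cube_le]; in [i^5] three powers come from the displacement and two from the
     height. *)
  have -> : b' - b = (u x * i ^+ 2 - b) + (j11 (J x) / 2 * i ^+ 4 - K3 * i ^+ 5)
    + (j22 (J x) / 2 * i ^+ 4 - K3 * i ^+ 5) + (- 2 * K3 * i ^+ 5) * kappa.
    by rewrite /b' /L /lapl; field.
  apply: (@EX_ge_pol7 _ _ _ P X0 hX0_meas hX0_m4 hX0_mean1 hX0_mean2 hX0_cov11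
    hX0_cov22 hX0_cov12 V (rescale a c x) _ (j1 (J x) * i ^+ 3) (j2 (J x) * i ^+ 3)
    _ (j12 (J x) * i ^+ 4) _ _ mV V01) => y.
  rewrite rescale_shift//; apply: le_trans (uV _); rewrite -exprVn -iE.
  have := C21_tay2 H x (y.1 * i) (y.2 * i); rewrite ler_norml => /andP[T _].
  have N : norm1 (y.1 * i) (y.2 * i) ^+ 3 <= i ^+ 3 * ((y.1 ^+ 2 + y.2 ^+ 2) + 2 * (y.1 ^+ 2 + y.2 ^+ 2) ^+ 2).
    rewrite (_ : norm1 _ _ = i * norm1 y.1 y.2).
      by rewrite exprMn ler_wpM2l ?exprn_ge0 ?(ltW i0)// norm1_cube_le.
    by rewrite /norm1 !normrM (gtr0_norm i0); ring.
  have KN := ler_wpM2l K30 N.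
  set v := u (pshift _ _ _) in T *.
  have {}T : u x + lin (J x) (y.1 * i) (y.2 * i) + quad (J x) (y.1 * i) (y.2 * i)
    - K3 * (i ^+ 3 * ((y.1 ^+ 2 + y.2 ^+ 2) + 2 * (y.1 ^+ 2 + y.2 ^+ 2) ^+ 2)) <= v by lra.
  have {}T := ler_wpM2r i2 T.
  apply: le_trans (lerB T (lexx b)).
  rewrite le_eqVlt; apply/orP; left; apply/eqP; rewrite /pol7 /lin /quad; field => //.
have /andP[e0 e1] := EX_itv P hX0_meas (rescale a c x) mV V01.
set q := E V _ in low e0 e1 *.
have Lb : `|L| <= 2 * K2.
  move: j11b j22b; rewrite /L /lapl !ler_norml => /andP[? ?] /andP[? ?].
  by apply/andP; split; lra.
have KKi : 0 <= K3 * (2 + 2 * kappa) * i ^+ 3.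
  by rewrite mulr_ge0 ?exprn_ge0 ?(ltW i0)// mulr_ge0// addr_ge0// mulr_ge0.
have b'le : b' <= (u x + 2 * K2 * i ^+ 2) * i ^+ 2.
  rewrite ler_wpM2r//; have : L * i ^+ 2 <= 2 * K2 * i ^+ 2.
    by rewrite ler_wpM2r//; exact: le_trans (ler_norm _) Lb.
  by lra.
have i21 : i ^+ 2 <= 1 by rewrite expr2 mulr_ile1// ltW.
have a2i2 : a ^+ 2 * i ^+ 2 = 1 by rewrite -exprMn ai expr1n.
(* The bounds on [step] hold on [[0, 1]] only, and [b'] may be negative; the assumption on [a] keeps
   [b2] below 1. *)
pose b2 := Num.max b' 0.
have b20 : 0 <= b2 by rewrite le_max lexx orbT.
have b2le : b2 <= (u x + 2 * K2 * i ^+ 2) * i ^+ 2.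
  by rewrite ge_max b'le/= mulr_ge0// addr_ge0// mulr_ge0// mulr_ge0.
have b21 : b2 <= 1.
  apply: (le_trans b2le); rewrite -[leRHS]a2i2 ler_wpM2r//; apply: le_trans Ma.
  by apply: lerD => //; rewrite ler_piMr// mulr_ge0.
have qb2 : b2 - b <= q.
  by rewrite lerBlDr ge_max -lerBlDr low/=; lra.
have g1 : step b2 - b <= step q.
  have [qb|qb] := leP b2 q.
    apply: (@le_trans _ _ (step b2)); first by rewrite lerBlDr lerDl.
    exact: ler_survival_step.
  have := survival_step_lip hp_ge0 hp_sum hp_mean e0 (ltW qb) b21; lra.
have g2 : b2 - s2 * b2 ^+ 2 <= step b2.
  by apply: survival_step_ge => //; rewrite b20.
have bb2 : b' <= b2 by rewrite le_max lexx.
have sq : b2 ^+ 2 <= (u x ^+ 2 + (2 * M * (2 * K2) + (2 * K2) ^+ 2) * i ^+ 2) * i ^+ 4.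
  apply: (@le_trans _ _ (((u x + 2 * K2 * i ^+ 2) * i ^+ 2) ^+ 2)).
    by rewrite lerXn2r ?nnegrE//; exact: le_trans b2le.
  rewrite (_ : i ^+ 4 = i ^+ 2 ^+ 2); last by ring.
  rewrite exprMn ler_wpM2r ?sqr_ge0//.
  have h1 : 0 <= (M - u x) * K2 * i ^+ 2 by rewrite mulr_ge0// mulr_ge0// subr_ge0.
  have h2 : K2 ^+ 2 * i ^+ 2 * i ^+ 2 <= K2 ^+ 2 * i ^+ 2.
    by rewrite ler_piMr// mulr_ge0// sqr_ge0.
  lra.
have sq' := ler_wpM2l (ltW s20) sq.
apply: le_trans g1; rewrite lerD2r; apply: le_trans g2.
apply: (@le_trans _ _ (b' - s2 * ((u x ^+ 2 + (2 * M * (2 * K2) + (2 * K2) ^+ 2) * i ^+ 2) * i ^+ 4))); last by lra.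
rewrite /discretization_error /reaction /b' -/L -!exprVn -iE le_eqVlt.
by apply/orP; left; apply/eqP; ring.
Qed.

(* The survival-type recursion dominates the rescaled PDE solution up to an error which
   accumulates over the [n] generations but vanishes relative to [1/n]. *)
Lemma hit_liminf_pde (r M K1 K2 K3 : R) (c : R * R) phi J0 :
  0 < r -> C21 M K1 K2 K3 phi J0 -> (forall x, 0 < phi x -> eball c r x) ->
  exists2 u, sbm_pde_solution s2 phi u &
  forall e, 0 < e -> \forall n \near \oo,
    u 1 (0, 0) - e <= n%:R * hit (eball (0, 0) (r * Num.sqrt n%:R)) n
       (rescale (Num.sqrt n%:R) c (0, 0)).
Proof.
move=> r0 H phi_supp.
have [u [J [L2 [L3 [A [Hu A0 HC Hexp]]]]]] := pde_solution_exists (ltW s20) H.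
exists u => // e e0.
have u00 : u 0 = phi by case: Hu => h _; apply/funext => x.
have L30 : 0 <= L3.
  have /HC h : 0 <= (0 : R) <= 1 by rewrite lexx ler01.
  have := C21_tay2 h (0, 0) 1 0; rewrite /norm1 normr0 addr0 normr1 expr1n mulr1.
  exact: le_trans.
(* The term [A * et] is the only part of [err n] that does not vanish as [n] grows, and it is at
   most [e / 4]. *)
pose et := e / 4 / (A + 1).
have et0 : 0 < et by rewrite divr_gt0 ?divr_gt0// ltr_wpDl.
have Aet : A * et <= e / 4.
  rewrite /et mulrA ler_pdivrMr ?ltr_wpDl//; lra.
pose err (n : nat) := discretization_error L3 M (2 * L2) (Num.sqrt n%:R)
   + (A / et ^+ 2 + A) / n%:R + A * et.
have s_oo : (Num.sqrt n%:R : R) @[n --> \oo] --> +oo.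
  apply/cvgryPge => B; near=> n.
  have [B0|B0] := leP B 0; first exact: le_trans (sqrtr_ge0 _).
  rewrite -(ger0_norm (ltW B0)) -sqrtr_sqr ler_wsqrtr//.
  near: n; exact: nbhs_infty_ger.
have sn n : Num.sqrt n%:R ^+ 2 = n%:R :> R by rewrite sqr_sqrtr.
have si0 : ((Num.sqrt n%:R)^-1 : R) @[n --> \oo] --> 0.
  apply/gtr0_cvgV0 => //; near=> n; rewrite sqrtr_gt0 ltr0n.
  by near: n; exact: nbhs_infty_gt.
have ni0 : (n%:R^-1 : R) @[n --> \oo] --> 0.
  rewrite (_ : (fun n => _) = (fun n => (Num.sqrt n%:R)^-1 * (Num.sqrt n%:R)^-1)).
    by rewrite -(mulr0 0); exact: cvgM.
  by apply/funext => n; rewrite -invfM -expr2 sn.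
have err_small : \forall n \near \oo, err n < e.
  have L : err n @[n --> \oo] --> L3 * (2 + 2 * kappa) * 0
     + s2 * (2 * M * (2 * L2) + (2 * L2) ^+ 2) * 0 + (A / et ^+ 2 + A) * 0 + A * et.
    rewrite /err /discretization_error.
    apply: cvgD; last exact: cvg_cst.
    apply: cvgD; last by apply: cvgM => //; exact: cvg_cst.
    apply: cvgD; first by apply: cvgM => //; exact: cvg_cst.
    by apply: cvgM; [exact: cvg_cst|under eq_fun do rewrite sn].
  rewrite !mulr0 !add0r in L; apply: (cvgr_lt _ L); lra.
near=> n.
have n0 : (0 < n)%N by near: n; exact: nbhs_infty_gt.
have nR0 : 0 < n%:R :> R by rewrite ltr0n.
have nM : M + 2 * L2 <= n%:R by near: n; exact: nbhs_infty_ger.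
have nM' : M <= n%:R by near: n; exact: nbhs_infty_ger.
have errn : err n < e by near: n.
set a := Num.sqrt n%:R; set B := eball _ _.
have a2 : a ^+ 2 = n%:R by exact: sn.
have a0 : 0 < a by rewrite sqrtr_gt0.
have a1 : 1 <= a by rewrite -sqrtr1 ler_wsqrtr// ler1n.
have mB : measurable B by exact: measurable_eball.
have err0 : 0 <= err n.
  rewrite /err /discretization_error !addr_ge0//.
  - by rewrite divr_ge0 ?(ltW a0)// mulr_ge0// addr_ge0// mulr_ge0// moment4_ge0.
  - rewrite divr_ge0 ?sqr_ge0// mulr_ge0 ?(ltW s20)//.
    have /HC h : 0 <= (0 : R) <= 1 by rewrite lexx ler01.
    have /andP[h1 h2] := C21_val h (0, 0).
    have h3 := C21_jet_bounded (0, 0) h; case: h3 => _ _ h3 _ _.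
    have L20 : 0 <= L2 by have := le_trans (normr_ge0 _) h3; lra.
    have M0 : 0 <= M by exact: le_trans h2.
    by rewrite addr_ge0 ?sqr_ge0// !mulr_ge0.
  - by rewrite divr_ge0// addr_ge0// divr_ge0// sqr_ge0.
  - by rewrite mulr_ge0// ltW.
suff key k : (k <= n)%N -> forall x,
    u (k%:R / n%:R) x / n%:R - k%:R * err n / n%:R ^+ 2 <= hit B k (rescale a c x).
  have := key n (leqnn n) (0, 0); rewrite divff ?gt_eqF//.
  rewrite -(ler_pM2l nR0) => h; apply: le_trans h.
  rewrite [leRHS](_ : _ = u 1 (0, 0) - err n); last by field; rewrite gt_eqF.
  by rewrite lerD2l lerN2 ltW.
elim: k => [|k IH] kn x.
  (* At generation 0 the claim is [phi / n <= 1] on the support of [phi], whence the requirement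
     [M <= n]. *)
  rewrite !mul0r subr0 u00 /= indicE.
  have [px|px] := leP (phi x) 0.
    by apply: (@le_trans _ _ 0); [rewrite mulr_le0_ge0// invr_ge0 ltW|case: (_ \in _)].
  rewrite (_ : (_ \in _) = true).
    rewrite ler_pdivrMr// mul1r; apply: le_trans nM'.
    by have /andP[] := C21_val H x.
  apply: mem_set; rewrite /B /eball/= !subr0 !exprMn -mulrDr sqrtrM ?sqr_ge0// sqrtr_sqr (gtr0_norm a0) mulrC.
  by rewrite ltr_pM2r//; exact: phi_supp.
have kn' : (k <= n)%N by exact: ltnW.
have t01 : 0 <= (k%:R / n%:R : R) <= 1.
  by apply/andP; split; [exact: divr_ge0|rewrite ler_pdivrMr// mul1r ler_nat].
have [mk k01] := hitp_measurable_itv hp_ge0 hp_sum P hX0_meas k mB.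
have b0 : 0 <= k%:R * err n / n%:R ^+ 2 by rewrite divr_ge0 ?sqr_ge0// mulr_ge0.
have h y : u (k%:R / n%:R) y / a ^+ 2 - k%:R * err n / n%:R ^+ 2 <= hit B k (rescale a c y).
  by rewrite a2; exact: IH.
have := hit_step_lower (HC _ t01) a1 _ _ mk k01 h x.
rewrite a2 => /(_ nM b0); apply: le_trans.
have kS : k.+1%:R / n%:R = k%:R / n%:R + n%:R^-1 :> R by rewrite -natr1 mulrDl mul1r.
have th : k%:R / n%:R + n%:R^-1 <= 1 :> R.
  by rewrite -kS ler_pdivrMr// mul1r ler_nat.
have /andP[t0 _] := t01.
have ni : 0 <= n%:R^-1 :> R by rewrite invr_ge0 ltW.
have := Hexp (k%:R / n%:R) n%:R^-1 et x t0 ni th et0; rewrite -kS ler_norml => /andP[_].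
set r1 := reaction _ _ _ _; set uS := u (k.+1%:R / n%:R) x; set u0 := u (k%:R / n%:R) x.
move=> h1; have {}h1 : uS <= u0 + n%:R^-1 * r1 + n%:R^-1 * (A * n%:R^-1 / et ^+ 2 + A * et + A * n%:R^-1) by lra.
have := ler_wpM2r ni h1; rewrite -(lerD2r (- (k.+1%:R * err n / n%:R ^+ 2))) => /le_trans; apply.
rewrite le_eqVlt; apply/orP; left; apply/eqP.
rewrite -[k.+1%:R]natr1 /err -/a; set de := discretization_error _ _ _ _; field.
by rewrite gt_eqF//= gt_eqF.
Unshelve. all: by end_near. Qed.

End Comparison.

(** * From independent ingredients to independent blocks *)

Section BlockIndependence.
Context {R : realType} {d : measure_display} {Omega : measurableType d}.
Context (P : probability Omega R) {I : choiceType} (F : I -> set (set Omega)).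
Hypothesis F_indep : mutually_independent P F.
Hypothesis F_measurable : forall j, F j `<=` measurable.
Hypothesis F_setI : forall j, setI_closed (F j).
Hypothesis F_setT : forall j, F j setT.

Definition gens (S : set I) : set (set Omega) := \bigcup_(j in S) F j.

Definition all_in (s : seq I) (G : I -> set Omega) : set Omega :=
  [set w | forall j, j \in s -> G j w].

(** A pi-system containing [gens S]; the duplicate-free list matches the injective families of
    [mutually_independent]. *)
Definition cyl (S : set I) : set (set Omega) :=
  [set E | exists (s : seq I) (G : I -> set Omega),
    [/\ uniq s, (forall j, j \in s -> S j), (forall j, F j (G j)) & E = all_in s G]].

Lemma all_in_bigcap (s : seq I) (G : I -> set Omega) :
  all_in s G = \bigcap_(k in [set: 'I_(size s)]) G (tnth (in_tuple s) k).
Proof.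
apply/seteqP; split => w /= H.
  by move=> k _; apply: H; exact: mem_tnth.
by move=> j js; have /tnthP[k ->] : j \in in_tuple s by []; exact: H.
Qed.

Lemma probability_all_in (s : seq I) (G : I -> set Omega) : uniq s ->
  (forall j, F j (G j)) -> P (all_in s G) = (\prod_(j <- s) fine (P (G j)))%:E.
Proof.
move=> us FG; have inj : injective (tnth (in_tuple s)) by exact/tuple_uniqP.
rewrite all_in_bigcap (F_indep inj (E := fun k => G (tnth (in_tuple s) k)) _)//.
by rewrite (big_tnth _ _ s).
Qed.

Lemma cyl_measurable S : cyl S `<=` measurable.
Proof.
move=> _ [s [G [_ _ FG ->]]]; rewrite all_in_bigcap.
by apply: fin_bigcap_measurable => // k _; exact: F_measurable.
Qed.

Lemma cyl_setI S : setI_closed (cyl S).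
Proof.
move=> _ _ [s1 [G1 [u1 S1 F1 ->]]] [s2 [G2 [u2 S2 F2 ->]]].
exists (undup (s1 ++ s2)), (fun j => (if j \in s1 then G1 j else setT) `&`
   (if j \in s2 then G2 j else setT)); split.
- exact: undup_uniq.
- by move=> j; rewrite mem_undup mem_cat => /orP[/S1|/S2].
- by move=> j; apply: F_setI; case: ifP.
- apply/seteqP; split => w /=.
    by move=> [h1 h2] j _; split; case: ifPn => // js; [exact: h1|exact: h2].
  move=> h; split=> j js.
    by have := h j; rewrite mem_undup mem_cat js => /(_ isT)[].
  by have := h j; rewrite mem_undup mem_cat js orbT => /(_ isT)[].
Qed.

Lemma cyl_setT S : cyl S setT.
Proof.
by exists [::], (fun=> setT); split => //; apply/seteqP; split.
Qed.

Lemma gens_cyl S : gens S `<=` cyl S.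
Proof.
move=> A [j Sj FA]; exists [:: j], (fun k => if k == j then A else setT); split => //.
- by move=> k; rewrite inE => /eqP ->.
- by move=> k; case: eqP => [->|].
- apply/seteqP; split => w /=.
    by move=> Aw k; rewrite inE => ->.
  by move=> /(_ j); rewrite inE eqxx; apply.
Qed.

Lemma probability_cylI S1 S2 A B : S1 `&` S2 = set0 -> cyl S1 A -> cyl S2 B ->
  P (A `&` B) = (P A * P B)%E.
Proof.
move=> S12 [s1 [G1 [u1 sS1 F1 ->]]] [s2 [G2 [u2 sS2 F2 ->]]].
have disj j : j \in s1 -> j \in s2 -> False.
  by move=> /sS1 a /sS2 b; have : (S1 `&` S2) j by []; rewrite S12.
rewrite (probability_all_in u1 F1) (probability_all_in u2 F2) -EFinM.
pose G j := if j \in s1 then G1 j else G2 j.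
have -> : all_in s1 G1 `&` all_in s2 G2 = all_in (s1 ++ s2) G.
  apply/seteqP; split => w /=.
    move=> [h1 h2] j; rewrite mem_cat /G; case: ifPn => [js _|_ /= js]; first exact: h1.
    exact: h2.
  move=> h; split=> j js.
    by have := h j; rewrite mem_cat /G js => /(_ isT).
  have := h j; rewrite mem_cat /G js orbT => /(_ isT).
  by case: ifPn => // js1; case: (disj _ js1 js).
rewrite probability_all_in; first last.
- by move=> j; rewrite /G; case: ifP.
- rewrite cat_uniq u1 u2 andbT/=; apply/hasPn => j js2; apply/negP => js1; exact: disj js2.
rewrite big_cat/=; congr (_ * _)%:E.
  by rewrite big_seq [RHS]big_seq; apply: eq_bigr => j js; rewrite /G js.
rewrite big_seq [RHS]big_seq; apply: eq_bigr => j js; rewrite /G.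
by case: ifPn => // js1; case: (disj _ js1 js).
Qed.

Lemma gens_measurable S : <<s gens S >> `<=` @measurable _ Omega.
Proof.
apply: smallest_sub; first exact: sigma_algebra_measurable.
by move=> A [j _]; exact: F_measurable.
Qed.

(** With [B] fixed, both sides are finite measures in [A] that agree on a pi-system containing the
    whole space. *)
Lemma extend_independence (Pi : set (set Omega)) (B : set Omega) :
  Pi `<=` measurable -> setI_closed Pi -> Pi setT -> measurable B ->
  (forall A, Pi A -> P (A `&` B) = (P A * P B)%E) ->
  forall A, <<s Pi >> A -> P (A `&` B) = (P A * P B)%E.
Proof.
move=> Pim PiI PiT mB H A sA.
have PB0 : 0 <= fine (P B) by rewrite fine_ge0.
pose r : {nonneg R} := NngNum PB0.
have PBE : P B = (r%:num)%:E by rewrite /= fineK// fin_num_measure.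
suff : mrestr P mB A = mscale r P A.
  by rewrite /mrestr /mscale [RHS]muleC -PBE.
apply: (@g_sigma_algebra_measure_unique _ _ _ Pi Pim (fun=> setT) (fun=> PiT)) sA => //.
- by rewrite bigcup_const//; exists 0%N.
- by move=> C PC; have := H C PC; rewrite [in RHS]muleC PBE.
- move=> _; apply: (@le_lt_trans _ _ 1%E); last exact: ltry.
  by apply: probability_le1; exact: measurableI.
Qed.

Lemma gens_independent S1 S2 A B : S1 `&` S2 = set0 ->
  <<s gens S1 >> A -> <<s gens S2 >> B -> P (A `&` B) = (P A * P B)%E.
Proof.
move=> S12 sA sB.
have sAc : <<s cyl S1 >> A by apply: (sub_smallest2r _ (@gens_cyl S1)) sA; exact: smallest_sigma_algebra.
have sBc : <<s cyl S2 >> B by apply: (sub_smallest2r _ (@gens_cyl S2)) sB; exact: smallest_sigma_algebra.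
have mB : measurable B := gens_measurable sB.
apply: (extend_independence (@cyl_measurable S1) (@cyl_setI S1) (cyl_setT S1)) => // {A sA sAc} A cA.
rewrite setIC muleC.
apply: (extend_independence (@cyl_measurable S2) (@cyl_setI S2) (cyl_setT S2)) => //.
  exact: (@cyl_measurable S1).
move=> C cC; rewrite setIC muleC; exact: (probability_cylI S12).
Qed.

End BlockIndependence.

(** Independence makes the law of the pair a product, so by Tonelli the second coordinate may be
    redrawn from a fresh [w']. The branching property is used in this form. *)
Lemma resample {R : realType} {d d1 d2 : measure_display} {Omega : measurableType d}
  {T1 : measurableType d1} {T2 : measurableType d2} (P : probability Omega R)
  (g1 : Omega -> T1) (g2 : Omega -> T2) (f : T1 * T2 -> \bar R) :
  measurable_fun setT g1 -> measurable_fun setT g2 ->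
  (forall A B, measurable A -> measurable B ->
     P (g1 @^-1` A `&` g2 @^-1` B) = (P (g1 @^-1` A) * P (g2 @^-1` B))%E) ->
  measurable_fun setT f -> (forall z, 0 <= f z)%E ->
  (\int[P]_w f (g1 w, g2 w) = \int[P]_w \int[P]_w' f (g1 w, g2 w'))%E.
Proof.
move=> m1 m2 ind mf f0.
have m12 : measurable_fun setT (fun w => (g1 w, g2 w)) by exact: measurable_fun_pair.
pose h1 : {mfun Omega >-> T1} := HB.pack g1 (isMeasurableFun.Build _ _ _ _ g1 m1).
pose h2 : {mfun Omega >-> T2} := HB.pack g2 (isMeasurableFun.Build _ _ _ _ g2 m2).
pose h12 : {mfun Omega >-> (T1 * T2)%type} :=
  HB.pack (fun w => (g1 w, g2 w)) (isMeasurableFun.Build _ _ _ _ _ m12).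
have prodE X : measurable X ->
    (distribution P h1 \x distribution P h2)%E X = distribution P h12 X.
  apply: product_measure_unique => A B mA mB.
  exact: ind.
transitivity (\int[distribution P h12]_z f z)%E.
  by rewrite ge0_integral_distribution.
transitivity (\int[(distribution P h1 \x distribution P h2)%E]_z f z)%E.
  by apply: eq_measure_integral => X mX _; exact/esym/prodE.
rewrite fubini_tonelli1// ge0_integral_distribution//.
- apply: eq_integral => w _ /=.
  by rewrite /fubini_F ge0_integral_distribution//; exact: measurableT_comp.
- exact: measurable_fun_fubini_tonelli_F.
- by move=> x; exact: integral_ge0.
Qed.

(** * The tree of a single particle *)

Section BranchingTree.
Context {R : realType} (p : nat -> R).
Hypothesis hp_ge0 : forall k, 0 <= p k.
Hypothesis hp_sum : (fun n => \sum_(0 <= k < n) p k) @ \oo --> (1 : R).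
Context {d : measure_display} {Omega : measurableType d} (P : probability Omega R).
Context (xi : nat -> Omega -> (R * R)%type) (N : nat -> seq nat -> Omega -> nat)
  (X : nat -> seq nat -> Omega -> (R * R)%type) (X0 : Omega -> (R * R)%type).
Hypothesis hxi_meas : forall i, measurable_fun [set: Omega] (xi i).
Hypothesis hN_meas : forall i u, measurable_fun [set: Omega] (N i u).
Hypothesis hX_meas : forall i u, measurable_fun [set: Omega] (X i u).
Hypothesis hX0_meas : measurable_fun [set: Omega] X0.

(** [{classic brw_idx}] equips the indices with the decidable equality required by the lists in
    [cyl]. *)
Definition ingredient (j : {classic brw_idx}) : set (set Omega) := match (j : brw_idx) with
  | IPP => <<s \bigcup_(i in [set: nat]) preimages (xi i) >>
  | IOff i u => preimages (N i u)
  | IDisp i u => preimages (X i u) end.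

Hypothesis hindep : mutually_independent P ingredient.
Hypothesis hN_law : forall i u k, P (N i u @^-1` [set k]) = (p k)%:E.
Hypothesis hX_law : forall i u A, measurable A -> P (X i u @^-1` A) = P (X0 @^-1` A).

Lemma preimages_measurable d' (T : measurableType d') (Y : Omega -> T) :
  measurable_fun setT Y -> preimages Y `<=` measurable.
Proof. by move=> mY _ [A mA <-]; rewrite -[X in measurable X]setTI; exact: mY. Qed.

Lemma preimages_setI d' (T : measurableType d') (Y : Omega -> T) : setI_closed (preimages Y).
Proof.
move=> _ _ [A mA <-] [B mB <-]; exists (A `&` B); last by rewrite preimage_setI.
exact: measurableI.
Qed.

Lemma preimages_setT d' (T : measurableType d') (Y : Omega -> T) : preimages Y setT.
Proof. by exists setT; [exact: measurableT|exact: preimage_setT]. Qed.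

Lemma ingredient_measurable j : ingredient j `<=` measurable.
Proof.
case: j => [|i u|i u] /=; [|exact: preimages_measurable..].
apply: smallest_sub; first exact: sigma_algebra_measurable.
by move=> A [i _]; exact: preimages_measurable.
Qed.

Lemma ingredient_setI j : setI_closed (ingredient j).
Proof.
case: j => [|i u|i u] /=; [|exact: preimages_setI..].
move=> A B sA sB.
exact: (@measurableI _ (g_sigma_algebraType (\bigcup_(i in [set: nat]) preimages (xi i)))).
Qed.

Lemma ingredient_setT j : ingredient j setT.
Proof.
case: j => [|i u|i u] /=; [|exact: preimages_setT..].
exact: (@measurableT _ (g_sigma_algebraType (\bigcup_(i in [set: nat]) preimages (xi i)))).
Qed.

Local Notation idx := {classic brw_idx}.
(** The set [Omega] under the sigma-algebra of the ingredients in [S]: measurability from [info S]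
    means dependence on these ingredients alone. *)
Local Notation info S := (g_sigma_algebraType (gens ingredient S)).

Lemma info_id S S' : S `<=` S' -> measurable_fun setT (id : info S' -> info S).
Proof.
move=> SS' _ A mA; rewrite setTI preimage_id.
apply: (sub_smallest2r _ _) mA; first exact: smallest_sigma_algebra.
by move=> E [j Sj FE]; exists j => //; exact: SS'.
Qed.

Lemma info_all S : measurable_fun setT (id : Omega -> info S).
Proof.
move=> _ A mA; rewrite setTI preimage_id; exact: gens_measurable ingredient_measurable _ _ mA.
Qed.

Lemma info_gen d' (T : measurableType d') (Y : Omega -> T) (S : set idx) (j : idx) :
  S j -> preimages Y `<=` ingredient j -> measurable_fun setT (Y : info S -> T).
Proof.
move=> Sj YF _ A mA; rewrite setTI; apply: sub_sigma_algebra; exists j => //.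
by apply: YF; exists A.
Qed.

Lemma info_xi (S : set idx) i : S IPP -> measurable_fun setT (xi i : info S -> (R * R)%type).
Proof.
move=> h; apply: (info_gen h) => A hA; apply: sub_sigma_algebra; by exists i.
Qed.

Lemma info_N (S : set idx) i u : S (IOff i u) -> measurable_fun setT (N i u : info S -> nat).
Proof. by move=> h; exact: info_gen h _. Qed.

Lemma info_X (S : set idx) i u : S (IDisp i u) -> measurable_fun setT (X i u : info S -> (R * R)%type).
Proof. by move=> h; exact: info_gen h _. Qed.

Lemma info_independent (S1 S2 : set idx) A B : S1 `&` S2 = set0 ->
  <<s gens ingredient S1 >> A -> <<s gens ingredient S2 >> B -> P (A `&` B) = (P A * P B)%E.
Proof.
move=> S12; apply: (gens_independent _ _ _ _ S12).
- exact: hindep.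
- exact: ingredient_measurable.
- exact: ingredient_setI.
- exact: ingredient_setT.
Qed.

(** The displacement of [u] is excluded, being already spent in the position of [u]. [child_block]
    restores it, so that the blocks of distinct children are disjoint from one another and from
    [IOff] at the parent. *)
Definition subtree (i : nat) (u : seq nat) : set idx := [set j : idx | match (j : brw_idx) with
  | IPP => False
  | IOff i' v => i' = i /\ prefix u v
  | IDisp i' v => [/\ i' = i, prefix u v & v <> u] end].

Definition child_block (i : nat) (u : seq nat) : set idx :=
  [set (IDisp i u : idx)] `|` subtree i u.

Context (B : set (R * R)).
Hypothesis mB : measurable B.

(* A descendant of [u], [m] generations later, lies in [B] when [u] sits at [x]. *)
Fixpoint reaches (m : nat) (i : nat) (u : seq nat) (x : R * R) (w : Omega) : Prop :=
  if m is m'.+1 then exists c, (c < N i u w)%N /\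
    reaches m' i (rcons u c) (padd x (X i (rcons u c) w)) w
  else B x.

Lemma child_block_subtree i u c : child_block i (rcons u c) `<=` subtree i u.
Proof.
have pu v : prefix (rcons u c) v -> prefix u v by apply: prefix_trans; exact: prefix_rcons.
have nu v : prefix (rcons u c) v -> v <> u.
  by move=> /size_prefix h e; move: h; rewrite e size_rcons ltnn.
move=> j [->|]; first by split => //; [exact: prefix_rcons|apply: nu; exact: prefix_refl].
by case: j => [//|i' v [-> /pu]|i' v [-> h _]] //; split; [|exact: pu|exact: nu].
Qed.

(** Measurability jointly with the starting point is required because [resample] is applied with a
    random one. *)
Lemma reaches_jointly_measurable m i u :
  measurable [set z : (R * R) * info (subtree i u) | reaches m i u z.1 z.2].
Proof.
elim: m u => [|m IH] u /=.
  rewrite (_ : [set _ | _] = setT `&` fst @^-1` B); last by rewrite setTI.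
  exact: measurable_fst.
rewrite (_ : [set _ | _] = \bigcup_c (
   (setT `&` (fun z : (R * R) * info (subtree i u) => N i u z.2) @^-1` [set k | (c < k)%N]) `&`
   (setT `&` (fun z : (R * R) * info (subtree i u) =>
      (padd z.1 (X i (rcons u c) z.2), z.2 : info (subtree i (rcons u c)))) @^-1`
      [set z | reaches m i (rcons u c) z.1 z.2]))); last first.
  apply/seteqP; split => z /=.
    by move=> [c [h1 h2]]; exists c => //; rewrite !setTI.
  by move=> [c _]; rewrite !setTI => -[h1 h2]; exists c.
apply: bigcupT_measurable => c; apply: measurableI.
  have mN : measurable_fun setT (N i u : info (subtree i u) -> nat).
    by apply: info_N; split => //; exact: prefix_refl.
  by apply: (measurableT_comp mN) => //; exact: measurable_snd.
have sub : subtree i (rcons u c) `<=` subtree i u.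
  by move=> j hj; apply: (@child_block_subtree i u c); right.
have mX : measurable_fun setT (X i (rcons u c) : info (subtree i u) -> (R * R)%type).
  by apply: info_X; apply: (@child_block_subtree i u c); left.
have mpair : measurable_fun setT (fun z : (R * R) * info (subtree i u) =>
      (padd z.1 (X i (rcons u c) z.2), z.2 : info (subtree i (rcons u c)))).
  apply: measurable_fun_pair.
    apply: measurable_fun_padd; first exact: measurable_fst.
    by apply: (measurableT_comp mX); exact: measurable_snd.
  by apply: (measurableT_comp (info_id sub)); exact: measurable_snd.
exact: mpair.
Qed.

Lemma reaches_measurable m i u x : <<s gens ingredient (subtree i u) >> [set w | reaches m i u x w].
Proof.
have mx : measurable_fun setT (fun w : info (subtree i u) => (x, w)).
  by apply: measurable_fun_pair; [exact: measurable_cst|exact: measurable_id].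
have := mx measurableT _ (@reaches_jointly_measurable m i u).
by rewrite setTI.
Qed.

Lemma subtree_measurable S : <<s gens ingredient S >> `<=` @measurable _ Omega.
Proof. by move=> A mA; exact: (gens_measurable ingredient_measurable mA). Qed.

Local Notation hit := (hitp p P X0 B).
Local Notation E := (EX P X0).

Definition child_reaches m i u c x : set Omega :=
  [set w | reaches m i (rcons u c) (padd x (X i (rcons u c) w)) w].

Lemma child_reaches_measurable m i u c x :
  <<s gens ingredient (child_block i (rcons u c)) >> (child_reaches m i u c x).
Proof.
set v := rcons u c.
have sub : subtree i v `<=` child_block i v by move=> j hj; right.
have mX : measurable_fun setT (X i v : info (child_block i v) -> (R * R)%type).
  by apply: info_X; left.
have mp : measurable_fun setT (fun w : info (child_block i v) =>
    (padd x (X i v w), w : info (subtree i v))).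
  apply: measurable_fun_pair; last exact: info_id sub.
  by apply: measurable_fun_padd => //; exact: measurable_cst.
have := mp measurableT _ (@reaches_jointly_measurable m i v).
by rewrite setTI.
Qed.

Lemma indep_preimages (S1 S2 : set idx) d1 d2 (T1 : measurableType d1) (T2 : measurableType d2)
  (g1 : Omega -> T1) (g2 : Omega -> T2) : S1 `&` S2 = set0 ->
  measurable_fun setT (g1 : info S1 -> T1) -> measurable_fun setT (g2 : info S2 -> T2) ->
  forall A A', measurable A -> measurable A' ->
  P (g1 @^-1` A `&` g2 @^-1` A') = (P (g1 @^-1` A) * P (g2 @^-1` A'))%E.
Proof.
move=> S12 m1 m2 A A' mA mA'; apply: (info_independent S12).
  by have := m1 measurableT _ mA; rewrite setTI.
by have := m2 measurableT _ mA'; rewrite setTI.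
Qed.

Lemma integral_law i u (f : R * R -> \bar R) : measurable_fun setT f -> (forall y, 0 <= f y)%E ->
  (\int[P]_w f (X i u w) = \int[P]_w f (X0 w))%E.
Proof.
move=> mf f0.
pose h1 : {mfun Omega >-> (R * R)%type} := HB.pack (X i u) (isMeasurableFun.Build _ _ _ _ _ (hX_meas i u)).
pose h2 : {mfun Omega >-> (R * R)%type} := HB.pack X0 (isMeasurableFun.Build _ _ _ _ _ hX0_meas).
transitivity (\int[distribution P h1]_y f y)%E; first by rewrite ge0_integral_distribution.
transitivity (\int[distribution P h2]_y f y)%E; last by rewrite ge0_integral_distribution.
by apply: eq_measure_integral => A mA _; exact: hX_law.
Qed.

(** The displacement of the child is independent of the subtree below it: the tree is averaged out
    from a fixed point first, then the displacement. *)
Lemma probability_child_reaches m i u c x :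
  (forall y, P [set w | reaches m i (rcons u c) y w] = (hit m y)%:E) ->
  P (child_reaches m i u c x) = (E (hit m) x)%:E.
Proof.
set v := rcons u c => IH.
have [mh h01] := hitp_measurable_itv hp_ge0 hp_sum P hX0_meas m mB.
pose f (z : (R * R) * info (subtree i v)) : \bar R :=
  (\1_[set z | reaches m i v (padd x z.1) z.2] z)%:E.
have mA : measurable [set z : (R * R) * info (subtree i v) | reaches m i v (padd x z.1) z.2].
  have mp : measurable_fun setT (fun z : (R * R) * info (subtree i v) => (padd x z.1, z.2)).
    apply: measurable_fun_pair; last exact: measurable_snd.
    by apply: measurable_fun_padd; [exact: measurable_cst|exact: measurable_fst].
  have := mp measurableT _ (@reaches_jointly_measurable m i v).
  by rewrite setTI.
have mf : measurable_fun setT f by apply/measurable_EFinP; exact: measurable_indic.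
have dis : [set (IDisp i v : idx)] `&` subtree i v = set0.
  by rewrite -subset0 => j [->] [].
have mC := subtree_measurable (@child_reaches_measurable m i u c x).
transitivity (\int[P]_w (\1_(child_reaches m i u c x) w)%:E)%E.
  by rewrite integral_indic// setIT.
transitivity (\int[P]_w f (X i v w, w))%E.
  by apply: eq_integral => w _; rewrite /f !indicE.
rewrite (@resample _ _ _ _ _ _ _ P (X i v) (id : Omega -> info (subtree i v)) f)//.
- transitivity (\int[P]_w ((hit m (padd x (X i v w)))%:E))%E.
    apply: eq_integral => w _; rewrite -IH.
    have mr := subtree_measurable (@reaches_measurable m i v (padd x (X i v w))).
    transitivity (\int[P]_w' (\1_([set w' | reaches m i v (padd x (X i v w)) w']) w')%:E)%E; last first.
      by rewrite integral_indic// setIT.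
    by apply: eq_integral => w' _; rewrite /f !indicE.
  rewrite (@integral_law i v (fun y => (hit m (padd x y))%:E)).
  + have I := bounded_integrable P (measurable_shift_X0 hX0_meas x mh) (C := 1).
    rewrite /EX /Rintegral fineK//; apply: integrable_fin_num => //; apply: I => w.
    by have /andP[? ?] := h01 (padd x (X0 w)); rewrite ger0_norm.
  + apply/measurable_EFinP; apply: (measurableT_comp mh).
    by apply: measurable_fun_padd; [exact: measurable_cst|exact: measurable_id].
  + by move=> y; rewrite lee_fin; have /andP[] := h01 (padd x y).
- exact: info_all.
- by apply: (indep_preimages dis) => //; apply: info_X.
- by move=> z; rewrite lee_fin indicE.
Qed.

Definition first_children i u (l : nat) : set idx :=
  [set (IOff i u : idx)] `|` \bigcup_(c in [set c | (c < l)%N]) child_block i (rcons u c).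

Lemma prefix_rcons_inj (u v : seq nat) c c' :
  prefix (rcons u c) v -> prefix (rcons u c') v -> c = c'.
Proof.
rewrite !prefixE !size_rcons => /eqP -> /eqP e.
by have /rcons_inj[] := e.
Qed.

Lemma child_block_prefix i u (j : idx) : child_block i u j -> exists v,
  prefix u v /\ (j = IOff i v \/ j = IDisp i v).
Proof.
case=> [->|]; first by exists u; split; [exact: prefix_refl|right].
case: j => [//|i' v [-> h]|i' v [-> h _]]; exists v; split => //; [by left|by right].
Qed.

Lemma first_children_disjoint i u l :
  first_children i u l `&` child_block i (rcons u l) = set0.
Proof.
rewrite -subset0 => j [h1 /child_block_prefix[v [pv hv]]].
have pu : prefix (rcons u l) u = false.
  by apply/negP => /size_prefix; rewrite size_rcons ltnn.
case: h1 => [h1|[c /= cl /child_block_prefix[v' [pv' hv']]]].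
  by case: hv; rewrite h1 // => -[e]; move: pv; rewrite -e pu.
have e : v = v'.
  by case: hv hv' => -> [] // [].
move: cl; rewrite -e in pv'; rewrite (prefix_rcons_inj pv' pv); by rewrite ltnn.
Qed.

Lemma no_child_measurable m i u l k x : <<s gens ingredient (first_children i u l) >>
  ((N i u @^-1` [set k]) `&` \bigcap_(c in [set c | (c < l)%N]) ~` child_reaches m i u c x).
Proof.
apply: (@measurableI _ (info (first_children i u l))).
  have mN : measurable_fun setT (N i u : info (first_children i u l) -> nat).
    by apply: info_N; left.
  by have := mN measurableT [set k] I; rewrite setTI.
apply: (@bigcap_measurableType _ (info (first_children i u l))) => c /= cl.
apply: (@measurableC _ (info (first_children i u l))).
have sub : child_block i (rcons u c) `<=` first_children i u l.
  by move=> j hj; right; exists c.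
by have := info_id sub measurableT (@child_reaches_measurable m i u c x); rewrite setTI.
Qed.

(** Potential children carry ingredients whether born or not, so [l] can be unrelated to the family
    size [k]; this permits the induction on [l], one independent block at a time. *)
Lemma probability_no_child m i u l k x :
  (forall c y, P [set w | reaches m i (rcons u c) y w] = (hit m y)%:E) ->
  P ((N i u @^-1` [set k]) `&` \bigcap_(c in [set c | (c < l)%N]) ~` child_reaches m i u c x)
  = (p k * (1 - E (hit m) x) ^+ l)%:E.
Proof.
move=> IH; elim: l => [|l IHl].
  rewrite (_ : \bigcap_(c in _) _ = setT); last by apply/seteqP; split.
  by rewrite setIT hN_law expr0 mulr1.
have -> : \bigcap_(c in [set c | (c < l.+1)%N]) ~` child_reaches m i u c x =
  \bigcap_(c in [set c | (c < l)%N]) ~` child_reaches m i u c x `&` ~` child_reaches m i u l x.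
  apply/seteqP; split => w /=.
    by move=> h; split => [c /= cl|]; apply: h => //=; exact: ltnW.
  by move=> [h1 h2] c /=; rewrite ltnS leq_eqVlt => /orP[/eqP ->//|]; exact: h1.
have sC := @child_reaches_measurable m i u l x.
rewrite setIA (info_independent (first_children_disjoint i u l)).
- rewrite IHl probability_setC; last exact: subtree_measurable sC.
  by rewrite (@probability_child_reaches m i u l x (IH l)) -EFinB -EFinM -mulrA -exprSr.
- exact: no_child_measurable.
- exact: (@measurableC _ (info (child_block i (rcons u l)))).
Qed.

(** The complement splits over the number of children, and summing [p k (1 - E)^k] produces the
    generating function at [1 - E]. *)
Lemma probability_reaches m i u x : P [set w | reaches m i u x w] = (hit m x)%:E.
Proof.
elim: m u x => [|m IH] u x.
  rewrite /= indicE; have [xB|xB] := boolP (x \in B).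
    by rewrite (_ : [set _ | _] = setT) ?probability_setT//; apply/seteqP; split => // w _; exact/set_mem.
  by rewrite (_ : [set _ | _] = set0) ?measure0//; apply/seteqP; split => // w Bx; move/negP: xB => []; exact/mem_set.
have mr := subtree_measurable (@reaches_measurable m.+1 i u x).
have [mh h01] := hitp_measurable_itv hp_ge0 hp_sum P hX0_meas m mB.
have e01 := EX_itv P hX0_meas x mh h01.
pose D k := (N i u @^-1` [set k]) `&` \bigcap_(c in [set c | (c < k)%N]) ~` child_reaches m i u c x.
have mD k : measurable (D k) by exact: subtree_measurable (@no_child_measurable m i u k k x).
have CE : ~` [set w | reaches m.+1 i u x w] = \bigcup_k D k.
  apply/seteqP; split => w /=.
    by move=> h; exists (N i u w) => //; split => // c /= cN hc; apply: h; exists c.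
  by move=> [k _ [/= <- h]] [c [cN hc]]; exact: (h c cN).
have tD : trivIset setT D.
  by move=> k l _ _ [w [[/= <- _] [/= <- _]]].
have : P (~` [set w | reaches m.+1 i u x w]) = (pgf p (1 - E (hit m) x))%:E.
  rewrite CE measure_bigcup//.
  rewrite (eq_eseriesr (g := fun k => (p k * (1 - E (hit m) x) ^+ k)%:E)); last first.
    by move=> k _; exact: probability_no_child.
  apply/cvg_lim => //.
  under eq_fun do rewrite sumEFin.
  apply: cvg_EFin; first exact: nearW.
  have e01' : 0 <= 1 - E (hit m) x <= 1 by case/andP: e01 => ? ?; apply/andP; split; lra.
  rewrite (_ : fine \o _ = (fun n => \sum_(0 <= k < n) p k * (1 - E (hit m) x) ^+ k)).
    exact: (pgf_cvg hp_ge0 hp_sum e01').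
  by apply/funext => n /=; apply: eq_bigl => k; rewrite in_setT.
rewrite probability_setC// => h.
have fr : P [set w | reaches m.+1 i u x w] \is a fin_num by exact: fin_num_measure.
move: h; rewrite -(fineK fr) -EFinB => -[h]; congr (_%:E).
by rewrite /= /survival_step -h; ring.
Qed.

End BranchingTree.

(** Bridge from the recursion to the words of [alive] and [position]; a general prefix [u0] is what
    the induction on [m] demands. *)
Lemma reachesP {R : realType} {d : measure_display} {Omega : measurableType d} (N : nat -> seq nat -> Omega -> nat)
  (X : nat -> seq nat -> Omega -> (R * R)%type) (B : set (R * R)) m i u0 x w :
  reaches N X B m i u0 x w <-> exists u, [/\ size u = m,
    (forall k, (k < m)%N -> (nth 0%N u k < N i (u0 ++ take k u) w)%N) &
    B (x.1 + \sum_(k < size u) (X i (u0 ++ take k.+1 u) w).1,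
       x.2 + \sum_(k < size u) (X i (u0 ++ take k.+1 u) w).2)].
Proof.
elim: m u0 x => [|m IH] u0 x /=.
  split.
    by move=> Bx; exists [::]; rewrite /= !big_ord0 !addr0 -surjective_pairing.
  by move=> [u [/size0nil -> _]]; rewrite /= !big_ord0 !addr0 -surjective_pairing.
have cats (u : seq nat) c k : u0 ++ take k.+1 (c :: u) = rcons u0 c ++ take k u.
  by rewrite /= cat_rcons.
have sums (Y : seq nat -> R) c (u : seq nat) :
    \sum_(k < size (c :: u)) Y (u0 ++ take k.+1 (c :: u)) =
    Y (rcons u0 c) + \sum_(k < size u) Y (rcons u0 c ++ take k.+1 u).
  rewrite [LHS]big_ord_recl; congr (_ + _); first by rewrite cats take0 cats0.
  by apply: eq_bigr => k _; rewrite cats.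
split.
  move=> [c [cN /IH[u [su uN uB]]]]; exists (c :: u); split.
  - by rewrite /= su.
  - by case=> [_|k km]; [rewrite cats0|rewrite cats; exact: uN].
  - rewrite (sums (fun v => (X i v w).1)) (sums (fun v => (X i v w).2)) !addrA; exact: uB.
move=> [[[]//|c u] [[su] uN uB]]; exists c; split.
  by have := uN 0%N isT; rewrite /= cats0.
apply/IH; exists u; split => //.
  by move=> k km; rewrite -cats; exact: (uN k.+1).
by move: uB; rewrite (sums (fun v => (X i v w).1)) (sums (fun v => (X i v w).2)) !addrA.
Qed.

(** * Averaging out the trees of the initial particles *)

Section Forest.
Context {R : realType} (p : nat -> R).
Hypothesis hp_ge0 : forall k, 0 <= p k.
Hypothesis hp_sum : (fun n => \sum_(0 <= k < n) p k) @ \oo --> (1 : R).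
Context {d : measure_display} {Omega : measurableType d} (P : probability Omega R).
Context (xi : nat -> Omega -> (R * R)%type) (N : nat -> seq nat -> Omega -> nat)
  (X : nat -> seq nat -> Omega -> (R * R)%type) (X0 : Omega -> (R * R)%type).
Hypothesis hxi_meas : forall i, measurable_fun [set: Omega] (xi i).
Hypothesis hN_meas : forall i u, measurable_fun [set: Omega] (N i u).
Hypothesis hX_meas : forall i u, measurable_fun [set: Omega] (X i u).
Hypothesis hX0_meas : measurable_fun [set: Omega] X0.


Hypothesis hindep : mutually_independent P (ingredient xi N X).
Hypothesis hN_law : forall i u k, P (N i u @^-1` [set k]) = (p k)%:E.
Hypothesis hX_law : forall i u A, measurable A -> P (X i u @^-1` A) = P (X0 @^-1` A).
Context (B : set (R * R)).
Hypothesis mB : measurable B.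

Local Notation idx := {classic brw_idx}.
Local Notation info S := (g_sigma_algebraType (gens (ingredient xi N X) S)).
Local Notation hit := (hitp p P X0 B).

Definition misses n i : set Omega := ~` [set w | reaches N X B n i [::] (xi i w) w].

(* The information that remains once the trees of the first [K] initial particles are removed. *)
Definition beyond (K : nat) : set idx := \bigcap_(i in [set i | (i < K)%N]) ~` subtree i [::].

Lemma subtree_root_inj i i' (j : idx) : subtree i [::] j -> subtree i' [::] j -> i = i'.
Proof. by case: j => [//|a v [-> _] []|a v [-> _ _] []]. Qed.

Lemma misses_measurable n i (S : set idx) : S IPP -> subtree i [::] `<=` S ->
  <<s gens (ingredient xi N X) S >> (misses n i).
Proof.
move=> S0 sub; apply: (@measurableC _ (info S)).
have mxi : measurable_fun setT (xi i : info S -> (R * R)%type) by exact: info_xi.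
have mp : measurable_fun setT (fun w : info S =>
    (xi i w, w : info (subtree i [::]))).
  by apply: measurable_fun_pair => //; exact: info_id sub.
have := mp measurableT _ (@reaches_jointly_measurable _ _ _ xi N X B mB n i [::]).
by rewrite setTI.
Qed.

(** Induction on [K]: the earlier trees are averaged out with the indicator of particle [K] placed
    in the weight, then the tree of [K] is redrawn given the rest. This is why the weight is general
    and depends only on [beyond K], which retains the initial points. *)
Lemma misses_prod n K (phi : Omega -> \bar R) : (forall w, 0 <= phi w)%E ->
  measurable_fun setT (phi : info (beyond K) -> \bar R) ->
  (\int[P]_w (phi w * (\prod_(i < K) \1_(misses n i) w)%:E) =
   \int[P]_w (phi w * (\prod_(i < K) (1 - hit n (xi i w)))%:E))%E.
Proof.
have [mh h01] := hitp_measurable_itv hp_ge0 hp_sum P hX0_meas n mB.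
have bIPP k : beyond k IPP by move=> i _ [].
elim: K phi => [|K IH] phi phi0 mphi.
  by apply: eq_integral => w _; rewrite !big_ord0.
have subK : beyond K.+1 `<=` beyond K by move=> j hj i /= iK; apply: hj => /=; exact: ltnW.
have treeK : subtree K [::] `<=` beyond K.
  by move=> j hj i /= iK hi; move: iK; rewrite (subtree_root_inj hj hi) ltnn.
have mK : measurable_fun setT (phi : info (beyond K) -> \bar R).
  exact: (measurableT_comp mphi (info_id subK)).
have m1 : measurable_fun setT ((\1_(misses n K) : Omega -> R) : info (beyond K) -> R).
  by apply: measurable_indic; exact: misses_measurable.
transitivity (\int[P]_w ((phi w * (\1_(misses n K) w)%:E) * (\prod_(i < K) \1_(misses n i) w)%:E))%E.
  by apply: eq_integral => w _; rewrite big_ord_recr/= EFinM muleAC muleA.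
rewrite IH; last 2 first.
- by move=> w; apply: mule_ge0 => //; rewrite lee_fin indicE; case: (_ \in _).
- by apply: emeasurable_funM => //; exact/measurable_EFinP.
pose S1 := beyond K.+1; pose S2 := subtree K [::].
pose f (z : info S1 * info S2) : \bar R :=
  (phi z.1 * (\prod_(i < K) (1 - hit n (xi i z.1)))%:E *
   (1 - \1_[set z : info S1 * info S2 | reaches N X B n K [::] (xi K z.1) z.2] z)%:E)%E.
have prod0 w (k : nat) : 0 <= \prod_(i < k) (1 - hit n (xi i w)).
  by apply: prodr_ge0 => i _; rewrite subr_ge0; have /andP[] := h01 (xi i w).
have mr : measurable [set z : info S1 * info S2 | reaches N X B n K [::] (xi K z.1) z.2].
  have mp : measurable_fun setT (fun z : info S1 * info S2 => (xi K z.1, z.2)).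
    apply: measurable_fun_pair; last exact: measurable_snd.
    have mx : measurable_fun setT (xi K : info S1 -> (R * R)%type) by apply: info_xi; exact: bIPP.
    exact: (measurableT_comp mx measurable_fst).
  have := mp measurableT _ (@reaches_jointly_measurable _ _ _ xi N X B mB n K [::]).
  by rewrite setTI.
have mf : measurable_fun setT f.
  apply: emeasurable_funM; first apply: emeasurable_funM.
  - by apply: (measurableT_comp mphi); exact: measurable_fst.
  - apply/measurable_EFinP; apply: measurable_prod => i _.
    apply: measurable_funB; first exact: measurable_cst.
    apply: (measurableT_comp mh).
    have mx : measurable_fun setT (xi i : info S1 -> (R * R)%type) by apply: info_xi; exact: bIPP.
    exact: (measurableT_comp mx measurable_fst).
  - apply/measurable_EFinP; apply: measurable_funB; first exact: measurable_cst.
    exact: measurable_indic.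
have dis : S1 `&` S2 = set0 by rewrite -subset0 => j [h1 h2]; apply: (h1 K) => /=.
transitivity (\int[P]_w f (w, w))%E.
  apply: eq_integral => w _; rewrite /f /= muleAC; congr (_ * _)%E.
  rewrite /misses !indicE in_setC; congr (_%:E).
  rewrite (_ : ((w, w) \in _) = (w \in [set w | reaches N X B n K [::] (xi K w) w]))//.
  by case: (_ \in _); rewrite /= ?subrr ?subr0.
rewrite (@resample _ _ _ _ _ _ _ P (id : Omega -> info S1) (id : Omega -> info S2) f).
- apply: eq_integral => w _; rewrite /f /=.
  have mr' := subtree_measurable hxi_meas hN_meas hX_meas
    (@reaches_measurable _ _ _ xi N X B mB n K [::] (xi K w)).
  set c := (phi w * (\prod_(i < K) (1 - hit n (xi i w)))%:E)%E.
  transitivity (\int[P]_w' (c * (\1_(~` [set w' | reaches N X B n K [::] (xi K w) w']) w')%:E))%E.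
    apply: eq_integral => w' _; rewrite !indicE in_setC; congr (_ * _%:E)%E.
    rewrite (_ : ((w, w') \in _) = (w' \in [set w' | reaches N X B n K [::] (xi K w) w'])) //.
    by case: (_ \in _); rewrite /= ?subrr ?subr0.
  rewrite ge0_integralZl; [|exact: measurableT| | |]; last 3 first.
  + by apply/measurable_EFinP; apply: measurable_indic; exact: measurableC.
  + by move=> w' _; rewrite lee_fin.
  + by rewrite /c mule_ge0// lee_fin.
  rewrite big_ord_recr/= EFinM muleA; congr (_ * _)%E.
  transitivity (P (~` [set w' | reaches N X B n K [::] (xi K w) w'])).
    by rewrite integral_indic ?setIT//; exact: measurableC.
  rewrite (@probability_setC _ _ _ P)//.
  by rewrite (probability_reaches hp_ge0 hp_sum hxi_meas hN_meas hX_meas hX0_meas hindep hN_law hX_law mB).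
- exact: info_all.
- exact: info_all.
- move=> A A' mA mA'; apply: (info_independent hxi_meas hN_meas hX_meas hindep dis); exact: mA || exact: mA'.
- exact: mf.
- move=> z; apply: mule_ge0; first by apply: mule_ge0; rewrite ?lee_fin.
  by rewrite lee_fin subr_ge0 indicE; case: (_ \in _).
Qed.

Lemma probability_misses n K :
  P (\bigcap_(i in [set i | (i < K)%N]) misses n i) =
  (\int[P]_w (\prod_(i < K) (1 - hit n (xi i w)))%:E)%E.
Proof.
have m i : measurable (misses n i).
  apply: (subtree_measurable hxi_meas hN_meas hX_meas).
  by apply: (@misses_measurable n i setT).
have mI : measurable (\bigcap_(i in [set i | (i < K)%N]) misses n i).
  exact: bigcap_measurableType.
have := @misses_prod n K (fun=> 1%E) (fun=> lee01) (measurable_cst _).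
under eq_integral do rewrite mul1e.
under [X in _ = X -> _]eq_integral do rewrite mul1e.
move=> <-; rewrite -[X in P X]setIT -integral_indic//.
apply: eq_integral => w _; congr (_%:E); rewrite indicE.
have [|] := boolP (w \in _).
  move=> /set_mem h; rewrite big1// => i _; rewrite indicE mem_set//.
  by apply: h; exact: (ltn_ord i).
move=> /negP h; have [i hi] : exists i : 'I_K, ~ misses n i w.
  apply: contrapT => /forallNP h'; apply: h; apply: mem_set => i /= iK.
  by have := h' (Ordinal iK); exact: contrapT.
by rewrite (bigD1 i)//= indicE memNset// mul0r.
Qed.

Lemma misses_bigcap_measurable n (D : set nat) : measurable (\bigcap_(i in D) misses n i).
Proof.
apply: bigcap_measurableType => i _.
apply: (subtree_measurable hxi_meas hN_meas hX_meas).
by apply: (@misses_measurable n i setT).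
Qed.

End Forest.

(** The balls are open: a particle at distance [y < a] would lie in some empty ball of radius
    greater than [y], and conversely [a] itself qualifies for the supremum. *)
Lemma Rn_event {R : realType} {d : measure_display} {Omega : measurableType d}
  (xi : nat -> Omega -> (R * R)%type) (N : nat -> seq nat -> Omega -> nat)
  (X : nat -> seq nat -> Omega -> (R * R)%type) n (a : R) : 0 < a ->
  [set w | (a%:E <= Rn xi N X n w)%E] =
  \bigcap_(i in [set: nat]) misses xi N X (eball (0, 0) a) n i.
Proof.
move=> a0.
have zero w (u : R) : Zn xi N X n w (eball ((0, 0) : R * R) u) = 0%E <->
    forall i, ~ reaches N X (eball ((0, 0) : R * R) u) n i [::] (xi i w) w.
  rewrite /Zn; set S := [set q : nat * seq nat | _]; split.
    move=> Z0 i /reachesP[v [sv aliv vB]].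
    suff : (1%E <= \esum_(q in S) (1%E : \bar R))%E by rewrite Z0 lee_fin ler10.
    apply: esum_ge; exists [set (i, v)].
      split; first exact: finite_set1.
      move=> _ ->; split => //; first by split => [k|]; [rewrite sv; exact: aliv|].
    by rewrite fsbig_set1.
  move=> H; rewrite (_ : S = set0) ?esum_set0//; rewrite -subset0 => -[i v] [/= sv [al pB]].
  apply: (H i); apply/reachesP; exists v; split => // k km; apply: al; by rewrite sv.
apply/seteqP; split => w /=.
  move=> h i _ /= hit.
  move: hit => /reachesP[v [sv aliv vB]].
  have {}h : (a%:E <= ereal_sup [set u%:E | u in [set u : R | (0 < u)%R /\
      Zn xi N X n w (eball (0%R, 0%R) u) = 0%E]])%E.
    by move: h; rewrite /Rn le_max => /orP[|//]; rewrite lee_fin leNgt a0.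
  move: vB; rewrite /eball /=; set y := Num.sqrt _ => ya.
  have ya' : (y%:E < a%:E)%E by rewrite lte_fin.
  have [_ [u [u0 /zero H] <-] yu] := ereal_sup_gt (lt_le_trans ya' h).
  rewrite lte_fin in yu.
  by apply: (H i); apply/reachesP; exists v.
move=> h; rewrite /Rn le_max; apply/orP; right; apply: ereal_sup_ubound.
exists a => //; split => //; apply/zero => i; exact: (h i I).
Qed.

(* Junk value [0] when [t] is not a natural number. *)
Definition count_pow {R : realType} (b : R) (t : \bar R) : R :=
  if t is r%:E then if r == (Num.truncn r)%:R then b ^+ Num.truncn r else 0 else 0.

Lemma count_pow_nat {R : realType} (b : R) n : count_pow b n%:R%:E = b ^+ n.
Proof. by rewrite /count_pow natrK eqxx. Qed.

Lemma count_pow_itv {R : realType} (b : R) t : 0 <= b <= 1 -> 0 <= count_pow b t <= 1.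
Proof.
move=> /andP[b0 b1]; rewrite /count_pow.
case: t => [r| |]; rewrite ?lexx ?ler01//.
by case: eqP => _; rewrite ?lexx ?ler01// exprn_ge0// exprn_ile1.
Qed.

Lemma count_pow_series {R : realType} (b : R) t : 0 <= b ->
  (count_pow b t)%:E = (\sum_(0 <= k <oo) (b ^+ k * (t == k%:R%:E)%:R)%:E)%E.
Proof.
move=> b0.
have [[n ->]|nt] := pselect (exists n : nat, t = n%:R%:E).
  rewrite (@nneseriesD1 _ _ n)//; last first.
    by move=> k _; rewrite lee_fin mulr_ge0 ?exprn_ge0.
  rewrite eqxx mulr1 eseries0 ?adde0 ?count_pow_nat// => k _ /= kn.
  by rewrite eqe eqr_nat eq_sym (negPf kn) mulr0.
have nt' k : (t == k%:R%:E) = false by apply/eqP => tk; apply: nt; exists k.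
rewrite eseries0; last by move=> k _ _; rewrite nt' mulr0.
congr EFin; rewrite /count_pow; case: t nt nt' => // r nt _.
by case: eqP => // e; exfalso; apply: nt; exists (Num.truncn r); rewrite -e.
Qed.

Lemma poisson_pmf_ge0 {R : realType} (l : R) k : 0 <= l -> 0 <= Defs.poisson_pmf l k.
Proof. by move=> l0; apply: mulr_ge0; rewrite ?invr_ge0// mulr_ge0 ?expR_ge0 ?exprn_ge0. Qed.

Lemma poisson_pgf {R : realType} (b l : R) : 0 <= b -> 0 <= l ->
  (\sum_(0 <= k <oo) (b ^+ k * Defs.poisson_pmf l k)%:E)%E = (expR (- ((1 - b) * l)))%:E.
Proof.
move=> b0 l0.
have E k : (b ^+ k * Defs.poisson_pmf l k)%:E = ((expR (- l))%:E * (exp_coeff (b * l) k)%:E)%E.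
  rewrite -EFinM /Defs.poisson_pmf /exp_coeff /= exprMn; congr EFin; ring.
under eq_eseriesr do rewrite E.
rewrite nneseriesZl//; last first.
  by move=> k _; rewrite lee_fin exp_coeff_ge0// mulr_ge0.
have -> : (\sum_(0 <= k <oo) (exp_coeff (b * l) k)%:E)%E = (expR (b * l))%:E.
  rewrite /expR -EFin_lim; last exact: is_cvg_series_exp_coeff.
  by apply/congr_lim/funext => n /=; rewrite sumEFin.
by rewrite -EFinM -expRD; congr (expR _)%:E; ring.
Qed.

(** * Joint generating function of Poisson counts *)

Section JointGeneratingFunction.
Context {R : realType} {d : measure_display} {Omega : measurableType d} (P : probability Omega R).
Context (m : nat) (T : 'I_m -> Omega -> \bar R) (lam b : 'I_m -> R).
Hypothesis mT : forall j, measurable_fun [set: Omega] (T j).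
Hypothesis lam_ge0 : forall j, 0 <= lam j.
Hypothesis b_itv : forall j, 0 <= b j <= 1.
Hypothesis T_law : forall k : 'I_m -> nat,
  P (\bigcap_(j in [set: 'I_m]) [set w | T j w = (k j)%:R%:E]) =
  (\prod_(j < m) Defs.poisson_pmf (lam j) (k j))%:E.

(** Hybrid between the indicator of [T = k] at [l = 0] and the generating function at [l = m].
    Raising [l] sums over the value of one count, so the joint law is used directly. *)
Let Q l (k : 'I_m -> nat) w : R := \prod_(j < m)
  (if (j < l)%N then count_pow (b j) (T j w) else (T j w == (k j)%:R%:E)%:R).

Let b_ge0 j : 0 <= b j. Proof. by case/andP: (b_itv j). Qed.

Let mterm k j c : measurable_fun setT (fun w => c * (T j w == k%:R%:E)%:R : R).
Proof.
apply: measurable_funM => //.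
apply: (@measurableT_comp _ _ _ _ _ _ (fun x : bool => x%:R : R)) => //.
exact: measurable_fun_eqe.
Qed.

Lemma measurable_count_pow j : measurable_fun setT (fun w => count_pow (b j) (T j w)).
Proof.
apply/measurable_EFinP.
rewrite (_ : _ \o _ = fun w => (\sum_(0 <= k <oo) (b j ^+ k * (T j w == k%:R%:E)%:R)%:E)%E).
  apply: ge0_emeasurable_sum => [k w _ _|k _].
    by rewrite lee_fin mulr_ge0 // ?exprn_ge0.
  exact/measurable_EFinP/mterm.
by apply/funext => w /=; rewrite count_pow_series.
Qed.

Let mQ l k : measurable_fun setT (Q l k).
Proof.
apply: measurable_prod => j _; case: (j < l)%N; first exact: measurable_count_pow.
have := @mterm (k j) j 1; apply: eq_measurable_fun => w _; exact: mul1r.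
Qed.

Let Q_ge0 l k w : 0 <= Q l k w.
Proof.
apply: prodr_ge0 => j _; case: ifP => // _.
by case/andP: (count_pow_itv (T j w) (b_itv j)).
Qed.

Let prod_levelS l (o : 'I_m) (f g : 'I_m -> R) : (o : nat) = l ->
  \prod_(j < m) (if (j < l.+1)%N then f j else g j) =
  (\prod_(j < m | j != o) (if (j < l)%N then f j else g j)) * f o.
Proof.
move=> ol; rewrite (bigD1 o)//= ol ltnSn mulrC; congr (_ * _).
apply: eq_bigr => j jo; rewrite ltnS leq_eqVlt.
by have [jl|//] := eqVneq (j : nat) l; case/eqP: jo; apply: val_inj; rewrite /= jl ol.
Qed.

Let prod_level l (o : 'I_m) (f g g' : 'I_m -> R) : (o : nat) = l ->
  (forall j, j != o -> g' j = g j) ->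
  \prod_(j < m) (if (j < l)%N then f j else g' j) =
  (\prod_(j < m | j != o) (if (j < l)%N then f j else g j)) * g' o.
Proof.
move=> ol gg; rewrite (bigD1 o)//= ol ltnn mulrC; congr (_ * _).
by apply: eq_bigr => j jo; rewrite gg.
Qed.

Lemma expectation_count_pow :
  (\int[P]_w (\prod_(j < m) count_pow (b j) (T j w))%:E =
   (\prod_(j < m) expR (- ((1 - b j) * lam j)))%:E)%E.
Proof.
suff main l k : (l <= m)%N -> (\int[P]_w (Q l k w)%:E = (\prod_(j < m)
    (if (j < l)%N then expR (- ((1 - b j) * lam j)) else Defs.poisson_pmf (lam j) (k j)))%:E)%E.
  have := main m (fun=> 0%N) (leqnn m); rewrite /Q => Hm.
  have E (f g : 'I_m -> R) : \prod_(j < m) (if (j < m)%N then f j else g j) = \prod_(j < m) f j.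
    by apply: eq_bigr => j _; rewrite ltn_ord.
  rewrite E in Hm; rewrite -Hm; apply: eq_integral => w _; by rewrite E.
elim: l k => [|l IH] k lm.
  rewrite -T_law.
  set E := \bigcap_(j in _) _.
  have mE : measurable E.
    apply: fin_bigcap_measurable => // j _.
    by have := mT j measurableT (emeasurable_set1 (k j)%:R%:E); rewrite setTI.
  rewrite -(setIT E) -integral_indic//; apply: eq_integral => w _; congr EFin.
  rewrite indicE; have [Ew|nEw] := pselect (E w).
    by rewrite mem_set// /Q big1// => j _; rewrite (Ew j) ?eqxx.
  rewrite memNset//; apply/eqP/prodf_eq0.
  have /existsNP[j /not_implyP[_ Tj]] := nEw.
  by exists j => //; rewrite (introF eqP Tj).
pose o := Ordinal lm; pose k' n (j : 'I_m) := if j == o then n else k j.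
rewrite (@prod_levelS l o)//.
transitivity (\int[P]_w (\sum_(0 <= n <oo) ((b o ^+ n)%:E * (Q l (k' n) w)%:E)))%E.
  apply: eq_integral => w _; rewrite /Q (@prod_levelS l o)// EFinM count_pow_series//.
  rewrite -nneseriesZl; last by move=> n _; rewrite lee_fin mulr_ge0 ?exprn_ge0.
  apply: eq_eseriesr => n _.
  rewrite (@prod_level _ o _ (fun j => (T j w == (k j)%:R%:E)%:R))//; last first.
    by move=> j jo; rewrite /k' (negPf jo).
  rewrite -!EFinM; congr EFin; rewrite /k' eqxx; ring.
rewrite integral_nneseries//; last 2 first.
- move=> n; apply: emeasurable_funM => //; exact/measurable_EFinP.
- by move=> n w _; rewrite mule_ge0//; rewrite lee_fin ?exprn_ge0 //.
transitivity (\sum_(0 <= n <oo) ((\prod_(j < m | j != o)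
    (if (j < l)%N then expR (- ((1 - b j) * lam j)) else Defs.poisson_pmf (lam j) (k j)))%:E *
    (b o ^+ n * Defs.poisson_pmf (lam o) n)%:E))%E.
  apply: eq_eseriesr => n _; rewrite ge0_integralZl//; last 3 first.
  - exact/measurable_EFinP.
  - by move=> w _; rewrite lee_fin.
  - by rewrite lee_fin exprn_ge0.
  rewrite (IH (k' n) (ltnW lm)).
  rewrite (@prod_level _ o _ (fun j => Defs.poisson_pmf (lam j) (k j)))//; last first.
    by move=> j jo; rewrite /k' (negPf jo).
  rewrite -!EFinM; congr EFin; rewrite /k' eqxx; ring.
rewrite nneseriesZl; last first.
  by move=> n _; rewrite lee_fin mulr_ge0 ?exprn_ge0 ?poisson_pmf_ge0.
by rewrite poisson_pgf// -EFinM.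
Qed.
End JointGeneratingFunction.

Lemma prod_itv {R : realType} (I : finType) (F : I -> R) :
  (forall i, 0 <= F i <= 1) -> 0 <= \prod_(i : I) F i <= 1.
Proof.
move=> F01; elim/big_ind : _ => [|x y /andP[x0 x1] /andP[y0 y1]|i _]; last exact: F01.
  by rewrite ler01 lexx.
by rewrite mulr_ge0//= mulr_ile1.
Qed.

(** * Products over the initial particles *)

Section PoissonThinning.
Context {R : realType} {d : measure_display} {Omega : measurableType d} (P : probability Omega R).
Context (xi : nat -> Omega -> (R * R)%type).
Hypothesis hxi_meas : forall i, measurable_fun [set: Omega] (xi i).
Hypothesis hpoisson : poisson_lebesgue P xi.

Lemma partial_count_stationary (c : nat -> bool) n :
  (\sum_(0 <= i <oo) ((c i)%:R : R)%:E)%E = n%:R%:E ->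
  \forall K \near \oo, (\sum_(i < K) c i)%N = n.
Proof.
move=> En.
have cv : (fun K : nat => (\sum_(0 <= i < K) ((c i)%:R : R)%:E)%E) @ \oo --> (n%:R : R)%:E.
  by rewrite -En; apply: is_cvg_nneseries => k _ _; rewrite lee_fin.
have fcv : (fun K : nat => fine (\sum_(0 <= i < K) ((c i)%:R : R)%:E)%E) @ \oo --> (n%:R : R).
  exact: fine_cvg cv.
move/cvgrPdist_lt : fcv => /(_ 1 ltr01); apply: filterS => K /=.
rewrite sumEFin /= -natr_sum big_mkord => dist.
apply/eqP; move: dist; rewrite ltr_distl -!(natrD _ _ 1) => /andP[]. 
by rewrite ltrBlDr -!(natrD _ _ 1) !ltr_nat !addn1 !ltnS eqn_leq => -> ->.
Qed.

(** Almost surely all counts are finite, so the product over the first [K] particles is eventually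
    constant in [K]; dominated convergence then yields the joint generating function. *)
Lemma poisson_simple m (A : 'I_m -> set (R * R)) (b : 'I_m -> R) :
  (forall j, measurable (A j)) -> (forall j, (@leb2 R (A j) < +oo)%E) ->
  (forall j j', j != j' -> A j `&` A j' = set0) -> (forall j, 0 <= b j <= 1) ->
  (fun K => \int[P]_w (\prod_(i < K) \prod_(j < m) b j ^+ (xi i w \in A j))%:E)%E @ \oo -->
  (\prod_(j < m) expR (- ((1 - b j) * fine (@leb2 R (A j)))))%:E.
Proof.
move=> mA Afin Adisj b_itv.
pose T j w : \bar R := (\sum_(0 <= i <oo) ((xi i w \in A j)%:R : R)%:E)%E.
have mmem j i : measurable_fun setT (fun w => (xi i w \in A j)%:R : R).
  rewrite (_ : (fun w => _) = \1_(xi i @^-1` A j)); last first.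
    by apply/funext => w; rewrite indicE; congr (_%:R); apply/idP/idP; rewrite !inE.
  apply: measurable_indic; rewrite -[X in measurable X]setTI; exact: hxi_meas.
have mT j : measurable_fun setT (T j).
  apply: ge0_emeasurable_sum => [k w _ _|k _]; first by rewrite lee_fin.
  exact/measurable_EFinP.
have lam0 j : 0 <= fine (@leb2 R (A j)) by apply: fine_ge0.
have law k : P (\bigcap_(j in [set: 'I_m]) [set w | T j w = (k j)%:R%:E]) =
    (\prod_(j < m) Defs.poisson_pmf (fine (@leb2 R (A j))) (k j))%:E by exact: hpoisson.
(* At [b = 1] the generating function equals 1, while [count_pow] is 0 off the naturals: thus [G] is
   the indicator that all counts are natural numbers, and its event has probability 1. *)
pose G w := \prod_(j < m) count_pow 1 (T j w).
have one_itv (j : 'I_m) : 0 <= (1 : R) <= 1 by rewrite ler01 lexx.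
have mG : measurable_fun setT G.
  by apply: measurable_prod => j _; exact: (@measurable_count_pow _ _ _ _ T (fun=> 1)).
have IG : (\int[P]_w (G w)%:E = 1)%E.
  rewrite (@expectation_count_pow _ _ _ P m T _ (fun=> 1) mT lam0 one_itv law).
  by rewrite big1// => j _; rewrite subrr mul0r oppr0 expR0.
pose E := G @^-1` [set 1].
have mE : measurable E by rewrite -[X in measurable X]setTI; exact: mG.
have GE w : G w = \1_E w.
  rewrite indicE; have [Ew|nEw] := pselect (E w); first by rewrite mem_set.
  rewrite memNset//.
  have : (G w == 1) || (G w == 0).
    rewrite /G; elim/big_ind : _ => [|x y|j _]; first by rewrite eqxx.
      by move=> /orP[|] /eqP-> /orP[|] /eqP->; rewrite ?(mulr0,mul0r,mulr1) eqxx ?orbT.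
    rewrite /count_pow; case: (T j w) => [r||]; rewrite ?eqxx ?orbT//.
    by case: ifP; rewrite ?expr1n eqxx ?orbT.
  by case/orP => /eqP //.
have PE : P E = 1%E.
  rewrite -IG -[in LHS](setIT E) -integral_indic//.
  by apply: eq_integral => w _; rewrite GE.
have natE w : E w -> forall j, exists n, T j w = n%:R%:E.
  move=> Gw j; apply: contrapT => nn; have : G w = 0; last first.
    by move=> G0; move: Gw; rewrite /E /= G0 => /eqP; rewrite eq_sym oner_eq0.
  apply/eqP/prodf_eq0; exists j => //; rewrite /count_pow.
  case: (T j w) nn => // r nn; case: ifP => [/eqP e|_]; last by rewrite eqxx.
  exfalso; apply: nn.
  by exists (Num.truncn r); rewrite -e.
have cp_itv (j : 'I_m) t : 0 <= count_pow (b j) t <= 1 by apply: count_pow_itv.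
have factor_itv i w : 0 <= (\prod_(j < m) b j ^+ (xi i w \in A j) : R) <= 1.
  by apply: prod_itv => j; case/andP: (b_itv j) => b0 b1; rewrite exprn_ge0// exprn_ile1.
rewrite -(@expectation_count_pow _ _ _ P m T _ b mT lam0 b_itv law).
have mthin i : measurable_fun setT (fun w => \prod_(j < m) b j ^+ (xi i w \in A j)).
  apply: measurable_prod => j _.
  rewrite (_ : (fun w => _) = fun w => 1 + (b j - 1) * (xi i w \in A j)%:R).
    by apply: measurable_funD => //; apply: measurable_funM.
  by apply/funext => w; case: (_ \in _); rewrite ?expr1 ?expr0 ?mulr1 ?mulr0 ?addr0//; ring.
have [|||||_ _] := @dominated_convergence _ _ _ P setT measurableT
   (fun K w => (\prod_(i < K) \prod_(j < m) b j ^+ (xi i w \in A j))%:E)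
   (fun w => (\prod_(j < m) count_pow (b j) (T j w))%:E) (cst 1%E); last by [].
- by move=> K; apply/measurable_EFinP/measurable_prod => i _; exact: mthin.
- apply/measurable_EFinP/measurable_prod => j _.
  exact: (@measurable_count_pow _ _ _ _ T b).
- exists (~` E); split; first exact: measurableC.
    have := @probability_setC _ _ _ P E mE; by rewrite PE subee.
  move=> w nlim /= Ew; apply: nlim => _.
  have {}Ew := natE w Ew; have [n nE] := choice Ew.
  have ev : \forall K \near \oo, forall j, (\sum_(i < K) (xi i w \in A j))%N = n j.
    by apply: filter_forall => j; exact: (@partial_count_stationary (fun i => xi i w \in A j) (n j) (nE j)).
  apply: cvg_near_cst; apply: filterS ev => K KE; congr EFin.
  rewrite exchange_big /=; apply: eq_bigr => j _.
  by rewrite prodrXr KE nE count_pow_nat.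
- exact: finite_measure_integrable_cst.
- apply: aeW => w K _ /=; rewrite lee_fin.
  have /andP[f0 f1] := @prod_itv R 'I_K _ (fun i => factor_itv i w).
  by rewrite ger0_norm.
Qed.
End PoissonThinning.

Lemma leb2_set0 {R : realType} : @leb2 R set0 = 0%E.
Proof. exact: (measure0 (lebesgue_measure \x lebesgue_measure)%E). Qed.

Lemma leb2_ge0 {R : realType} A : (0 <= @leb2 R A)%E.
Proof. exact: (measure_ge0 (lebesgue_measure \x lebesgue_measure)%E). Qed.

(** * The Laplace functional of the initial points *)

Section PoissonFunctional.
Import HBNNSimple.
Context {R : realType} {d : measure_display} {Omega : measurableType d} (P : probability Omega R).
Context (xi : nat -> Omega -> (R * R)%type).
Hypothesis hxi_meas : forall i, measurable_fun [set: Omega] (xi i).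
Hypothesis hpoisson : poisson_lebesgue P xi.
Local Notation RR := (measurableTypeR R * measurableTypeR R)%type.

Lemma poisson_nnsfun (g : {nnsfun RR >-> R}) : (forall x, g x <= 1) ->
  (\int[@leb2 R]_x (g x)%:E < +oo)%E ->
  (fun K => \int[P]_w (\prod_(i < K) (1 - g (xi i w)))%:E)%E @ \oo -->
  (expR (- fine (\int[@leb2 R]_x (g x)%:E)))%:E.
Proof.
move=> g1 gfin.
pose s : seq R := finmap.enum_fset (fset_set (range g)); pose m := size s.
pose y (j : 'I_m) := nth 0 s j.
have ys j : y j \in s by exact: mem_nth.
have fr : finite_set (range g) by exact: fimfunP.
have yr j : exists x, g x = y j.
  by have := ys j; rewrite /s in_fset_set// inE => -[x _ gx]; exists x.
have y0 j : 0 <= y j by have [x <-] := yr j.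
have y1 j : y j <= 1 by have [x <-] := yr j.
have sg x : g x \in s by rewrite /s in_fset_set// inE; exists x.
have us : uniq s by exact: finmap.fset_uniq.
(* The level set of the value 0 has infinite measure when the integral is finite; it is emptied, and
   its factor [1 - 0] contributes nothing. *)
pose A (j : 'I_m) : set (R * R) := if y j == 0 then set0 else g @^-1` [set y j].
have Isum : (\int[@leb2 R]_x (g x)%:E = \sum_(j < m) (y j)%:E * @leb2 R (g @^-1` [set y j]))%E.
  transitivity (sintegral (@leb2 R) g); first exact: (@integralT_nnsfun _ _ R (lebesgue_measure \x lebesgue_measure)%E g).
  rewrite sintegralE fsbig_finite//= -/s (big_nth 0) big_mkord.
  by [].
have term0 j : (0 <= (y j)%:E * @leb2 R (g @^-1` [set y j]))%E.
  by apply: mule_ge0; rewrite ?lee_fin// leb2_ge0.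
have termfin j : ((y j)%:E * @leb2 R (g @^-1` [set y j]) < +oo)%E.
  apply: le_lt_trans gfin; rewrite Isum (bigD1 j)//= leeDl// sume_ge0//.
have Afin j : (@leb2 R (A j) < +oo)%E.
  rewrite /A; case: eqVneq => [_|yj]; first by rewrite leb2_set0.
  rewrite ltey; apply/eqP => lA; have := termfin j; rewrite lA gt0_muley ?ltxx//.
  by rewrite lte_fin lt_neqAle eq_sym yj y0.
have termE j : ((y j)%:E * @leb2 R (g @^-1` [set y j]) = (y j * fine (@leb2 R (A j)))%:E)%E.
  have := Afin j; rewrite /A; case: eqVneq => [->|yj] Af; first by rewrite mul0e mul0r.
  by rewrite EFinM fineK// ge0_fin_numE// leb2_ge0.
have -> : expR (- fine (\int[@leb2 R]_x (g x)%:E)%E) =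
    \prod_(j < m) expR (- ((1 - (1 - y j)) * fine (@leb2 R (A j)))).
  rewrite -(big_morph _ (@expRD R) (@expR0 R)) Isum (eq_bigr _ (fun j _ => termE j)) sumEFin /=.
  by rewrite sumrN; congr (expR (- _)); apply: eq_bigr => j _; congr (_ * _); ring.
have mg : measurable_fun (setT : set RR) g by exact: measurable_funPT.
have mA j : measurable (A j).
  rewrite /A; case: ifP => // _.
  have := mg measurableT [set y j] (measurable_set1 _); by rewrite setTI.
have dis j j' : j != j' -> A j `&` A j' = set0.
  move=> jj; apply/seteqP; split => // x []; rewrite /A; case: ifP => // _; case: ifP => //= _ -> /eqP.
  by rewrite /y nth_uniq// => /eqP e; case/eqP: jj; exact: val_inj.
have bi j : 0 <= 1 - y j <= 1 by rewrite subr_ge0 y1 lerBlDr lerDl y0.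
have := poisson_simple hxi_meas hpoisson mA Afin dis bi; apply: cvg_trans; apply: near_eq_cvg; near=> K.
apply: eq_integral => w _; congr EFin; apply: eq_bigr => i _.
have i0m : (index (g (xi i w)) s < m)%N by rewrite index_mem.
pose j0 := Ordinal i0m.
have yj0 : y j0 = g (xi i w) by rewrite /y nth_index.
rewrite (bigD1 j0)//= big1 ?mulr1; last first.
  move=> j jj; rewrite memNset// /A; case: ifP => // _ gy; first by case: gy.
  have /eqP := etrans yj0 gy.
  by rewrite /y nth_uniq// => /eqP e; case/eqP: jj; exact: val_inj.
rewrite /A yj0; case: eqVneq => [->|ne]; first by rewrite in_set0 expr0 subr0.
by rewrite mem_set.
Unshelve. all: end_near. Qed.

Lemma poisson_functional (v : R * R -> R) : measurable_fun setT v ->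
  (forall x, 0 <= v x <= 1) -> (\int[@leb2 R]_x (v x)%:E < +oo)%E ->
  (fun K => \int[P]_w (\prod_(i < K) (1 - v (xi i w)))%:E)%E @ \oo -->
  (expR (- fine (\int[@leb2 R]_x (v x)%:E)))%:E.
Proof.
move=> mv v01 vfin.
have mv' : measurable_fun (setT : set RR) v by exact: mv.
have mEv : measurable_fun (setT : set RR) (EFin \o v) by exact/measurable_EFinP.
have v0 x : (0 <= (EFin \o v) x)%E by rewrite lee_fin; case/andP: (v01 x).
pose g := nnsfun_approx measurableT mEv.
have gv_cvg x : (EFin \o g ^~ x) @ \oo --> (v x)%:E.
  by apply: cvg_nnsfun_approx.
have g_nd : nondecreasing_seq (g : (RR -> R)^nat) by exact: nd_nnsfun_approx.
have gv_cvgr x : (fun L => g L x) @ \oo --> v x.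
  exact: fine_cvg (gv_cvg x).
have g_le L L' x : (L <= L')%N -> g L x <= g L' x by move=> LL; have /lefP := g_nd _ _ LL; exact.
have gv L x : g L x <= v x.
  have nd : nondecreasing_seq (fun L => g L x) by move=> L1 L2; exact: g_le.
  have cv : cvgn (fun L => g L x) by apply/cvg_ex; exists (v x).
  have := nondecreasing_cvgn_le nd cv L; by rewrite (cvg_lim _ (gv_cvgr x)).
have g01 L x : 0 <= g L x <= 1.
  by rewrite fun_ge0 /=; apply: le_trans (gv L x) _; case/andP: (v01 x).
pose I L := (\int[@leb2 R]_x (g L x)%:E)%E.
have mg L : measurable_fun (setT : set RR) (fun x => (g L x)%:E) by exact/measurable_EFinP.
have IL L : (I L <= \int[@leb2 R]_x (v x)%:E)%E.
  by apply: ge0_le_integral => // x _; rewrite lee_fin.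
have Ifin L : (I L < +oo)%E by exact: le_lt_trans (IL L) vfin.
have Icvg : I @ \oo --> (\int[@leb2 R]_x (v x)%:E)%E.
  rewrite (_ : (\int[@leb2 R]_x (v x)%:E)%E = (\int[@leb2 R]_x (limn (fun L => (g L x)%:E)))%E); last first.
    by apply: eq_integral => x _; apply/esym/cvg_lim => //; exact: gv_cvg.
  apply: (@cvg_monotone_convergence _ _ _ _ _ measurableT (fun L x => (g L x)%:E)) => //.
    by move=> L x _; rewrite lee_fin.
  by move=> x _ L L' LL; rewrite lee_fin g_le.
pose S (f : R * R -> R) K := (\int[P]_w (\prod_(i < K) (1 - f (xi i w)))%:E)%E.
have itv1 (f : R * R -> R) K w : (forall x, 0 <= f x <= 1) ->
    0 <= \prod_(i < K) (1 - f (xi i w)) <= 1.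
  move=> f01; apply: prod_itv => i; case/andP: (f01 (xi i w)) => f0 f1.
  by rewrite subr_ge0 f1 lerBlDr lerDl.
have mprod (f : R * R -> R) K : measurable_fun setT f ->
    measurable_fun setT (fun w => \prod_(i < K) (1 - f (xi i w))).
  move=> mf; apply: measurable_prod => i _; apply: measurable_funB => //.
  exact: measurableT_comp.
have S_ninc (f : R * R -> R) : measurable_fun setT f -> (forall x, 0 <= f x <= 1) ->
    nonincreasing_seq (S f).
  move=> mf f01; apply/nonincreasing_seqP => K; apply: ge0_le_integral => //.
  - by move=> w _; rewrite lee_fin; case/andP: (itv1 f K.+1 w f01).
  - exact/measurable_EFinP/mprod.
  - exact/measurable_EFinP/mprod.
  - move=> w _; rewrite lee_fin big_ord_recr /=; have /andP[p0 p1] := itv1 f K w f01.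
    case/andP: (f01 (xi K w)) => f0 f1; apply: ler_piMr => //; lra.
have S_anti (f h : R * R -> R) K : measurable_fun setT f -> (forall x, 0 <= f x <= 1) -> measurable_fun setT h ->
    (forall x, 0 <= h x <= 1) -> (forall x, f x <= h x) -> (S h K <= S f K)%E.
  move=> mf f01 mh h01 fh; apply: ge0_le_integral => //.
  - by move=> w _; rewrite lee_fin; case/andP: (itv1 h K w h01).
  - exact/measurable_EFinP/mprod.
  - exact/measurable_EFinP/mprod.
  - move=> w _; rewrite lee_fin; apply: (@ler_prod _ _ _ _ (fun i : 'I_K => 1 - h (xi i w)) (fun i => 1 - f (xi i w))) => i _.
    by case/andP: (h01 (xi i w)) => _ h1; rewrite subr_ge0 h1 lerB.
have S_cvg (f : R * R -> R) : measurable_fun setT f -> (forall x, 0 <= f x <= 1) ->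
    S f @ \oo --> ereal_inf (range (S f)).
  by move=> mf f01; apply: ereal_nonincreasing_cvgn; exact: S_ninc.
have gm L : measurable_fun setT (g L) by [].
have Sg L : ereal_inf (range (S (g L))) = (expR (- fine (I L)))%:E.
  apply: (@cvg_unique _ _ (S (g L) @ \oo)) => //; first exact: (S_cvg (g L) (gm L) (g01 L)).
  by apply: poisson_nnsfun => [x|]; [case/andP: (g01 L x)|exact: Ifin].
have vpos : (0 <= \int[@leb2 R]_x (v x)%:E)%E.
  by apply: integral_ge0 => x _; exact: v0.
have vE : (fine (\int[@leb2 R]_x (v x)%:E))%:E%E = (\int[@leb2 R]_x (v x)%:E)%E.
  by rewrite fineK// ge0_fin_numE.
have Ipos L : (0 <= I L)%E by apply: integral_ge0 => x _; rewrite lee_fin.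
have expcvg : (fun L => (expR (- fine (I L)))%:E) @ \oo --> (expR (- fine (\int[@leb2 R]_x (v x)%:E)%E))%:E.
  apply: cvg_EFin; first exact: nearW.
  apply: continuous_cvg; first exact: continuous_expR.
  by apply: cvgN; apply: fine_cvg; rewrite vE.
(* Both limits, in [K] and in the simple functions, are decreasing, so their interchange reduces to
   comparing infima. *)
suff <- : ereal_inf (range (S v)) = (expR (- fine (\int[@leb2 R]_x (v x)%:E)%E))%:E by exact: S_cvg.
apply/eqP; rewrite eq_le; apply/andP; split.
  rewrite -(cvg_lim _ expcvg)//; apply: lime_ge; first by apply/cvg_ex; eexists; exact: expcvg.
  apply: nearW => L; rewrite -Sg; apply: le_ereal_inf_tmp => _ [K _ <-].
  apply: ge_ereal_inf; exists (S v K); [by exists K|].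
  exact: (S_anti (g L) v K (gm L) (g01 L) mv v01 (gv L)).
apply: le_ereal_inf_tmp => _ [K _ <-].
have lim : (fun L => S (g L) K) @ \oo --> S v K.
  have [|||||_ _] := @dominated_convergence _ _ _ P setT measurableT
    (fun L w => (\prod_(i < K) (1 - g L (xi i w)))%:E)
    (fun w => (\prod_(i < K) (1 - v (xi i w)))%:E) (cst 1%E); last by [].
  - by move=> L; apply/measurable_EFinP; exact: (mprod (g L) K (gm L)).
  - exact/measurable_EFinP/mprod.
  - apply: aeW => w _; apply: cvg_EFin; first exact: nearW.
    elim: (K) => [|k IH]; first by under eq_fun do rewrite big_ord0; rewrite big_ord0; exact: cvg_cst.
    under eq_fun do rewrite big_ord_recr /=; rewrite big_ord_recr /=.
    by apply: cvgM => //; apply: cvgB; [exact: cvg_cst|exact: gv_cvgr].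
  - exact: finite_measure_integrable_cst.
  - apply: aeW => w L _ /=; rewrite lee_fin.
    by have /andP[? ?] := itv1 (g L) K w (g01 L); rewrite ger0_norm.
rewrite -(cvg_lim _ lim)//; apply: lime_ge; first by apply/cvg_ex; eexists; exact: lim.
apply: nearW => L; apply: le_trans (_ : ereal_inf (range (S (g L))) <= _)%E; last first.
  by apply: ge_ereal_inf; exists (S (g L) K) => //; exists K.
by rewrite Sg lee_fin ler_expR lerN2 fine_le ?ge0_fin_numE.
Qed.
End PoissonFunctional.

(** * Dilations of the plane *)

Local Notation RR R := (measurableTypeR R * measurableTypeR R)%type.

Lemma lebesgue_measure_dilation {R : realType} (c : R) (A : set R) : c != 0 -> measurable A ->
  (`|c|%:E * @lebesgue_measure R (( *%R c) @^-1` A) = @lebesgue_measure R A)%E.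
Proof.
move=> c0 mA.
have mc : measurable_fun (setT : set (measurableTypeR R)) ( *%R c : _ -> measurableTypeR R).
  by apply: measurable_funM => //; exact: measurable_cst.
apply/esym; apply: (@lebesgue_measure_unique R (mscale (NngNum (normr_ge0 c)) (pushforward lebesgue_measure ( *%R c : measurableTypeR R -> measurableTypeR R)))) => //.
move=> _ [[a b]] _ <-.
change (lebesgue_measure `]a, b] = `|c|%:E * lebesgue_measure ( *%R c @^-1` `]a, b]))%E.
have [cp|cn] : 0 < c \/ c < 0 by case: (ltgtP c 0) c0 => //; [right|left].
  rewrite (_ : _ @^-1` _ = [set` `]a / c, b / c]%R]); last first.
    by apply/seteqP; split => x /=; rewrite !in_itv/= ltr_pdivrMr// ler_pdivlMr// [x * c]mulrC.
  rewrite !lebesgue_measure_itv/= !lte_fin ltr_pM2r ?invr_gt0// gtr0_norm//.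
  case: ifP => _; rewrite ?mule0// -!EFinB -EFinM; congr EFin; field; exact: lt0r_neq0.
rewrite (_ : _ @^-1` _ = [set` `[b / c, a / c[%R]); last first.
  by apply/seteqP; split => x /=; rewrite !in_itv/= ltr_ndivlMr// ler_ndivrMr// [x * c]mulrC andbC.
rewrite !lebesgue_measure_itv/= !lte_fin ltr_nM2r ?invr_lt0// ltr0_norm//.
case: ifP => _; rewrite ?mule0// -!EFinB -EFinM; congr EFin; field; exact: ltr0_neq0.
Qed.

(** Negative factors are included: the upper bound starts the trees at [- sqrt n x]. *)
Lemma integral_dilation {R : realType} (c : R) (f : R * R -> \bar R) : c != 0 ->
  measurable_fun setT f -> (forall x, 0 <= f x)%E ->
  (\int[@leb2 R]_x f x = (c ^+ 2)%:E * \int[@leb2 R]_x f (c * x.1, c * x.2)%R)%E.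
Proof.
move=> c0 mf f0.
pose h (x : RR R) : RR R := (c * x.1, c * x.2).
have mh : measurable_fun (setT : set (RR R)) h.
  by apply: measurable_fun_pair; apply: measurable_funM => //; exact: measurable_cst.
pose mu : {measure set (RR R) -> \bar R} := (lebesgue_measure \x lebesgue_measure)%E.
have c2 : 0 <= c ^+ 2 by exact: sqr_ge0.
pose pm : {measure set (RR R) -> \bar R} := measure_function_pushforward__canonical__measure_function_Measure mu mh.
pose nu : {measure set (RR R) -> \bar R} := mscale (NngNum c2) pm.
have mf' : measurable_fun (setT : set (RR R)) f by exact: mf.
transitivity (\int[nu]_x f x)%E.
  apply: eq_measure_integral => A mA _.
  apply: (@product_measure_unique _ _ _ _ _ lebesgue_measure lebesgue_measure nu) => // A1 A2 mA1 mA2.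
  change ((c ^+ 2)%:E * mu (h @^-1` (A1 `*` A2)) = lebesgue_measure A1 * lebesgue_measure A2)%E.
  have mpre (B : set (measurableTypeR R)) : measurable B ->
      measurable (( *%R c : measurableTypeR R -> measurableTypeR R) @^-1` B).
    move=> mB; rewrite -[X in measurable X]setTI.
    have mc : measurable_fun (setT : set (measurableTypeR R)) ( *%R c : _ -> measurableTypeR R).
      by apply: measurable_funM => //; exact: measurable_cst.
    exact: mc.
  have -> : mu (h @^-1` (A1 `*` A2)) =
      (lebesgue_measure (( *%R c) @^-1` A1) * lebesgue_measure (( *%R c) @^-1` A2))%E.
    exact: (@product_measure1E _ _ _ _ R lebesgue_measure lebesgue_measure _ _ (mpre _ mA1) (mpre _ mA2)).
  rewrite -(@lebesgue_measure_dilation _ c A1)// -(@lebesgue_measure_dilation _ c A2)//.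
  rewrite -[c ^+ 2]real_normK ?num_real// expr2 EFinM -!muleA; congr (_ * _)%E.
  by rewrite muleCA.
transitivity ((c ^+ 2)%:E * \int[pm]_x f x)%E.
  by apply: (@ge0_integral_mscale _ _ _ pm setT measurableT (NngNum c2)).
apply: (congr1 (mule (c ^+ 2)%:E)).
have f0' : {in (setT : set (RR R)), forall y, (0 <= f y)%E} by move=> y _; exact: f0.
exact: (@ge0_integral_pushforward _ _ _ _ _ h mh mu setT f measurableT mf' f0').
Qed.

(** * The area of the disc and an integrable majorant of [|y|^-4] *)

Section Disk.
Context {R : realType}.
Local Notation mu := (@lebesgue_measure R).

(** The substitution [x = sin t] gives [2 cos^2 t], with primitive [t + sin t cos t]. *)
Lemma integral_half_circle : (\int[mu]_(x in `[(-1)%R, 1%R]) (2 * Num.sqrt (1 - x ^+ 2))%:E = pi%:E)%E.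
Proof.
have pi2 : - (pi / 2) < pi / 2 :> R by rewrite gtrN// divr_gt0// pi_gt0.
have dsin : derive1 (@sin R) = cos by apply/funext => x; rewrite derive1E derive_val.
have scE x : sin x ^+ 2 = 1 - cos x ^+ 2 :> R by exact: sin2cos2.
have -> : `[(-1)%R, 1%R]%classic = `[sin (- (pi / 2)) : R, sin (pi / 2)]%classic.
  by rewrite sinN sin_pihalf.
rewrite (@integration_by_substitution_increasing R sin (fun x => 2 * Num.sqrt (1 - x ^+ 2))).
- transitivity (\int[mu]_(x in `[(- (pi / 2))%R, (pi / 2)%R]) (2 * cos x ^+ 2)%:E)%E.
    apply: eq_integral => x; rewrite inE /= in_itv /= => xp; congr EFin.
    rewrite /= !fctE /= dsin scE opprB addrCA subrr addr0 sqrtr_sqr ger0_norm; last first.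
      exact: cos_ge0_pihalf.
    by rewrite expr2 mulrA.
  rewrite (@continuous_FTC2 _ _ (fun x => x + sin x * cos x))//.
  + rewrite -EFinB; congr EFin; rewrite cosN cos_pihalf !mulr0 !addr0 opprK; lra.
  + apply: continuous_subspaceT => x; apply: cvgM; first exact: cvg_cst.
    by apply: cvgM; exact: continuous_cos.
  + split => [x _||].
    * by apply: derivableD => //; apply: derivableM.
    * apply: cvg_at_right_filter; apply: cvgD => //; apply: cvgM; [exact: continuous_sin|exact: continuous_cos].
    * apply: cvg_at_left_filter; apply: cvgD => //; apply: cvgM; [exact: continuous_sin|exact: continuous_cos].
  + move=> x _; rewrite derive1E.
    have d : is_derive x (1 : R) (id + sin * cos : R -> R) (1 + (sin x *: (- sin x) + cos x *: cos x)).
      by apply: is_deriveD.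
    rewrite -[LHS]/('D_1 (id + sin * cos : R -> R) x) derive_val /GRing.scale /=.
    have := scE x; rewrite !expr2 => e; lra.
- by rewrite ltW.
- by move=> x y xI yI xy; rewrite ltr_sin.
- by move=> x _; rewrite dsin; exact: continuous_cos.
- by rewrite dsin; apply/cvg_ex; eexists; apply: cvg_at_right_filter; exact: continuous_cos.
- by rewrite dsin; apply/cvg_ex; eexists; apply: cvg_at_left_filter; exact: continuous_cos.
- split => [x _||]; first by [].
    by apply: cvg_at_right_filter; exact: continuous_sin.
  by apply: cvg_at_left_filter; exact: continuous_sin.
- apply: continuous_subspaceT => x; apply: cvgM; first exact: cvg_cst.
  apply: continuous_comp; last exact: sqrt_continuous.
  by apply: cvgB; [exact: cvg_cst|exact: exprn_continuous].
Qed.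

Lemma leb2_unit_disk : @leb2 R (@eball R (0, 0) 1) = pi%:E.
Proof.
have -> : @leb2 R (@eball R (0, 0) 1) = (\int[mu]_x mu (xsection (@eball R (0%R, 0%R) 1%R) x))%E by [].
rewrite -integral_half_circle [RHS]integral_mkcond; apply: eq_integral => x _.
have -> : xsection (@eball R (0, 0) 1) x = `]- Num.sqrt (1 - x ^+ 2), Num.sqrt (1 - x ^+ 2)[%classic.
  apply/seteqP; split => y /=; rewrite /xsection /= inE /eball /= !subr0 in_itv /= -ltr_norml -sqrtr_sqr;
    rewrite -[X in _ < X -> _]sqrtr1 || rewrite -[X in _ -> _ < X]sqrtr1.
    rewrite ltr_sqrt// => xy; rewrite ltr_sqrt; first lra.
    by have := sqr_ge0 y; lra.
  move=> h; rewrite ltr_sqrt//; have x1 : 0 < 1 - x ^+ 2.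
    rewrite ltNge; apply/negP => n; move: h; rewrite (ler0_sqrtr n) ltNge sqrtr_ge0//.
  by move: h; rewrite ltr_sqrt//; lra.
rewrite lebesgue_measure_itv /= lte_fin -EFinB opprK /patch mem_setE in_itv /=.
have [s0|s0] := ltP (- Num.sqrt (1 - x ^+ 2)) (Num.sqrt (1 - x ^+ 2)).
  rewrite ifT; first by congr EFin; lra.
  have : 0 < Num.sqrt (1 - x ^+ 2) by lra.
  by rewrite sqrtr_gt0 => h; apply/andP; split; nra.
have -> : Num.sqrt (1 - x ^+ 2) = 0.
  by apply/eqP; rewrite eq_le sqrtr_ge0 andbT; lra.
by rewrite mulr0; case: ifP.
Qed.

Lemma leb2_disk (r : R) : 0 < r -> @leb2 R (@eball R (0, 0) r) = (pi * r ^+ 2)%:E.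
Proof.
move=> r0.
have leb2E (A : set (R * R)) : measurable A -> @leb2 R A = (\int[@leb2 R]_x (\1_A x)%:E)%E.
  move=> mA; rewrite (@integral_indic _ _ _ (mu \x mu)%E setT measurableT A)// setIT//.
rewrite leb2E; last exact: measurable_eball.
rewrite (@integral_dilation _ r _ (lt0r_neq0 r0))//; last first.
- by apply/measurable_EFinP; apply: measurable_indic; exact: measurable_eball.
rewrite (_ : (\int[@leb2 R]_x _)%E = pi%:E); first by rewrite -EFinM mulrC.
rewrite -leb2_unit_disk leb2E; last exact: measurable_eball.
apply: eq_integral => x _; congr EFin; rewrite !indicE; congr (_%:R); congr nat_of_bool.
apply/idP/idP; rewrite !inE /eball /= !subr0 !exprMn -mulrDr sqrtrM ?sqr_ge0// sqrtr_sqr gtr0_norm//.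
  by rewrite gtr_pMr.
by rewrite gtr_pMr.
Qed.

Lemma integral_oneDsqr : (\int[mu]_x (oneDsqr x)^-1%:E = pi%:E)%E.
Proof.
rewrite (ge0_symfun_integralT (f := fun x => (oneDsqr x)^-1))//=.
- rewrite (_ : [set x | _] = `[0, +oo[%classic); last first.
    by apply/seteqP; split => x/=; rewrite in_itv/= andbT.
  by rewrite integral0y_oneDsqr -EFinM; congr EFin; field.
- exact: continuous_oneDsqrV.
- by move=> x; rewrite /= /oneDsqr sqrrN.
Qed.

(** A product majorant of [|y|^-4] away from the origin reduces the planar tail integral to two
    arctangents. *)
Lemma integral_oneDsqr2 :
  (\int[@leb2 R]_x ((oneDsqr x.1)^-1 * (oneDsqr x.2)^-1)%:E = (pi ^+ 2)%:E)%E.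
Proof.
have m1 : measurable_fun (setT : set (measurableTypeR R)) (fun x : R => (oneDsqr x)^-1).
  by apply: continuous_measurable_fun; exact: continuous_oneDsqrV.
have m1' : measurable_fun (setT : set (measurableTypeR R)) (fun x : R => ((oneDsqr x)^-1)%:E).
  exact/measurable_EFinP.
have scale (k : R) : 0 <= k -> (\int[mu]_y (k%:E * ((oneDsqr y)^-1)%:E) = (k * pi)%:E)%E.
  move=> k0; rewrite EFinM -integral_oneDsqr.
  by apply: (@ge0_integralZl _ _ _ mu setT measurableT (fun x : R => ((oneDsqr x)^-1)%:E)).
transitivity (\int[mu]_x \int[mu]_y ((oneDsqr x)^-1 * (oneDsqr y)^-1)%:E)%E.
  apply: (@fubini_tonelli1 _ _ _ _ R mu mu (fun x => ((oneDsqr x.1)^-1 * (oneDsqr x.2)^-1)%:E)).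
    apply/measurable_EFinP; apply: measurable_funM.
      exact: (measurableT_comp m1 measurable_fst).
    exact: (measurableT_comp m1 measurable_snd).
  by move=> x; rewrite lee_fin mulr_ge0.
transitivity (\int[mu]_x (pi%:E * ((oneDsqr x)^-1)%:E))%E.
  apply: eq_integral => x _; under eq_integral do rewrite EFinM.
  by rewrite scale// EFinM muleC.
by rewrite scale ?pi_ge0// expr2.
Qed.
End Disk.

(** Read off the supremum over simple functions, for integrands whose measurability is not
    established: the void probability as a function of [x], and the Laplace integrand as a function
    of [w]. *)
Lemma ge0_le_integral_nomeas {d : measure_display} {T : measurableType d} {R : realType}
  (mu : {measure set T -> \bar R}) (f g : T -> \bar R) : (forall x, 0 <= f x)%E ->
  (forall x, f x <= g x)%E -> (\int[mu]_x f x <= \int[mu]_x g x)%E.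
Proof.
move=> f0 fg; have g0 x : (0 <= g x)%E by exact: le_trans (f0 x) (fg x).
rewrite !ge0_integralTE//; apply: ereal_sup_le => _ [h hf <-]; exists h => // x.
exact: le_trans (hf x) (fg x).
Qed.

Lemma limn_einf_ge {R : realType} (a : \bar R) (u : nat -> \bar R) :
  (\forall n \near \oo, (a <= u n)%E) -> (a <= limn_einf u)%E.
Proof.
move=> [N _ Nu]; rewrite limn_einf_lim (cvg_lim _ (cvg_einfs_sup (u := u)))//.
apply: (@le_trans _ _ (einfs u N)); last by apply: ereal_sup_ubound; exists N.
by apply: le_ereal_inf_tmp => _ [k Nk <-]; exact: Nu.
Qed.

(** * The probability of a clearing and its lower bound *)

Section Clearing.
Context {R : realType} (p : nat -> R) (s2 : R).
Hypothesis hp_ge0 : forall k, 0 <= p k.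
Hypothesis hp_sum : (fun n => \sum_(0 <= k < n) p k) @ \oo --> (1 : R).
Hypothesis hp1 : p 1%N < 1.
Hypothesis hp_mean : (fun n => \sum_(0 <= k < n) (k%:R * p k)) @ \oo --> (1 : R).
Hypothesis hp_var : (fun n => \sum_(0 <= k < n) (k%:R ^+ 2 * p k)) @ \oo --> s2 + 1.
Context {d : measure_display} {Omega : measurableType d} (P : probability Omega R).
Context (X0 : Omega -> (R * R)%type).
Hypothesis hX0_meas : measurable_fun [set: Omega] X0.
Hypothesis hX0_m4 : (\int[P]_w ((((X0 w).1 ^+ 2 + (X0 w).2 ^+ 2) ^+ 2)%:E) < +oo)%E.
Hypothesis hX0_mean1 : (\int[P]_w ((X0 w).1)%:E = 0)%E.
Hypothesis hX0_mean2 : (\int[P]_w ((X0 w).2)%:E = 0)%E.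
Hypothesis hX0_cov11 : (\int[P]_w (((X0 w).1 ^+ 2)%:E) = 1)%E.
Hypothesis hX0_cov22 : (\int[P]_w (((X0 w).2 ^+ 2)%:E) = 1)%E.
Hypothesis hX0_cov12 : (\int[P]_w (((X0 w).1 * (X0 w).2)%:E) = 0)%E.

Local Notation hit := (hitp p P X0).
Local Notation tail := (tail_const p P X0).
Local Notation ballh r n := (eball (0, 0) (r * Num.sqrt n%:R)).

(* [3] comes from [(1 + y1^2) (1 + y2^2) <= 3 |y|^4] for [|y| >= 1]. *)
Definition tail_mass (r rho : R) : R := 3 * tail * (1 - r / rho) ^- 4.

Lemma tail_mass_ge0 r rho : 0 <= tail_mass r rho.
Proof.
rewrite /tail_mass mulr_ge0//; last by rewrite invr_ge0 exprn_even_ge0.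
rewrite mulr_ge0// ltW// (tail_const_gt0 hp_ge0 hp_sum hp1 hp_mean P X0)//.
Qed.

Lemma hitp_rescaled_le n r rho (y : R * R) : (0 < n)%N -> 0 < r -> r < rho -> 1 <= rho ->
  hit (ballh r n) n (Num.sqrt n%:R * y.1, Num.sqrt n%:R * y.2) <=
  survival p n * \1_(eball (0, 0) rho) y +
  tail_mass r rho / n%:R * ((oneDsqr y.1)^-1 * (oneDsqr y.2)^-1).
Proof.
move=> n0 r0 rrho rho1; set a := Num.sqrt n%:R.
have n0r : 0 < n%:R :> R by rewrite ltr0n.
have a0 : 0 < a by rewrite sqrtr_gt0.
have aa : a ^+ 2 = n%:R by rewrite sqr_sqrtr.
have rho0 : 0 < rho by lra.
have /andP[s0 s1] := survival_itv hp_ge0 hp_sum n.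
have second_ge0 : 0 <= tail_mass r rho / n%:R * ((oneDsqr y.1)^-1 * (oneDsqr y.2)^-1).
  apply: mulr_ge0; first by apply: divr_ge0; [exact: tail_mass_ge0|exact: ltW].
  by apply: mulr_ge0; rewrite invr_ge0 (le_trans ler01 (oneDsqr_ge1 _)).
rewrite indicE; have [yin|yout] := boolP (y \in eball (0, 0) rho).
  rewrite mulr1; apply: ler_wpDr => //.
  by apply: hitp_le_survival => //; exact: measurable_eball.
rewrite mulr0 add0r; set s := Num.sqrt (y.1 ^+ 2 + y.2 ^+ 2).
have ss : s ^+ 2 = y.1 ^+ 2 + y.2 ^+ 2 by rewrite sqr_sqrtr// addr_ge0 ?sqr_ge0.
have rhos : rho <= s.
  by move: yout; rewrite notin_setE /eball /= !subr0 => /negP; rewrite -leNgt.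
have s0' : 0 < s by lra.
have en : Num.sqrt ((a * y.1) ^+ 2 + (a * y.2) ^+ 2) = a * s.
  by rewrite !exprMn -mulrDr sqrtrM ?sqr_ge0// sqrtr_sqr gtr0_norm.
have rs : r * a < a * s by rewrite mulrC ltr_pM2l//; lra.
have ra0 : 0 <= r * a by rewrite mulr_ge0// ltW.
have ht := @hitp_tail R p hp_ge0 hp_sum hp1 hp_mean d Omega P X0 hX0_meas hX0_m4
  hX0_mean1 hX0_mean2 hX0_cov11 hX0_cov22 hX0_cov12 (r * a) n (a * y.1, a * y.2) ra0.
rewrite /= en in ht; apply: (le_trans (ht rs)) => {ht}.
have K0 := tail_const_gt0 hp_ge0 hp_sum hp1 hp_mean P X0.
set K := tail in K0 *; set c := 1 - r / rho.
have c0 : 0 < c by rewrite subr_gt0 ltr_pdivrMr// mul1r.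
have cs : c * s <= s - r.
  have : r / rho * rho <= r / rho * s by rewrite ler_pM2l// divr_gt0.
  rewrite divfK ?gt_eqF// /c; move: (r / rho) => q; lra.
have sr : 0 < s - r by lra.
have E1 : K * n%:R / (a * s - r * a) ^+ 4 = K / n%:R * (s - r) ^- 4.
  rewrite -aa; field; rewrite (gt_eqF a0) /=.
  by rewrite [a * s]mulrC [r * a]mulrC -[s * a]mulrC -mulrBr mulf_neq0 ?gt_eqF.
have E2 : (s - r) ^- 4 <= (c * s) ^- 4.
  by rewrite lef_pV2 ?posrE ?exprn_gt0 ?mulr_gt0// lerXn2r// ?nnegrE; nra.
have E3 : s ^- 4 <= 3 * ((oneDsqr y.1)^-1 * (oneDsqr y.2)^-1).
  have U0 : 0 < oneDsqr y.1 * oneDsqr y.2.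
    by apply: mulr_gt0; exact: lt_le_trans ltr01 (oneDsqr_ge1 _).
  rewrite -invfM ler_pdivlMr// ler_pdivrMl ?exprn_gt0//.
  rewrite (_ : s ^+ 4 = (y.1 ^+ 2 + y.2 ^+ 2) ^+ 2); last by rewrite -ss -exprM.
  have s2' : 1 <= y.1 ^+ 2 + y.2 ^+ 2 by rewrite -ss expr_ge1//; lra.
  rewrite /oneDsqr.
  have := sqr_ge0 y.1; have := sqr_ge0 y.2.
  move: (y.1 ^+ 2) (y.2 ^+ 2) s2' => u v uv v0 u0; nra.
rewrite E1; apply: (@le_trans _ _ (K / n%:R * (c ^- 4 * s ^- 4))).
  by rewrite -invfM -exprMn ler_wpM2l// divr_ge0// ltW.
rewrite (_ : tail_mass r rho / n%:R * _ =
    K / n%:R * (c ^- 4 * (3 * ((oneDsqr y.1)^-1 * (oneDsqr y.2)^-1)))).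
  by rewrite ler_wpM2l ?divr_ge0 ?(ltW K0)// ler_wpM2l// invr_ge0 exprn_ge0// ltW.
by rewrite /tail_mass -/c -/K; ring.
Qed.

Lemma integral_hitp_le n r rho : (0 < n)%N -> 0 < r -> r < rho -> 1 <= rho ->
  (\int[@leb2 R]_x (hit (ballh r n) n x)%:E <=
   (n%:R * survival p n * (pi * rho ^+ 2) + tail_mass r rho * pi ^+ 2)%:E)%E.
Proof.
move=> n0 r0 rrho rho1; set a := Num.sqrt n%:R.
have n0r : 0 < n%:R :> R by rewrite ltr0n.
have a0 : a != 0 by rewrite gt_eqF// sqrtr_gt0.
have aa : a ^+ 2 = n%:R by rewrite sqr_sqrtr.
have mB := @measurable_eball R (0, 0) (r * a).
have mh := hitp_measurable hp_ge0 hp_sum P hX0_meas n mB.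
have h01 x := hitp_itv hp_ge0 hp_sum P hX0_meas n x mB.
have /andP[sv0 sv1] := survival_itv hp_ge0 hp_sum n.
have D0 := tail_mass_ge0 r rho.
have Dn0 : 0 <= tail_mass r rho / n%:R by rewrite divr_ge0.
have g0 (y : R * R) : 0 <= (oneDsqr y.1)^-1 * (oneDsqr y.2)^-1.
  by apply: mulr_ge0; rewrite invr_ge0 (le_trans ler01 (oneDsqr_ge1 _)).
rewrite (@integral_dilation _ a)//; last 2 first.
- exact/measurable_EFinP.
- by move=> x; rewrite lee_fin; case/andP: (h01 x).
have mg : measurable_fun (setT : set (measurableTypeR R * measurableTypeR R))
    (fun y => (oneDsqr y.1)^-1 * (oneDsqr y.2)^-1).
  have m1 : measurable_fun (setT : set (measurableTypeR R)) (fun x : R => (oneDsqr x)^-1).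
    by apply: continuous_measurable_fun; exact: continuous_oneDsqrV.
  apply: measurable_funM; first exact: (measurableT_comp m1 measurable_fst).
  exact: (measurableT_comp m1 measurable_snd).
have mi : measurable_fun (setT : set (measurableTypeR R * measurableTypeR R))
    (\1_(eball (0, 0) rho) : R * R -> R).
  by apply: measurable_indic; exact: measurable_eball.
have Z1 : (\int[@leb2 R]_x ((survival p n)%:E * (\1_(eball (0, 0)%R rho) x)%:E) =
    (survival p n * (pi * rho ^+ 2))%:E)%E.
  have disk : @leb2 R (eball (0, 0) rho) = (\int[@leb2 R]_x (\1_(eball (0, 0)%R rho) x)%:E)%E.
    rewrite (@integral_indic _ _ _ (lebesgue_measure \x lebesgue_measure)%E setT measurableT) ?setIT//.
    exact: measurable_eball.
  rewrite EFinM -leb2_disk; last lra.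
  rewrite disk.
  apply: (@ge0_integralZl _ _ _ (lebesgue_measure \x lebesgue_measure)%E setT measurableT
    (fun x => (\1_(eball (0, 0)%R rho) x)%:E)).
  - exact/measurable_EFinP.
  - by move=> x _; rewrite lee_fin.
  - by rewrite lee_fin.
have Z2 : (\int[@leb2 R]_x ((tail_mass r rho / n%:R)%:E * ((oneDsqr x.1)^-1 * (oneDsqr x.2)^-1)%:E) =
    (tail_mass r rho / n%:R * pi ^+ 2)%:E)%E.
  rewrite [RHS]EFinM -integral_oneDsqr2.
  apply: (@ge0_integralZl _ _ _ (lebesgue_measure \x lebesgue_measure)%E setT measurableT
    (fun x => ((oneDsqr x.1)^-1 * (oneDsqr x.2)^-1)%:E)).
  - exact/measurable_EFinP.
  - by move=> x _; rewrite lee_fin g0.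
  - by rewrite lee_fin Dn0.
have bound : (\int[@leb2 R]_x (hit (ballh r n) n (a * x.1, a * x.2)%R)%:E <=
    (survival p n * (pi * rho ^+ 2) + tail_mass r rho / n%:R * pi ^+ 2)%:E)%E.
  apply: (@le_trans _ _ (\int[@leb2 R]_x ((survival p n)%:E * (\1_(eball (0, 0)%R rho) x)%:E +
    (tail_mass r rho / n%:R)%:E * ((oneDsqr x.1)^-1 * (oneDsqr x.2)^-1)%:E))%E).
    apply: (@ge0_le_integral_nomeas _ _ _ (lebesgue_measure \x lebesgue_measure)%E) => x; first by rewrite lee_fin; case/andP: (h01 (a * x.1, a * x.2)).
    by rewrite -!EFinM -EFinD lee_fin; exact: hitp_rescaled_le.
  rewrite (@ge0_integralD _ _ _ (lebesgue_measure \x lebesgue_measure)%E setT measurableT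
    (fun x => (survival p n)%:E * (\1_(eball (0, 0)%R rho) x)%:E)%E
    (fun x => (tail_mass r rho / n%:R)%:E * ((oneDsqr x.1)^-1 * (oneDsqr x.2)^-1)%:E)%E); last 4 first.
  - by move=> x _; apply: mule_ge0; rewrite lee_fin.
  - by apply: emeasurable_funM => //; exact/measurable_EFinP.
  - by move=> x _; apply: mule_ge0; rewrite lee_fin ?g0 ?Dn0.
  - by apply: emeasurable_funM => //; exact/measurable_EFinP.
  by rewrite [X in (_ <= X)%E]EFinD; apply: leeD; rewrite le_eqVlt; apply/orP; left; apply/eqP; [exact: Z1|exact: Z2].
apply: (le_trans (lee_wpmul2l _ bound)); first by rewrite lee_fin sqr_ge0.
rewrite -EFinM lee_fin aa le_eqVlt; apply/orP; left; apply/eqP; field; exact: lt0r_neq0.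
Qed.

Lemma integral_hitp_fin n r : (0 < n)%N -> 0 < r ->
  (\int[@leb2 R]_x (hit (ballh r n) n x)%:E < +oo)%E.
Proof.
move=> n0 r0; apply: (le_lt_trans (@integral_hitp_le n r (r + 1) n0 r0 _ _)); rewrite ?ltry//; lra.
Qed.

(** The first term pays for replacing [r] by [max r 1], the [1] for the error in the survival
    asymptotics, [tail_mass] for the exterior; [e^-1] forces the divergence at 0. *)
Definition clearing_const (e : R) : R :=
  2 * pi * (1 + e) / s2 + 1 + tail_mass 1 (Num.sqrt (1 + e)) * pi ^+ 2 + e^-1.

(** Splitting at [rho = sqrt (1 + e) r] makes [r / rho], hence the tail mass, depend on [e] alone;
    [1 <= r] ensures [1 <= rho]. *)
Lemma integral_hitp_asymptotic r e : 1 <= r -> 0 < e ->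
  \forall n \near \oo, (\int[@leb2 R]_x (hit (ballh r n) n x)%:E <=
    (2 * pi * (1 + e) * r ^+ 2 / s2 + 1 + tail_mass 1 (Num.sqrt (1 + e)) * pi ^+ 2)%:E)%E.
Proof.
move=> r1 e0; have r0 : 0 < r by lra.
have e1 : 1 < Num.sqrt (1 + e) by rewrite -[ltLHS]sqrtr1 ltr_sqrt; lra.
have ee : Num.sqrt (1 + e) ^+ 2 = 1 + e by rewrite sqr_sqrtr//; lra.
pose w := pi * ((1 + e) * r ^+ 2) : R.
have w0 : 0 < w by rewrite /w !mulr_gt0 ?pi_gt0 ?exprn_gt0//; lra.
(* The survival error [1 / w] is multiplied by the area [w] of the disc of radius [rho], so it
   contributes exactly 1. *)
have [N _ HN] := survival_asymptotic hp_ge0 hp_sum hp_mean hp1 hp_var (divr_gt0 ltr01 w0).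
exists (maxn N 1) => // n /=; rewrite geq_max => /andP[Nn n0].
apply: (le_trans (@integral_hitp_le n r (Num.sqrt (1 + e) * r) n0 r0 _ _)).
- by rewrite ltr_pMl.
- by rewrite -[leLHS]mulr1 ler_pM// ltW.
rewrite lee_fin; apply: lerD; last first.
  by rewrite /tail_mass (_ : r / (Num.sqrt (1 + e) * r) = 1 / Num.sqrt (1 + e))//; field;
    rewrite !gt_eqF//; lra.
have := HN _ Nn; rewrite /= -(ler_pM2r w0) mulrDl divfK ?gt_eqF// => H.
rewrite exprMn ee -/w; apply: (le_trans H); rewrite lerD2r le_eqVlt /w; apply/orP; left; apply/eqP.
by ring.
Qed.
Lemma clearing_const_gt0 e : 0 < e -> 0 < clearing_const e.
Proof.
move=> e0; have s20 := offspring_var_gt0 hp_ge0 hp_sum hp_mean hp1 hp_var.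
have := mulr_ge0 (tail_mass_ge0 1 (Num.sqrt (1 + e))) (exprn_ge0 2 (@pi_ge0 R)).
have : 0 < e^-1 by rewrite invr_gt0.
have : 0 < 2 * pi * (1 + e) / s2 by rewrite divr_gt0// !mulr_gt0 ?pi_gt0//; lra.
rewrite /clearing_const; lra.
Qed.

Lemma clearing_const_cvgy : clearing_const e @[e --> 0^'+] --> +oo.
Proof.
have s20 := offspring_var_gt0 hp_ge0 hp_sum hp_mean hp1 hp_var.
apply/cvgryPge => A; near=> e.
have e0 : 0 < e by near: e; exact: nbhs_right_gt.
have eA : e < (`|A| + 1)^-1.
  by near: e; apply: nbhs_right_lt; rewrite invr_gt0 ltr_wpDl.
have := mulr_ge0 (tail_mass_ge0 1 (Num.sqrt (1 + e))) (exprn_ge0 2 (@pi_ge0 R)).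
have : 0 < 2 * pi * (1 + e) / s2 by rewrite divr_gt0// !mulr_gt0 ?pi_gt0//; lra.
have : `|A| + 1 < e^-1.
  by rewrite -[ltLHS]invrK ltf_pV2 ?posrE// invr_gt0 ltr_wpDl.
have := ler_norm A; rewrite /clearing_const; lra.
Unshelve. all: by end_near. Qed.

Context (xi : nat -> Omega -> (R * R)%type) (N : nat -> seq nat -> Omega -> nat)
  (X : nat -> seq nat -> Omega -> (R * R)%type).
Hypothesis hxi_meas : forall i, measurable_fun [set: Omega] (xi i).
Hypothesis hN_meas : forall i u, measurable_fun [set: Omega] (N i u).
Hypothesis hX_meas : forall i u, measurable_fun [set: Omega] (X i u).
Hypothesis hpoisson : poisson_lebesgue P xi.
Hypothesis hindep : mutually_independent P (ingredient xi N X).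
Hypothesis hN_law : forall i u k, P (N i u @^-1` [set k]) = (p k)%:E.
Hypothesis hX_law : forall i u A, measurable A -> P (X i u @^-1` A) = P (X0 @^-1` A).

Lemma clearing_probability n r : (0 < n)%N -> 0 < r ->
  P [set w | ((r * Num.sqrt n%:R)%:E <= Rn xi N X n w)%E] =
  (expR (- fine (\int[@leb2 R]_x (hit (ballh r n) n x)%:E)%E))%:E.
Proof.
move=> n0 r0; have a0 : 0 < r * Num.sqrt n%:R by rewrite mulr_gt0// sqrtr_gt0 ltr0n.
have mB := @measurable_eball R (0, 0) (r * Num.sqrt n%:R).
rewrite Rn_event//.
pose F K := \bigcap_(i in [set i | (i < K)%N]) misses xi N X (ballh r n) n i.
have FE : \bigcap_(i in [set: nat]) misses xi N X (ballh r n) n i = \bigcap_K F K.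
  apply/seteqP; split => w Hw; first by move=> K _ i _; exact: Hw.
  by move=> i _; exact: (Hw i.+1 I i (ltnSn i)).
have mF K : measurable (F K) by exact: misses_bigcap_measurable.
rewrite FE; apply: (@cvg_unique _ _ (P \o F @ \oo)) => //.
  apply: nonincreasing_cvg_mu => //.
  - by rewrite (le_lt_trans (probability_le1 P (mF 0%N)))// ltry.
  - exact: bigcap_measurableType.
  - move=> K L KL; apply/subsetPset => w Hw i /= iK; apply: Hw => /=; exact: leq_trans iK KL.
rewrite (_ : P \o F = fun K => (\int[P]_w (\prod_(i < K) (1 - hit (ballh r n) n (xi i w)))%:E)%E); last first.
  apply/funext => K /=.
  exact: (probability_misses hp_ge0 hp_sum hxi_meas hN_meas hX_meas hX0_meas hindep hN_law hX_law mB).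
apply: poisson_functional => //.
- exact: hitp_measurable.
- by move=> x; exact: hitp_itv.
- exact: integral_hitp_fin.
Qed.

Lemma clearing_lower_bound r e : 0 < r -> 0 < e ->
  ((expR (- (2 * pi * (1 + e) * r ^+ 2 / s2) - clearing_const e))%:E <=
   limn_einf (fun n => P [set w | ((r * Num.sqrt n%:R)%:E <= Rn xi N X n w)%E]))%E.
Proof.
move=> r0 e0; have s20 := offspring_var_gt0 hp_ge0 hp_sum hp_mean hp1 hp_var.
have e10 : 0 < e^-1 by rewrite invr_gt0.
have A0 : 0 < 2 * pi * (1 + e) / s2 by rewrite divr_gt0// !mulr_gt0 ?pi_gt0//; lra.
have T0 := mulr_ge0 (tail_mass_ge0 1 (Num.sqrt (1 + e))) (exprn_ge0 2 (@pi_ge0 R)).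
(* A larger radius gives a smaller event, and [r'^2 <= r^2 + 1] is paid for by [clearing_const]. *)
pose r' := Num.max r 1.
have r'1 : 1 <= r' by rewrite le_max lexx orbT.
have r'r : r <= r' by rewrite le_max lexx.
have [M _ HM] := integral_hitp_asymptotic r'1 e0.
apply: limn_einf_ge; exists (maxn M 1) => // n /=; rewrite geq_max => /andP[Mn n0].
have r'0 : 0 < r' by lra.
have mev t : 0 < t -> measurable [set w | ((t * Num.sqrt n%:R)%:E <= Rn xi N X n w)%E].
  move=> t0; rewrite Rn_event; last by rewrite mulr_gt0// sqrtr_gt0 ltr0n.
  by apply: misses_bigcap_measurable => //; exact: measurable_eball.
apply: (@le_trans _ _ (P [set w | ((r' * Num.sqrt n%:R)%:E <= Rn xi N X n w)%E])); last first.
  apply: le_measure; rewrite ?inE; [exact: mev|exact: mev|].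
  by move=> w /=; apply: le_trans; rewrite lee_fin ler_wpM2r// sqrtr_ge0.
rewrite clearing_probability// lee_fin ler_expR -opprD lerN2.
have h0 : (0 <= \int[@leb2 R]_x (hit (ballh r' n) n x)%:E)%E.
  apply: integral_ge0 => x _; rewrite lee_fin.
  by case/andP: (hitp_itv hp_ge0 hp_sum P hX0_meas n x (@measurable_eball R (0, 0) (r' * Num.sqrt n%:R))).
have hf := integral_hitp_fin n0 r'0.
have := HM n Mn; rewrite /= -[X in (X <= _)%E]fineK ?ge0_fin_numE// lee_fin.
move=> h; apply: (le_trans h); rewrite /clearing_const.
have -> : 2 * pi * (1 + e) * r ^+ 2 / s2 = (2 * pi * (1 + e) / s2) * r ^+ 2 by field; exact: lt0r_neq0.
have -> : 2 * pi * (1 + e) * r' ^+ 2 / s2 = (2 * pi * (1 + e) / s2) * r' ^+ 2 by field; exact: lt0r_neq0.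
have : r' ^+ 2 <= r ^+ 2 + 1.
  by rewrite /r' maxEle; case: ifP => _; have := sqr_ge0 r; rewrite ?expr1n; lra.
move: (2 * pi * (1 + e) / s2) A0 => A A0.
by move: (r' ^+ 2) (r ^+ 2) => y x xy; nra.
Qed.

End Clearing.

Lemma limn_esup_le {R : realType} (a : \bar R) (u : nat -> \bar R) :
  (\forall n \near \oo, (u n <= a)%E) -> (limn_esup u <= a)%E.
Proof.
move=> [N _ Nu]; rewrite limn_esup_lim (cvg_lim _ (cvg_esups_inf (u := u)))//.
apply: ge_ereal_inf; exists (esups u N); first by exists N.
by apply: ge_ereal_sup => _ [k Nk <-]; exact: Nu.
Qed.

(** Since [J] may be infinite, the limsup is written [expeR z] with [z] extended real; if [- z < J],
    some tail infimum of [I] exceeds [- z] and contradicts the choice of [z]. *)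
Lemma limn_esup_expeR_le {R : realType} (I u : nat -> \bar R) (J : \bar R) :
  (\forall n \near \oo, (0 <= I n)%E /\ u n = expeR (- I n)) -> (J <= limn_einf I)%E ->
  (limn_esup u <= expeR (- J))%E.
Proof.
move=> [M _ HM] JI.
have L0 : (0 <= limn_esup u)%E.
  apply: le_trans (limn_einf_sup u); apply: limn_einf_ge; exists M => // n Mn.
  by have [_ ->] := HM n Mn; exact: expeR_ge0.
have [z Lz] := expeR_total L0; rewrite -Lz lee_expeR leeNr leNgt; apply/negP => zJ.
have := lt_le_trans zJ JI; rewrite limn_einf_lim (cvg_lim _ (cvg_einfs_sup (u := I)))//.
move=> /ereal_sup_gt[_ [K _ <-] zK].
have : (limn_esup u <= expeR (- einfs I K))%E.
  apply: limn_esup_le; exists (maxn K M) => // n /=; rewrite geq_max => /andP[Kn Mn].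
  have [_ ->] := HM n Mn; rewrite lee_expeR leeN2; apply: ereal_inf_lbound; by exists n.
by rewrite -Lz lee_expeR leeNr leNgt zK.
Qed.

Lemma bump_continuous {R : realType} (r : R) (c : R * R) : continuous (bump r c).
Proof.
move=> y.
have gc : gap r c z @[z --> y] --> gap r c y.
  apply: cvgB; [apply: cvgB; first exact: cvg_cst|].
    apply: (@continuous_comp _ _ _ (fun z : R * R => z.1 - c.1) (fun t => t ^+ 2)).
      by apply: cvgB; [exact: cvg_fst|exact: cvg_cst].
    exact: exprn_continuous.
  apply: (@continuous_comp _ _ _ (fun z : R * R => z.2 - c.2) (fun t => t ^+ 2)).
    by apply: cvgB; [exact: cvg_snd|exact: cvg_cst].
  exact: exprn_continuous.
rewrite (_ : bump r c = fun z => ((gap r c z + `|gap r c z|) / 2) ^+ 3); last first.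
  apply/funext => z; rewrite /bump; congr (_ ^+ 3); rewrite maxEle; case: leP => h.
    by rewrite ger0_norm//; lra.
  by rewrite ltr0_norm//; lra.
apply: (@continuous_comp _ _ _ (fun z => (gap r c z + `|gap r c z|) / 2) (fun t => t ^+ 3)).
  by apply: cvgM; [apply: cvgD => //; exact: cvg_norm|exact: cvg_cst].
exact: exprn_continuous.
Qed.

(** * Void probabilities from Laplace functionals *)

Section Discs.
Context {R : realType} (r : R) (x : R * R).
Hypothesis r0 : 0 < r.

(** The bump has infimum 0 on [eball x r], but a positive floor on each of these smaller discs,
    which exhaust it. *)
Definition inner_radius j : R := r - r / j.+2%:R.
Definition inner_disc j : set (R * R) := eball x (inner_radius j).

Lemma inner_radius_itv j : 0 <= inner_radius j < r.
Proof.
have h : 0 < r / j.+2%:R by rewrite divr_gt0.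
have h2 : r / j.+2%:R <= r.
  by rewrite ler_pdivrMr//; have : 1 <= j.+2%:R :> R; [rewrite ler1n|move: r0; nra].
by rewrite /inner_radius subr_ge0 h2 gtrBl.
Qed.

Lemma inner_disc_nondecreasing : nondecreasing_seq inner_disc.
Proof.
move=> i j ij; apply/subsetPset => y; rewrite /inner_disc /eball /= => h.
apply: (lt_le_trans h); rewrite /inner_radius lerD2l lerN2 ler_pM2l//.
by rewrite lef_pV2 ?posrE// ler_nat.
Qed.

Lemma bigcup_inner_disc : \bigcup_j inner_disc j = eball x r.
Proof.
apply/seteqP; split => y.
  by move=> [j _]; rewrite /inner_disc /eball /= => h; case/andP: (inner_radius_itv j) => _; lra.
rewrite /eball /= => h; set s := Num.sqrt _ in h *.
have rs : 0 < r - s by lra.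
have [j _ Hj] := nbhs_infty_gtr (r / (r - s)); exists j => //.
rewrite /inner_disc /eball /= -/s /inner_radius.
suff h2 : r / j.+2%:R < r - s by move: (r / j.+2%:R) h2 => q; lra.
have := Hj j (leqnn j); rewrite /= ltr_pdivrMr// => rj.
rewrite ltr_pdivrMr// -addn2 natrD; nra.
Qed.

Definition bump_floor j : R := (r ^+ 2 - inner_radius j ^+ 2) ^+ 3.

Lemma bump_floor_gt0 j : 0 < bump_floor j.
Proof.
by case/andP: (inner_radius_itv j) => a b; rewrite exprn_gt0// subr_gt0 ltr_pXn2r// ?nnegrE// ltW.
Qed.

Lemma bump_floor_le j y : inner_disc j y -> bump_floor j <= bump r x y.
Proof.
rewrite /inner_disc /eball /= => h; case/andP: (inner_radius_itv j) => a b.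
have e0 : 0 <= (y.1 - x.1) ^+ 2 + (y.2 - x.2) ^+ 2 by rewrite addr_ge0 ?sqr_ge0.
have h2 : (y.1 - x.1) ^+ 2 + (y.2 - x.2) ^+ 2 <= inner_radius j ^+ 2.
  by rewrite -[leLHS](sqr_sqrtr e0) ler_pXn2r// ?nnegrE ?sqrtr_ge0// ltW.
have c0 : inner_radius j ^+ 2 <= r ^+ 2 by rewrite ler_pXn2r// ?nnegrE// ltW.
apply: (@le_trans _ _ (gap r x y ^+ 3)); last first.
  have g0 : 0 <= gap r x y by rewrite /gap; lra.
  by rewrite /bump maxEle g0.
by rewrite /bump_floor ler_pXn2r// ?nnegrE /gap; lra.
Qed.

End Discs.

Section VoidProbability.
Context {R : realType} (r l : R) (x : R * R).
Hypothesis r0 : 0 < r.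
Context {d' : measure_display} {Omega' : measurableType d'} (P' : probability Omega' R).
Context (Y : Omega' -> {finite_measure set (R * R)%type -> \bar R}).
Hypothesis mY : forall A, measurable A -> measurable_fun [set: Omega'] (fun w => Y w A).
Hypothesis laplace_ge : forall t, 0 <= t ->
  ((expR (- l))%:E <= \int[P']_w expeR (- \int[Y w]_y (t * bump r x y)%:E))%E.

Let B j := inner_disc r x j.
Let mB j : measurable (B j). Proof. exact: measurable_eball. Qed.
Let g j w : R := expR (- (j%:R * fine (Y w (B j)))).

Let mg j : measurable_fun setT (g j).
Proof.
apply: (measurableT_comp (@measurable_expR R)).
apply: measurableT_comp => //; apply: measurable_funM => //.
exact: (measurableT_comp (@fine_measurable R setT measurableT) (mY (mB j))).
Qed.

Let Yfin w A : measurable A -> Y w A \is a fin_num.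
Proof. by move=> mA; exact: fin_num_measure. Qed.

Let laplace_le_g j w :
  (expeR (- \int[Y w]_y ((j%:R / bump_floor r j) * bump r x y)%:E) <= (g j w)%:E)%E.
Proof.
have m0 := bump_floor_gt0 r0 j.
have -> : (g j w)%:E = expeR (- (j%:R%:E * Y w (B j))).
  by rewrite -(fineK (Yfin w (mB j))) -EFinM.
rewrite lee_expeR leeN2.
have -> : (j%:R%:E * Y w (B j) = \int[Y w]_y (j%:R%:E * (\1_(B j) y)%:E))%E.
  rewrite ge0_integralZl//; last first.
    by apply/measurable_EFinP; exact: measurable_indic.
  by rewrite integral_indic// setIT.
apply: ge0_le_integral_nomeas => y; first by rewrite mule_ge0// lee_fin.
rewrite -EFinM lee_fin indicE; have [yB|yB] := boolP (y \in B j); last first.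
  rewrite mulr0 mulr_ge0 ?divr_ge0//; first exact: ltW.
  by rewrite /bump exprn_ge0// le_max lexx.
rewrite mulr1 -mulrA ler_peMr// mulrC ler_pdivlMr// mul1r.
by apply: bump_floor_le => //; exact: set_mem.
Qed.

Let g_cvg w : (fun j => (g j w)%:E) @ \oo --> (\1_[set w | Y w (eball x r) = 0%E] w)%:E.
Proof.
apply: cvg_EFin; first exact: nearW.
have mE : measurable (eball x r) by exact: measurable_eball.
rewrite indicE; have [Yw|Yw] := boolP (w \in _).
  have {}Yw := set_mem Yw; rewrite (_ : fine \o _ = fun=> 1); first exact: cvg_cst.
  apply/funext => j /=; rewrite /g (_ : Y w (B j) = 0%E) ?mulr0 ?oppr0 ?expR0//.
  apply/eqP; rewrite eq_le measure_ge0 andbT -Yw le_measure ?inE//.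
  by rewrite -(bigcup_inner_disc x r0); exact: bigcup_sup.
have cvB : Y w \o B @ \oo --> Y w (eball x r).
  rewrite -(bigcup_inner_disc x r0); apply: nondecreasing_cvg_mu => //.
    by rewrite bigcup_inner_disc.
  exact: inner_disc_nondecreasing.
set b := fine (Y w (eball x r)).
have b0 : 0 < b.
  rewrite /b fine_gt0//; apply/andP; split; last by rewrite -ge0_fin_numE// Yfin.
  rewrite lt_def measure_ge0 andbT; apply/eqP => Y0.
  by move/negP: Yw; apply; rewrite inE.
have cvf : (fun j => fine (Y w (B j))) @ \oo --> b.
  by apply: fine_cvg; rewrite fineK ?Yfin.
have cvy : (fun j => j%:R * fine (Y w (B j))) @ \oo --> +oo.
  apply/cvgryPge => A; near=> j.
  have fb : b / 2 <= fine (Y w (B j)).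
    near: j; apply: (cvgr_ge _ cvf); lra.
  have jA : `|A| / (b / 2) <= j%:R by near: j; exact: nbhs_infty_ger.
  rewrite ler_pdivrMr ?divr_gt0// in jA.
  apply: (le_trans (ler_norm A)); apply: (le_trans jA).
  by rewrite ler_wpM2l.
exact: (cvg_comp _ _ cvy (@cvgr_expR R)).
Unshelve. all: by end_near. Qed.

(** Taking [t = j / bump_floor j] makes the test function at least [j] on the inner disc [B j].
    Height and disc grow together, and [exp (- j Y(B j))] tends to the indicator of the void event,
    by continuity of [Y] from below. *)
Lemma void_probability_ge : ((expR (- l))%:E <= P' [set w | Y w (eball x r) = 0])%E.
Proof.
have mE : measurable [set w | Y w (eball x r) = 0%E].
  have := mY (@measurable_eball R x r) measurableT (emeasurable_set1 0%E); by rewrite setTI.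
have -> : P' [set w | Y w (eball x r) = 0%E] = (\int[P']_w (\1_[set w | Y w (eball x r) = 0%E] w)%:E)%E.
  by rewrite integral_indic// setIT.
have lim : (fun j => \int[P']_w (g j w)%:E)%E @ \oo -->
    (\int[P']_w (\1_[set w | Y w (eball x r) = 0%E] w)%:E)%E.
  have [|||||_ _] := @dominated_convergence _ _ _ P' setT measurableT (fun j w => (g j w)%:E)
    (fun w => (\1_[set w | Y w (eball x r) = 0%E] w)%:E) (cst 1%E); last by [].
  - by move=> j; exact/measurable_EFinP.
  - by apply/measurable_EFinP; exact: measurable_indic.
  - by apply: aeW => w _; exact: g_cvg.
  - exact: finite_measure_integrable_cst.
  - apply: aeW => w j _ /=; rewrite lee_fin ger0_norm ?expR_ge0//.
    by rewrite -expR0 ler_expR oppr_le0 mulr_ge0// fine_ge0.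
rewrite -(cvg_lim _ lim)//; apply: lime_ge; first by apply/cvg_ex; eexists; exact: lim.
apply: nearW => j; have m0 := bump_floor_gt0 r0 j.
have t0 : 0 <= j%:R / bump_floor r j by rewrite divr_ge0// ltW.
apply: (le_trans (laplace_ge t0)); apply: ge0_le_integral_nomeas => w; first exact: expeR_ge0.
exact: laplace_le_g.
Qed.

End VoidProbability.

Lemma eln_le0 {R : realType} (a : \bar R) : (a <= 1)%E -> (eln a <= 0)%E.
Proof.
rewrite /eln; case: ifP => // a0 a1; rewrite lee_fin; apply: ln_le0.
by move: a a0 a1 => [t| |] /=; rewrite ?ltxx// lee_fin.
Qed.

(** * The upper bound *)

Section UpperBound.
Context {R : realType} (p : nat -> R) (s2 : R).
Hypothesis hp_ge0 : forall k, 0 <= p k.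
Hypothesis hp_sum : (fun n => \sum_(0 <= k < n) p k) @ \oo --> (1 : R).
Hypothesis hp1 : p 1%N < 1.
Hypothesis hp_mean : (fun n => \sum_(0 <= k < n) (k%:R * p k)) @ \oo --> (1 : R).
Hypothesis hp_var : (fun n => \sum_(0 <= k < n) (k%:R ^+ 2 * p k)) @ \oo --> s2 + 1.
Context {d : measure_display} {Omega : measurableType d} (P : probability Omega R).
Context (X0 : Omega -> (R * R)%type).
Hypothesis hX0_meas : measurable_fun [set: Omega] X0.
Hypothesis hX0_m4 : (\int[P]_w ((((X0 w).1 ^+ 2 + (X0 w).2 ^+ 2) ^+ 2)%:E) < +oo)%E.
Hypothesis hX0_mean1 : (\int[P]_w ((X0 w).1)%:E = 0)%E.
Hypothesis hX0_mean2 : (\int[P]_w ((X0 w).2)%:E = 0)%E.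
Hypothesis hX0_cov11 : (\int[P]_w (((X0 w).1 ^+ 2)%:E) = 1)%E.
Hypothesis hX0_cov22 : (\int[P]_w (((X0 w).2 ^+ 2)%:E) = 1)%E.
Hypothesis hX0_cov12 : (\int[P]_w (((X0 w).1 * (X0 w).2)%:E) = 0)%E.
Context (r : R).
Hypothesis r0 : 0 < r.
Context {d' : measure_display} {Omega' : measurableType d'} (P' : probability Omega' R).
Context (Y : Omega' -> {finite_measure set (R * R)%type -> \bar R}).
Hypothesis hY : sbm_time1_from_delta0 P' s2 Y.

Local Notation hit n := (hitp p P X0 (eball (0, 0) (r * Num.sqrt n%:R)) n).
Let scaled_hit n (x : R * R) : R := n%:R * hit n (rescale (Num.sqrt n%:R) x (0, 0)).
Let void x := P' [set w | Y w (eball x r) = 0%E].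

Let hit_itv n x : 0 <= hit n x <= 1.
Proof. by apply: hitp_itv => //; exact: measurable_eball. Qed.

Let scaled_hit_ge0 n x : 0 <= scaled_hit n x.
Proof. by rewrite /scaled_hit mulr_ge0//; case/andP: (hit_itv n (rescale (Num.sqrt n%:R) x (0, 0))). Qed.

Lemma eln_void_le x : (- eln (void x) <= limn_einf (fun n => (scaled_hit n x)%:E))%E.
Proof.
have lim0 : (0 <= limn_einf (fun n => (scaled_hit n x)%:E))%E.
  by apply: limn_einf_ge; apply: nearW => n; rewrite lee_fin.
have lim_ge a : (\forall n \near \oo, a <= scaled_hit n x) ->
    (a%:E <= limn_einf (fun n => (scaled_hit n x)%:E))%E.
  by move=> h; apply: limn_einf_ge; apply: filterS h => n; rewrite lee_fin.
move: lim0 lim_ge; case: (limn_einf _) => [l l0 lim_ge|_ _|//]; last by rewrite leey.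
(* An infinite liminf leaves nothing to prove; a finite one, [l], bounds [u 1 (0, 0)] for every
   height [t] at once, so the limit in [t] follows the limit in [n] without any uniformity. *)
have vge : ((expR (- l))%:E <= void x)%E.
  apply: (void_probability_ge r0 hY.1) => t t0.
  have [K HK] := C21_bump x r0.
  have supp (y : R * R) : 0 < t * bump r x y -> eball x r y.
    move=> ty; have : y \in eball x r; last by rewrite inE.
    rewrite -(bump_gt0 x y r0) lt_neqAle; apply/andP; split; last first.
      by rewrite /bump exprn_ge0// le_max lexx.
    by apply/eqP => b0; move: ty; rewrite -b0 mulr0 ltxx.
  have [u Hu uhit] := hit_liminf_pde hp_ge0 hp_sum hp1 hp_mean hp_var hX0_meas hX0_m4
    hX0_mean1 hX0_mean2 hX0_cov11 hX0_cov22 hX0_cov12 r0 (C21_scale t0 HK) supp.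
  have ul : u 1 (0, 0) <= l.
    apply/ler_addgt0Pr => e e0; rewrite -lerBlDr -lee_fin; apply: lim_ge; exact: uhit.
  have b0 y : 0 <= t * bump r x y by rewrite mulr_ge0// /bump exprn_ge0// le_max lexx.
  have bM : exists M, forall y, t * bump r x y <= M.
    exists (t * r ^+ 6) => y; have /andP[_] := C21_val HK y; exact: ler_wpM2l.
  have bC : continuous (fun y => t * bump r x y).
    by move=> y; apply: cvgM; [exact: cvg_cst|exact: bump_continuous].
  by rewrite (hY.2 _ bC b0 bM u Hu) lee_fin ler_expR lerN2.
have vfin : void x \is a fin_num.
  rewrite ge0_fin_numE ?measure_ge0//; apply: (@le_lt_trans _ _ 1%E); last by rewrite ltry.
  apply: probability_le1.
  have := hY.1 _ (@measurable_eball R x r) measurableT _ (emeasurable_set1 0%E); by rewrite setTI.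
have fge : expR (- l) <= fine (void x) by rewrite -lee_fin fineK.
have f0 : 0 < fine (void x) by exact: lt_le_trans (expR_gt0 _) fge.
by rewrite /eln f0 -EFinN lee_fin lerNl -(expRK (- l)) ler_ln// posrE expR_gt0.
Qed.

Context (xi : nat -> Omega -> (R * R)%type) (N : nat -> seq nat -> Omega -> nat)
  (X : nat -> seq nat -> Omega -> (R * R)%type).
Hypothesis hxi_meas : forall i, measurable_fun [set: Omega] (xi i).
Hypothesis hN_meas : forall i u, measurable_fun [set: Omega] (N i u).
Hypothesis hX_meas : forall i u, measurable_fun [set: Omega] (X i u).
Hypothesis hpoisson : poisson_lebesgue P xi.
Hypothesis hindep : mutually_independent P (ingredient xi N X).
Hypothesis hN_law : forall i u k, P (N i u @^-1` [set k]) = (p k)%:E.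
Hypothesis hX_law : forall i u A, measurable A -> P (X i u @^-1` A) = P (X0 @^-1` A).

Let mscaled n : measurable_fun (setT : set (measurableTypeR R * measurableTypeR R)) (scaled_hit n).
Proof.
apply: measurable_funM => //.
have mh := hitp_measurable hp_ge0 hp_sum P hX0_meas n (@measurable_eball R (0, 0) (r * Num.sqrt n%:R)).
have mr : measurable_fun (setT : set (R * R)) (fun x : R * R => rescale (Num.sqrt n%:R) x (0, 0)).
  apply: measurable_fun_pair; apply: measurable_funM => //; apply: measurable_funB => //=.
exact: (measurableT_comp mh mr).
Qed.

Let integral_scaled_hit n : (0 < n)%N ->
  (\int[@leb2 R]_x (scaled_hit n x)%:E = \int[@leb2 R]_x (hit n x)%:E)%E.
Proof.
move=> n0; set a := Num.sqrt n%:R.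
have an0 : - a != 0 by rewrite oppr_eq0 gt_eqF// sqrtr_gt0 ltr0n.
have mh := hitp_measurable hp_ge0 hp_sum P hX0_meas n (@measurable_eball R (0, 0) (r * a)).
rewrite [RHS](@integral_dilation _ (- a))//; last 2 first.
- exact/measurable_EFinP.
- by move=> x; rewrite lee_fin; case/andP: (hit_itv n x).
rewrite sqrrN sqr_sqrtr//.
have hE x : hit n (- a * x.1, - a * x.2) = hit n (rescale a x (0, 0)).
  by rewrite /rescale /= !sub0r !mulrN !mulNr.
under [in RHS]eq_integral do rewrite hE.
transitivity (\int[@leb2 R]_x (n%:R%:E * (hit n (rescale a x (0, 0)%R))%:E))%E.
  by apply: eq_integral => x _; rewrite -EFinM.
apply: (@ge0_integralZl _ _ _ (lebesgue_measure \x lebesgue_measure)%E setT measurableT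
  (fun x => (hit n (rescale a x (0, 0)%R))%:E)).
- apply/measurable_EFinP.
  have nz : n%:R != 0 :> R by rewrite pnatr_eq0 -lt0n.
  rewrite (_ : (fun _ => _) = fun x => n%:R^-1 * scaled_hit n x); last first.
    by apply/funext => x; rewrite /scaled_hit mulKf.
  by apply: measurable_funM.
- by move=> x _; rewrite lee_fin; case/andP: (hit_itv n (rescale a x (0, 0))).
- by rewrite lee_fin.
Qed.

Lemma clearing_upper_bound :
  (limn_esup (fun n => P [set w | ((r * Num.sqrt n%:R)%:E <= Rn xi N X n w)%E])
   <= expeR (\int[@leb2 R]_x eln (void x)))%E.
Proof.
have v1 x : (void x <= 1)%E.
  apply: probability_le1.
  have := hY.1 _ (@measurable_eball R x r) measurableT _ (emeasurable_set1 0%E); by rewrite setTI.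
have neg x : ((fun x => eln (void x)) ^\- x = - eln (void x))%E.
  by rewrite funenegE; apply/max_idPl; rewrite leeNr oppe0 eln_le0.
(* The integrand is nonpositive, so by definition its integral is minus that of its negative part;
   this avoids asking for measurability in [x]. *)
have -> : (\int[@leb2 R]_x eln (void x) = - \int[@leb2 R]_x (- eln (void x)))%E.
  pose f x := eln (void x).
  have I0 : (\int[@leb2 R]_x (f ^\+ x) = 0)%E.
    by apply: integral0_eq => x _; rewrite funeposE; apply/max_idPr; exact: eln_le0.
  have I1 : (\int[@leb2 R]_x (f ^\- x) = \int[@leb2 R]_x (- eln (void x)))%E.
    by apply: eq_integral => x _; exact: neg.
  transitivity (\int[@leb2 R]_x (f ^\+ x) - \int[@leb2 R]_x (f ^\- x))%E.
    exact: (@integralE _ _ _ (lebesgue_measure \x lebesgue_measure)%E).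
  by rewrite I0 I1 sub0e.
apply: (limn_esup_expeR_le (I := fun n => (\int[@leb2 R]_x (scaled_hit n x)%:E)%E)).
  exists 1%N => // n /= n0; split; first by apply: integral_ge0 => x _; rewrite lee_fin.
  rewrite integral_scaled_hit//.
  rewrite (clearing_probability hp_ge0 hp_sum hp1 hp_mean hX0_meas hX0_m4
    hX0_mean1 hX0_mean2 hX0_cov11 hX0_cov22 hX0_cov12 hxi_meas hN_meas hX_meas hpoisson
    hindep hN_law hX_law n0 r0).
  have hf := integral_hitp_fin hp_ge0 hp_sum hp1 hp_mean hX0_meas hX0_m4
    hX0_mean1 hX0_mean2 hX0_cov11 hX0_cov22 hX0_cov12 n0 r0.
  rewrite -[in RHS](fineK (x := \int[@leb2 R]_x (hit n x)%:E)%E)// ge0_fin_numE//.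
  by apply: integral_ge0 => x _; rewrite lee_fin; case/andP: (hit_itv n x).
apply: (@le_trans _ _ (\int[@leb2 R]_x limn_einf (fun n => (scaled_hit n x)%:E))%E).
  apply: (@ge0_le_integral_nomeas _ _ _ (lebesgue_measure \x lebesgue_measure)%E) => x.
    by rewrite leeNr oppe0 eln_le0.
  exact: eln_void_le.
apply: (@fatou _ _ _ (lebesgue_measure \x lebesgue_measure)%E setT measurableT
  (fun n x => (scaled_hit n x)%:E)) => [n|n x _]; last by rewrite lee_fin.
exact/measurable_EFinP.
Qed.

End UpperBound.

Unset Implicit Arguments. Set Strict Implicit.

Theorem theorem1p2
  (R : realType)
  (* offspring distribution {p_k}, critical (m = 1), variance s2 < oo *)
  (p : nat -> R) (s2 : R)
  (hp_ge0 : forall k, 0 <= p k)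
  (hp_sum : (fun n => \sum_(0 <= k < n) p k) @ \oo --> (1 : R))
  (hp0 : p 0%N < 1) (hp1 : p 1%N < 1)
  (hp_mean : (fun n => \sum_(0 <= k < n) (k%:R * p k)) @ \oo --> (1 : R))
  (hp_var : (fun n => \sum_(0 <= k < n) (k%:R ^+ 2 * p k)) @ \oo --> s2 + 1)
  (* the underlying probability space *)
  (d : measure_display) (Omega : measurableType d) (P : probability Omega R)
  (* initial Poisson points, offspring numbers, displacements (indexed by the
     initial particle and an Ulam-Harris word), and a generic copy X0 of X *)
  (xi : nat -> Omega -> (R * R)%type)
  (N : nat -> seq nat -> Omega -> nat)
  (X : nat -> seq nat -> Omega -> (R * R)%type)
  (X0 : Omega -> (R * R)%type)
  (hxi_meas : forall i, measurable_fun [set: Omega] (xi i))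
  (hN_meas : forall i u, measurable_fun [set: Omega] (N i u))
  (hX_meas : forall i u, measurable_fun [set: Omega] (X i u))
  (hX0_meas : measurable_fun [set: Omega] X0)
  (hpoisson : poisson_lebesgue P xi)
  (hindep : mutually_independent P (fun j => match j with
       | IPP => <<s \bigcup_(i in [set: nat]) preimages (xi i) >>
       | IOff i u => preimages (N i u)
       | IDisp i u => preimages (X i u) end))
  (hN_law : forall i u k, P (N i u @^-1` [set k]) = (p k)%:E)
  (hX_law : forall i u A, measurable A -> P (X i u @^-1` A) = P (X0 @^-1` A))
  (* components of X are i.i.d. *)
  (hX0_indep : forall A B : set R, measurable A -> measurable B ->
     P (X0 @^-1` (A `*` B)) = (P (X0 @^-1` (A `*` [set: R])) * P (X0 @^-1` ([set: R] `*` B)))%E)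
  (hX0_ident : forall A : set R, measurable A ->
     P (X0 @^-1` (A `*` [set: R])) = P (X0 @^-1` ([set: R] `*` A)))
  (* E|X|^4 < oo *)
  (hX0_m4 : (\int[P]_w ((((X0 w).1 ^+ 2 + (X0 w).2 ^+ 2) ^+ 2)%:E) < +oo)%E)
  (* mean zero *)
  (hX0_mean1 : (\int[P]_w ((X0 w).1)%:E = 0)%E)
  (hX0_mean2 : (\int[P]_w ((X0 w).2)%:E = 0)%E)
  (* covariance matrix = identity *)
  (hX0_cov11 : (\int[P]_w (((X0 w).1 ^+ 2)%:E) = 1)%E)
  (hX0_cov22 : (\int[P]_w (((X0 w).2 ^+ 2)%:E) = 1)%E)
  (hX0_cov12 : (\int[P]_w (((X0 w).1 * (X0 w).2)%:E) = 0)%E) :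
  exists C : R -> R,
    (forall e, 0 < e -> 0 < C e) /\
    C e @[e --> 0^'+] --> +oo /\
    forall r delta : R, 0 < r -> 0 < delta ->
      ((expR (- (2 * pi * (1 + delta) * r ^+ 2 / s2) - C delta))%:E
         <= limn_einf (fun n => P [set w | (r * Num.sqrt n%:R)%:E <= Rn xi N X n w]))%E /\
      (limn_einf (fun n => P [set w | (r * Num.sqrt n%:R)%:E <= Rn xi N X n w])
         <= limn_esup (fun n => P [set w | (r * Num.sqrt n%:R)%:E <= Rn xi N X n w]))%E /\
      (forall (d' : measure_display) (Omega' : measurableType d')
              (P' : probability Omega' R)
              (Y : Omega' -> {finite_measure set (R * R)%type -> \bar R}),
         sbm_time1_from_delta0 P' s2 Y ->
         (limn_esup (fun n => P [set w | (r * Num.sqrt n%:R)%:E <= Rn xi N X n w])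
          <= expeR (\int[@leb2 R]_x eln (P' [set w | Y w (eball x r) = 0%E])))%E).
Proof.
have indep : mutually_independent P (ingredient xi N X) := hindep.
exists (@clearing_const R p s2 d Omega P X0); split; [|split].
- exact: clearing_const_gt0.
- exact: clearing_const_cvgy.
- move=> r delta r0 delta0; split; [|split].
  + exact: (clearing_lower_bound hp_ge0 hp_sum hp1 hp_mean hp_var hX0_meas hX0_m4 hX0_mean1
      hX0_mean2 hX0_cov11 hX0_cov22 hX0_cov12 hxi_meas hN_meas hX_meas hpoisson indep
      hN_law hX_law r0 delta0).
  + exact: limn_einf_sup.
  + move=> d' Omega' P' Y hY.
    exact: (clearing_upper_bound hp_ge0 hp_sum hp1 hp_mean hp_var hX0_meas hX0_m4 hX0_mean1
      hX0_mean2 hX0_cov11 hX0_cov22 hX0_cov12 r0 hY hxi_meas hN_meas hX_meas hpoisson indep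
      hN_law hX_law).
Qed.
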